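(* Let $\mathbb{B}$ be a real Banach space with norm $\|\cdot\|$. Let $\mathbf{G}:\mathbb{B}\to\mathbb{B}$ be a Borel measurable function for which there exist $\tau>0$, $\rho<1$ and $\mathbf{x}^*\in\mathbb{B}$ such that $$\|\mathbf{x}-\mathbf{x}^*-\tau\,\mathbf{G}(\mathbf{x})\|\le\rho\,\|\mathbf{x}-\mathbf{x}^*\|\qquad\text{for all }\mathbf{x}\in\mathbb{B}.$$ Let $\{\beta_n:n\ge 0\}\subseteq(0,1)$ satisfy $\lim_{n\to\infty}\beta_n=0$ and $\sum_{n=0}^\infty\beta_n=\infty$. For $n\ge 0$ let $\lambda_n:\mathbb{B}^{n+1}\to\mathbb{R}$ be Borel measurable functions such that, for some constant $C$, $$|\lambda_n(\mathbf{u}_0,\mathbf{u}_1,\ldots,\mathbf{u}_n)|\le C\bigl(1+\max_{0\le k\le n}\|\mathbf{u}_k\|\bigr)\qquad\text{for all } n\ge 0 \text{ and all } \mathbf{u}_0,\ldots,\mathbf{u}_n\in\mathbb{B}.$$ Let $\{\mathbf{W}_n:n\ge 1\}$ be a sequence of independent $\mathbb{B}$-valued random variables. Let $\mathbf{x}_0\in\mathbb{B}$ be fixed, let $\mathbf{X}_0=\mathbf{x}_0$, and for $n\ge 0$ let $$\mathbf{X}_{n+1}=\mathbf{X}_n-\beta_n\bigl(\mathbf{G}(\mathbf{X}_n)+\lambda_n(\mathbf{X}_0,\ldots,\mathbf{X}_n)\,\mathbf{W}_{n+1}\bigr).$$ Suppose that at least one of the following three conditions holds. (J1) $\{\mathbf{W}_n:n\ge1\}$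 are i.i.d. with $\mathbb{E}(\|\mathbf{W}_1\|^2)<\infty$ and $\mathbb{E}(\mathbf{W}_1)=0$, and $\sum_{n=0}^\infty\beta_n^2<\infty$. (J2) $\{\mathbf{W}_n:n\ge1\}$ are i.i.d. and, for some $\alpha\in[1,2)$ and $0<D<\infty$, one has $\mathbb{E}(\|\mathbf{W}_1\|^\alpha)<\infty$, $\mathbb{E}(\mathbf{W}_1)=0$, and $\beta_n\le D\,n^{-1/\alpha}$ for all $n\ge 1$. (J3) $\mathbb{E}[\mathbf{W}_n]=0$ for all $n\ge1$; the sequence $\{\mathbf{W}_n:n\ge 1\}$ is tight, i.e. for every $\epsilon>0$ there is a compact set $\mathbf{K}_\epsilon\subseteq\mathbb{B}$ such that $\mathbb{P}(\mathbf{W}_n\in\mathbf{K}_\epsilon)\ge 1-\epsilon$ for all $n\ge 1$; and for some $\alpha\in(1,2]$ one has $\sup_{n\ge1}\mathbb{E}(\|\mathbf{W}_n\|^\alpha)<\infty$ and $\sum_{n=0}^\infty\beta_n^\alpha<\infty$. Then $\{\mathbf{X}_n:n\ge 0\}$ converges to $\mathbf{x}^*$ in norm almost surely.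
   Context: No geometric condition (such as type, separability or the Radon–Nikodym property) is imposed on the Banach space $\mathbb{B}$. All random variables are defined on one probability space with probability $\mathbb{P}$ and expectation $\mathbb{E}$. A $\mathbb{B}$-valued random variable is a strongly (Bochner) measurable map into $\mathbb{B}$, and $\mathbb{E}$ of an integrable $\mathbb{B}$-valued random variable is its Bochner integral. *)

(* Defs.v *)
(* MathComp / MathComp-Analysis *)
From HB Require Import structures.
From mathcomp Require Export all_boot all_order all_algebra.
From mathcomp Require Export all_classical all_reals all_analysis.
Export Order.TTheory GRing.Theory Num.Theory.
Export numFieldNormedType.Exports.

Set Implicit Arguments.
Unset Strict Implicit.
Unset Printing Implicit Defensive.

Local Open Scope classical_set_scope.
Local Open Scope ring_scope.

Definition borel_set (X : topologicalType) : set (set X) := <<s @open X >>.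

Definition borel_fun (X Y : topologicalType) (f : X -> Y) : Prop :=
  forall A : set Y, borel_set A -> borel_set (f @^-1` A).

Section random_elements.
Context {d : measure_display} {T : measurableType d} {R : realType}.
Context (P : probability T R) (B : completeNormedModType R).

Definition simple_map (s : T -> B) : Prop :=
  finite_set (range s) /\ forall v : B, measurable (s @^-1` [set v]).

(* Convergence is required at every point, not merely almost everywhere, so
   that preimages of Borel sets are measurable without completing P. *)
Definition strongly_measurable (f : T -> B) : Prop :=
  exists s : nat -> T -> B,
    (forall k, simple_map (s k)) /\
    (forall w, s k w @[k --> \oo] --> f w).

Definition simple_integral (s : T -> B) : B :=
  \sum_(v \in range s) fine (P (s @^-1` [set v])) *: v.

(* "f is Bochner integrable and its Bochner integral is v". *)
Definition has_bochner_integral (f : T -> B) (v : B) : Prop :=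
  strongly_measurable f /\
  exists s : nat -> T -> B,
    [/\ forall k, simple_map (s k),
        (\int[P]_w `|f w - s k w|%:E)%E @[k --> \oo] --> 0%E
      & simple_integral (s k) @[k --> \oo] --> v].

Definition mutually_independent (Y : nat -> T -> B) : Prop :=
  forall (J : seq nat) (A : nat -> set B),
    uniq J -> (forall i, borel_set (A i)) ->
    P (\bigcap_(i in [set` J]) (Y i @^-1` A i)) =
    (\prod_(i <- J) P (Y i @^-1` A i))%E.

Definition identically_distributed (Y : nat -> T -> B) : Prop :=
  forall (i j : nat) (A : set B), borel_set A ->
    P (Y i @^-1` A) = P (Y j @^-1` A).

Definition iid (Y : nat -> T -> B) : Prop :=
  mutually_independent Y /\ identically_distributed Y.

Definition tight (Y : nat -> T -> B) : Prop :=
  forall eps : R, 0 < eps ->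
    exists K : set B, compact K /\
      forall n, ((1 - eps)%:E <= P (Y n @^-1` K))%E.

End random_elements.

(* Main.v *)
(** Put [gamma_n = beta_n / tau] and [M_n = 1 + max_{k <= n} |X_k|]. Then
    [X_{n+1} - xstar = (1 - gamma_n) (X_n - xstar) + gamma_n h_n + gamma_n M_n e_n] with
    [|h_n| <= rho |X_n - xstar|] and [e_n = a_n W_{n+1}], where [a_n] is bounded and
    depends on the past only. Let [u] be the weighted average of the noise,
    [u_{n+1} = (1 - gamma_n) u_n + gamma_n e_n]. If [u] tends to 0, then
    subtracting [M_n u_n] from [X_n - xstar] leaves a perturbed contraction, which
    forces [X] to be bounded and then to converge.

    No geometry of the space is needed for [u]: replacing [W] by its projection on
    finitely many centers reduces the question to scalar martingales with square
    summable increments, and each of the three conditions makes the residual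
    uniformly small in L^1 and the mean of the projection uniformly small.

    The space need not be separable, so [G (X_n)] could a priori fail to be
    strongly measurable. It is almost surely separably valued: otherwise a
    disjoint family of null sets, all of whose unions are Borel, would have a union
    of positive probability; a Cantor scheme then yields continuum many members,
    and diagonalizing against the continuum many traces of Borel sets produces a
    union which is not Borel. *)

Require Import Defs.
From mathcomp Require Import ring lra measurable_realfun.

Set Implicit Arguments.
Unset Strict Implicit.
Unset Printing Implicit Defensive.

Local Open Scope classical_set_scope.
Local Open Scope ring_scope.

(** * Perturbed averaging recursions *)

(** [lambda] grows with the trajectory, so the noise is not a priori square integrable. Dividing by
    the running maximum [M_n] makes the multiplier bounded; as [M_n] is nondecreasing, restoring it
    costs only a telescoping correction. A Banach norm has no orthogonality, hence no general
    maximal inequality of second order: convergence is proved for the scalar coefficients of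
    finitely many centers and for the norm of what they miss. That norm may have infinite variance,
    so it is truncated where [beta_n |W| <= 1]. The three conditions act through common facts:
    summability of [beta_n^2], summability of [E min(1, (beta_n |W|)^2)], and, for each mesh, one
    finite list of centers valid for all [n]. Predictability of the multiplier is the other
    obstacle: without separability the Borel sets of a product may exceed the product sigma-algebra,
    and [lambda] is only Borel. Hence the iterates are replaced by strongly measurable versions
    adapted to the past, which pair and add well. *)

Section recursions.
Context {R : realType}.
Implicit Types (q k g : nat -> R) (delta eta : R).

(** One factor at a time, [(1 - k) (1 + s + k) <= 1 + s]. Divergence of the sum thus gives decay of
    the product with an explicit rate and without logarithms. *)
Lemma prodB1_sum_le1 k N n : (forall i, (N <= i)%N -> 0 <= k i <= 1) ->
  (\prod_(N <= i < n) (1 - k i)) * (1 + \sum_(N <= i < n) k i) <= 1.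
Proof.
move=> k01; elim: n => [|n IH]; first by rewrite !big_geq// addr0 mulr1.
have [nN|Nn] := ltnP n N; first by rewrite !big_geq// addr0 mulr1.
rewrite !big_nat_recr//= -/(index_iota N n).
apply: le_trans IH.
have /andP[k0 k1] := k01 _ Nn.
have p0 : 0 <= \prod_(N <= i < n) (1 - k i).
  rewrite big_nat_cond; apply: prodr_ge0 => i; rewrite andbT => /andP[Ni _].
  by rewrite subr_ge0; have /andP[] := k01 _ Ni.
have s0 : 0 <= \sum_(N <= i < n) k i.
  rewrite big_nat_cond; apply: sumr_ge0 => i; rewrite andbT => /andP[Ni _].
  by have /andP[] := k01 _ Ni.
rewrite -mulrA ler_wpM2l//.
nra.
Qed.

Lemma sum_nat_tail k N n : (N <= n)%N ->
  \sum_(N <= i < n) k i = \sum_(0 <= i < n) k i - \sum_(0 <= i < N) k i.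
Proof. by move=> Nn; rewrite [in RHS](big_cat_nat (n := N))//= addrAC subrr add0r. Qed.

(** Past an index [N0] where the tail of [g] is below [eta / 2], the excess over [delta] is at most
    its initial size times the product of the [1 - k i], plus that tail. [q] may be negative: in one
    use it is a norm minus a signed sequence. *)
Lemma contracting_recursion_le q k g delta N eta :
  (forall n, (N <= n)%N -> 0 <= k n <= 1) -> series k n @[n --> \oo] --> +oo ->
  (forall n, (N <= n)%N -> q n.+1 <= (1 - k n) * q n + k n * delta + g n) ->
  (forall n, 0 <= g n) -> cvgn (series g) ->
  0 < eta -> \forall n \near \oo, q n <= delta + eta.
Proof.
move=> k01 kdiv qrec g0 /cauchy_cvgP/cauchy_seriesP gC eta0.
have eta20 : 0 < eta / 2 by rewrite divr_gt0.
have [[A B]/= [[N1 _ N1A] [N2 _ N2B]] AB] := gC _ eta20.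
pose N0 := maxn N (maxn N1 N2).
have NN0 : (N <= N0)%N by rewrite leq_maxl.
have gs n : (N0 <= n)%N -> \sum_(N0 <= i < n) g i <= eta / 2.
  move=> N0n; apply/ltW/(le_lt_trans (ler_norm _))/(AB (N0, n)); split => /=.
    by apply: N1A => /=; rewrite /N0 !leq_max leqnn orbT.
  by apply: N2B => /=; apply: leq_trans N0n; rewrite /N0 !leq_max leqnn !orbT.
have key n : (N0 <= n)%N -> q n <= delta + `|q N0 - delta| *
    (\prod_(N0 <= i < n) (1 - k i)) + \sum_(N0 <= i < n) g i.
  elim: n => [|n IH].
    rewrite leqn0 => /eqP N00; rewrite N00 !big_geq// mulr1 addr0.
    by rewrite -lerBlDl ler_norm.
  rewrite leq_eqVlt => /predU1P[<-|].
    by rewrite !big_geq// mulr1 addr0 -lerBlDl ler_norm.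
  rewrite ltnS => N0n; have Nn := leq_trans NN0 N0n.
  rewrite !big_nat_recr//=; apply: le_trans (qrec _ Nn) _.
  have /andP[k0 k1] := k01 _ Nn.
  have k1' : 0 <= 1 - k n by rewrite subr_ge0.
  have := ler_wpM2l k1' (IH N0n).
  have : 0 <= \sum_(N0 <= i < n) g i by apply: sumr_ge0.
  move: (\prod_(_ <= _ < _) _) (\sum_(_ <= _ < _) _) => p s s0 H.
  have ks : 0 <= k n * s by rewrite mulr_ge0.
  nra.
(* Once the sum of [k] over [[N0, n)] reaches the second summand of this threshold, the bound on the
   product makes the initial excess at most [eta / 2]. *)
have /cvgryPge/(_ (\sum_(0 <= i < N0) k i + `|q N0 - delta| / (eta / 2)))[n0 _ Hn0] := kdiv.
exists (maxn N0 n0) => // n /=; rewrite geq_max => /andP[N0n n0n].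
apply: le_trans (key _ N0n) _.
have := gs _ N0n.
suff : `|q N0 - delta| * \prod_(N0 <= i < n) (1 - k i) <= eta / 2.
  by move=> ? ?; lra.
have sk : `|q N0 - delta| / (eta / 2) <= \sum_(N0 <= i < n) k i.
  by rewrite sum_nat_tail// lerBrDl; exact: Hn0.
have := prodB1_sum_le1 n (fun i Ni => k01 i (leq_trans NN0 Ni)).
rewrite ler_pdivrMr// in sk.
have : 0 <= \prod_(N0 <= i < n) (1 - k i).
  rewrite big_nat_cond; apply: prodr_ge0 => i; rewrite andbT => /andP[Ni _].
  by rewrite subr_ge0; have /andP[] := k01 _ (leq_trans NN0 Ni).
move: sk.
move: (\prod_(_ <= _ < _) _) (\sum_(_ <= _ < _) _) => p s sk p0 ps.
apply: le_trans (ler_wpM2r p0 sk) _.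
rewrite mulrAC -[leRHS]mul1r ler_wpM2r//; first exact: ltW.
by apply: le_trans ps; rewrite mulrC mulrDr mulr1 lerDr.
Qed.

End recursions.

Section vector_recursions.
Context {R : realType} {V : completeNormedModType R}.
Implicit Types (u e x h : nat -> V) (gam : nat -> R).

(** Subtracting from [u n] the partial sum of [gam i *: e i] from a late [N] on leaves a recursion
    driven by that partial sum, which the Cauchy criterion makes small. Conditional convergence
    suffices, and a martingale offers no more. *)
Lemma averaging_cvg0 gam e u :
  (\forall n \near \oo, 0 <= gam n <= 1) ->
  series gam n @[n --> \oo] --> +oo ->
  (forall n, u n.+1 = (1 - gam n) *: u n + gam n *: e n) ->
  cvgn (series (fun n => gam n *: e n)) -> u n @[n --> \oo] --> (0 : V).
Proof.
move=> [N0 _ g01] gdiv urec /cauchy_cvgP/cauchy_seriesP eC.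
apply/cvgr0Pnorm_le => eps eps0.
have eps30 : 0 < eps / 3 by rewrite divr_gt0.
have [[A B]/= [[N1 _ N1A] [N2 _ N2B]] AB] := eC _ eps30.
pose N := maxn N0 (maxn N1 N2).
have SN n : (N <= n)%N -> `|\sum_(N <= i < n) gam i *: e i| <= eps / 3.
  move=> Nn; apply/ltW/(AB (N, n)); split => /=.
    by apply: N1A => /=; rewrite /N !leq_max leqnn orbT.
  by apply: N2B => /=; apply: leq_trans Nn; rewrite /N !leq_max leqnn !orbT.
pose p n := u n - \sum_(N <= i < n) gam i *: e i.
have gN n : (N <= n)%N -> 0 <= gam n <= 1.
  by move=> Nn; apply: g01 => /=; apply: leq_trans Nn; rewrite /N leq_maxl.
have prec n : (N <= n)%N ->
    `|p n.+1| <= (1 - gam n) * `|p n| + gam n * (eps / 3) + 0.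
  move=> Nn; have /andP[g0 g1] := gN _ Nn.
  have -> : p n.+1 = (1 - gam n) *: p n - gam n *: (\sum_(N <= i < n) gam i *: e i).
    rewrite /p big_nat_recr//= urec scalerBr !scalerBl !scale1r opprD !addrA.
    rewrite opprB addrA.
    move: (\sum_(_ <= _ < _) _) => S.
    rewrite -!addrA; congr (_ + (_ + _)).
    by rewrite addrCA subrr addrCA subrr.
  rewrite addr0; apply: le_trans (ler_normB _ _) _.
  rewrite !normrZ (ger0_norm g0) ger0_norm ?subr_ge0// lerD2l ler_wpM2l//.
  exact: SN.
have eps00 : cvgn (series (fun _ : nat => 0 : R)).
  rewrite (_ : series _ = cst 0); first exact: is_cvg_cst.
  by apply/funext => n; rewrite /series/= big1.
have [N3 _ H3] := contracting_recursion_le gN gdiv prec (fun=> lexx 0) eps00 eps30.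
exists (maxn N N3) => // n /=; rewrite geq_max => /andP[Nn N3n].
have := H3 _ N3n; have := SN _ Nn => H1 H2.
rewrite -(subrK (\sum_(N <= i < n) gam i *: e i) (u n)).
apply: le_trans (ler_normD _ _) _.
by move: H1 H2; rewrite /p; lra.
Qed.

End vector_recursions.

Section perturbed_contraction.
Context {R : realType} {V : completeNormedModType R}.
Implicit Types (u e x h : nat -> V) (gam : nat -> R).

(** The averages [v] of [c] and [r] of [g] vanish by [averaging_cvg0], and [|u - v| - r] contracts
    up to [eps]. Since [g] may be signed and [gam n * g n] only conditionally summable, [g] is
    averaged rather than bounded. *)
Lemma averaging_approx_cvg0 gam e u :
  (\forall n \near \oo, 0 <= gam n <= 1) ->
  series gam n @[n --> \oo] --> +oo ->
  (forall n, u n.+1 = (1 - gam n) *: u n + gam n *: e n) ->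
  (forall eps, 0 < eps -> exists (c : nat -> V) (g : nat -> R),
    [/\ cvgn (series (fun n => gam n *: c n)),
        cvgn (series (fun n => gam n * g n)) &
        \forall n \near \oo, `|e n - c n| <= eps + g n]) ->
  u n @[n --> \oo] --> (0 : V).
Proof.
move=> g01 gdiv urec H; apply/cvgr0Pnorm_le => eps eps0.
have eps40 : 0 < eps / 4 by rewrite divr_gt0.
have [c [g [cC gC [N1 _ ecg]]]] := H _ eps40.
pose v := fix v n : V := if n is m.+1 then (1 - gam m) *: v m + gam m *: c m else 0.
pose r := fix r n : R := if n is m.+1 then (1 - gam m) * r m + gam m * g m else 0.
have v0 : v n @[n --> \oo] --> (0 : V) by apply: averaging_cvg0 cC.
have r0 : r n @[n --> \oo] --> (0 : R).
  by have := @averaging_cvg0 R R^o gam g r g01 gdiv (fun=> erefl) gC.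
have [N2 _ g01'] := g01.
pose q n := `|u n - v n| - r n.
pose N := maxn N1 N2.
have gN n : (N <= n)%N -> 0 <= gam n <= 1.
  by move=> Nn; apply: g01' => /=; apply: leq_trans Nn; rewrite leq_maxr.
have qrec n : (N <= n)%N ->
    q n.+1 <= (1 - gam n) * q n + gam n * (eps / 4) + 0.
  move=> Nn; have /andP[g0 g1] := gN _ Nn; rewrite /q urec /=.
  have -> : (1 - gam n) *: u n + gam n *: e n -
    ((1 - gam n) *: v n + gam n *: c n) =
    (1 - gam n) *: (u n - v n) + gam n *: (e n - c n).
    by rewrite !scalerBr opprD !addrA; congr (_ - _); rewrite addrAC.
  have ec : `|e n - c n| <= eps / 4 + g n.
    by apply: ecg => /=; apply: leq_trans Nn; rewrite leq_maxl.
  have := ler_normD ((1 - gam n) *: (u n - v n)) (gam n *: (e n - c n)).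
  rewrite !normrZ (ger0_norm g0) (ger0_norm (_ : 0 <= 1 - gam n)) ?subr_ge0//.
  have := ler_wpM2l g0 ec.
  by move=> ? ?; lra.
have eps00 : cvgn (series (fun _ : nat => 0 : R)).
  rewrite (_ : series _ = cst 0); first exact: is_cvg_cst.
  by apply/funext => n; rewrite /series/= big1.
have := contracting_recursion_le gN gdiv qrec (fun=> lexx 0) eps00 eps40.
move/cvgr0Pnorm_le : v0 => /(_ _ eps40).
move/cvgr0Pnorm_le : r0 => /(_ _ eps40).
apply: filterS3 => n; rewrite /q => rn vn qn.
rewrite -(subrK (v n) (u n)); apply: le_trans (ler_normD _ _) _.
have := ler_norm (r n).
by move: qn; lra.
Qed.

(** [M] abstracts the running maximum. Removing [M n *: u n] from [x n] costs
    [(M n.+1 - M n) *: u n.+1], whose coefficients telescope; boundedness of [x] is shown before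
    convergence because it makes their sum finite. *)
Lemma perturbed_contraction_cvg0 gam rho K x h e u (M : nat -> R) :
  (\forall n \near \oo, 0 <= gam n <= 1) ->
  series gam n @[n --> \oo] --> +oo ->
  0 <= rho < 1 ->
  (forall n, x n.+1 =
     (1 - gam n) *: x n + gam n *: h n + (gam n * M n) *: e n) ->
  (forall n, `|h n| <= rho * `|x n|) ->
  0 <= M 0%N -> (forall n, M n <= M n.+1) ->
  (forall n L, (forall k, (k <= n)%N -> `|x k| <= L) -> M n <= K + L) ->
  (forall n, u n.+1 = (1 - gam n) *: u n + gam n *: e n) ->
  u n @[n --> \oo] --> (0 : V) -> x n @[n --> \oo] --> (0 : V).
Proof.
move=> g01 gdiv /andP[rho0 rho1] xrec hx M00 Mnd MK urec u0.
have M0 n : 0 <= M n by elim: n => // n IH; exact: le_trans (Mnd n).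
pose z n := x n - M n *: u n.
have zrec n : z n.+1 =
    (1 - gam n) *: z n + gam n *: h n - (M n.+1 - M n) *: u n.+1.
  have -> : z n.+1 = x n.+1 - M n *: u n.+1 - (M n.+1 - M n) *: u n.+1.
    by rewrite /z -addrA -opprD -scalerDl [M n + _]addrC subrK.
  congr (_ - _); rewrite xrec urec scalerDr !scalerA [gam n * M n]mulrC opprD.
  rewrite addrA [LHS]addrAC addrK addrAC /z scalerBr scalerA.
  by rewrite [M n * (1 - _)]mulrC.
have zrec_le n delta : 0 <= gam n <= 1 -> `|u n.+1| <= delta ->
   `|z n.+1| <= (1 - gam n) * `|z n| + gam n * (rho * `|x n|)
                 + delta * (M n.+1 - M n).
  move=> /andP[g0 g1] ud; rewrite zrec; apply: le_trans (ler_normB _ _) _.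
  have Mn : 0 <= M n.+1 - M n by rewrite subr_ge0.
  rewrite lerD//; last by rewrite normrZ (ger0_norm Mn) mulrC ler_wpM2r.
  apply: le_trans (ler_normD _ _) _.
  rewrite !normrZ (ger0_norm g0) (ger0_norm (_ : 0 <= 1 - gam n)) ?subr_ge0//.
  by rewrite lerD2l ler_wpM2l.
have [L L0 xL] : exists2 L, 0 <= L & forall n, `|x n| <= L.
  (* The noise enters twice, in the bound on [z] and in passing from [z] to [x], each time with
     weight [delta] times [M]; so [2 * delta] has to stay below [1 - rho]. *)
  pose delta := (1 - rho) / 4.
  have delta0 : 0 < delta by rewrite divr_gt0// subr_gt0.
  have [N1 _ g01'] := g01.
  move/cvgr0Pnorm_le : (u0) => /(_ _ delta0)[N2 _ uN].
  pose N := maxn N1 N2.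
  have gN n : (N <= n)%N -> 0 <= gam n <= 1.
    by move=> Nn; apply: g01' => /=; apply: leq_trans Nn; rewrite leq_maxl.
  have ud n : (N <= n)%N -> `|u n| <= delta.
    by move=> Nn; apply: uN => /=; apply: leq_trans Nn; rewrite leq_maxr.
  pose m := \big[Num.max/0]_(k < N.+1) `|x k|.
  (* The second argument solves [|z N| + 2 delta |K| + (rho + 2 delta) L = L], a level that the
     recursion cannot cross. *)
  pose L := Num.max m ((`|z N| + 2 * delta * `|K|) / (1 - rho - 2 * delta)).
  have den0 : 0 < 1 - rho - 2 * delta by rewrite /delta; lra.
  have mL : m <= L by rewrite le_max lexx.
  have L0 : 0 <= L.
    rewrite le_max; apply/orP; right; rewrite divr_ge0 ?(ltW den0)// addr_ge0//.
    by rewrite mulr_ge0// mulr_ge0// ltW.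
  have HL : `|z N| + 2 * delta * `|K| <= (1 - rho - 2 * delta) * L.
    by rewrite [leRHS]mulrC -ler_pdivrMr// le_max lexx orbT.
  have inv n : (N <= n)%N -> (forall k, (k <= n)%N -> `|x k| <= L) /\
      `|z n| <= `|z N| + rho * L + delta * (M n - M N).
    elim: n => [|n IH].
      rewrite leqn0 => /eqP N0; split.
        move=> k; rewrite leqn0 => /eqP->; apply: le_trans mL.
        by rewrite /m N0 big_ord_recl le_max lexx.
      by rewrite N0 subrr mulr0 addr0 lerDl mulr_ge0.
    rewrite leq_eqVlt => /predU1P[<-|].
      split; last by rewrite subrr mulr0 addr0 lerDl mulr_ge0.
      move=> k kN; apply: le_trans mL.
      have kN' : (k < N.+1)%N by [].
      by have := le_bigmax 0 (fun k : 'I_N.+1 => `|x k|) (Ordinal kN').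
    rewrite ltnS => Nn; have [xk zn] := IH Nn.
    have zn1 : `|z n.+1| <= `|z N| + rho * L + delta * (M n.+1 - M N).
      apply: le_trans (zrec_le n delta (gN _ Nn) (ud _ (leqW Nn))) _.
      have /andP[g0 g1] := gN _ Nn.
      have g1' : 0 <= 1 - gam n by rewrite subr_ge0.
      have H1 := ler_wpM2l g1' zn.
      have H2 : gam n * (rho * `|x n|) <= gam n * (rho * L).
        by rewrite ler_wpM2l// ler_wpM2l// xk.
      have H3 : 0 <= gam n * `|z N| by rewrite mulr_ge0.
      have H4 : 0 <= gam n * (delta * (M n - M N)).
        rewrite mulr_ge0// mulr_ge0 ?(ltW delta0)// subr_ge0.
        by move/nondecreasing_seqP : (Mnd); apply.
      lra.
    split=> // k; rewrite leq_eqVlt => /predU1P[->|]; last by rewrite ltnS; exact: xk.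
    (* If [x n.+1] exceeded [L] it would be the largest so far, so [M n.+1 <= K + |x n.+1|], and the
       estimates contradict the choice of [L]. *)
    have [//|Lx] := leP.
    have : M n.+1 <= K + `|x n.+1|.
      apply: MK => k'; rewrite leq_eqVlt => /predU1P[->//|k'n].
      by apply: le_trans (ltW Lx); exact: xk.
    have xz : `|x n.+1| <= `|z n.+1| + M n.+1 * delta.
      rewrite -(subrK (M n.+1 *: u n.+1) (x n.+1)).
      apply: le_trans (ler_normD _ _) _; rewrite lerD2l normrZ ger0_norm//.
      by rewrite ler_wpM2l// ud// leqW.
    move=> MKx.
    have H1 : M n.+1 * delta <= (`|K| + `|x n.+1|) * delta.
      rewrite ler_wpM2r ?(ltW delta0)//; apply: le_trans MKx _.
      by rewrite lerD2r ler_norm.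
    have H2 : 0 <= delta * M N by rewrite mulr_ge0// ltW.
    have H3 : rho * L + 2 * delta * L < rho * L + 2 * delta * `|x n.+1|.
      by rewrite ltrD2l ltr_pM2l// mulr_gt0.
    have H4 : (1 - rho - 2 * delta) * L < (1 - rho - 2 * delta) * `|x n.+1|.
      by rewrite ltr_pM2l.
    have H5 : rho * L <= rho * `|x n.+1| by rewrite ler_wpM2l// ltW.
    lra.
  exists L => // n; have [Nn|nN] := leqP N n; first by have [+ _] := inv n Nn; apply.
  by have [+ _] := inv N (leqnn N); apply; exact: ltnW.
pose Mi := `|K| + L.
have Mi0 : 0 <= Mi by rewrite addr_ge0.
have MMi n : M n <= Mi.
  by apply: le_trans (MK n L _) _ => //; rewrite lerD2r ler_norm.
have dMC : cvgn (series (fun n => M n.+1 - M n)).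
  rewrite (_ : series _ = (fun n => M n - M 0%N)).
    apply: is_cvgB; last exact: is_cvg_cst.
    apply: nondecreasing_is_cvgn; first exact/nondecreasing_seqP.
    by exists Mi => _ [n _ <-].
  by apply/funext => n; rewrite /series/= telescope_sumr.
apply/cvgr0Pnorm_le => eps eps0.
(* Relative to the contraction rate [(1 - rho) * gam n], the error made in replacing [x] by [z] then
   weighs at most [eps / 4]. *)
pose delta := eps / 4 * (1 - rho) / (Mi + 1).
have r10 : 0 < 1 - rho by rewrite subr_gt0.
have delta0 : 0 < delta by rewrite !divr_gt0 ?mulr_gt0// ?divr_gt0// ltr_wpDl.
have dM : delta * Mi <= eps / 4 * (1 - rho).
  rewrite /delta -mulrA ler_piMr//; first by rewrite mulr_ge0// ltW// divr_gt0.
  by rewrite mulrC ler_pdivrMr ?mul1r ?lerDl// ltr_wpDl.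
have [N1 _ g01'] := g01.
move/cvgr0Pnorm_le : (u0) => /(_ _ delta0)[N2 _ uN].
pose N := maxn N1 N2.
have gN n : (N <= n)%N -> 0 <= gam n <= 1.
  by move=> Nn; apply: g01' => /=; apply: leq_trans Nn; rewrite leq_maxl.
have ud n : (N <= n)%N -> `|u n| <= delta.
  by move=> Nn; apply: uN => /=; apply: leq_trans Nn; rewrite leq_maxr.
have xz n : (N <= n)%N -> `|x n| <= `|z n| + delta * Mi.
  move=> Nn; rewrite -[in leLHS](subrK (M n *: u n) (x n)).
  apply: le_trans (ler_normD _ _) _; rewrite lerD2l normrZ ger0_norm//.
  by rewrite mulrC ler_pM// ud.
have kN n : (N <= n)%N -> 0 <= (1 - rho) * gam n <= 1.
  move=> Nn; have /andP[g0 g1] := gN _ Nn; rewrite mulr_ge0//=; last exact: ltW.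
  by rewrite mulr_ile1// ?(ltW r10)// lerBlDr lerDl.
have kdiv : series (fun n => (1 - rho) * gam n) n @[n --> \oo] --> +oo.
  apply/cvgryPge => A; move/cvgryPge : gdiv => /(_ (A / (1 - rho))).
  apply: filterS => n; rewrite ler_pdivrMr// mulrC /series/= => /le_trans; apply.
  by rewrite mulr_sumr.
have zle n : (N <= n)%N -> `|z n.+1| <= (1 - (1 - rho) * gam n) * `|z n| +
     (1 - rho) * gam n * (eps / 4) + delta * (M n.+1 - M n).
  move=> Nn; apply: le_trans (zrec_le n delta (gN _ Nn) (ud _ (leqW Nn))) _.
  have /andP[g0 g1] := gN _ Nn.
  rewrite lerD2r.
  have : gam n * (rho * `|x n|) <= gam n * (rho * (`|z n| + delta * Mi)).
    by rewrite ler_wpM2l// ler_wpM2l// xz.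
  have : gam n * (rho * (delta * Mi)) <= gam n * (eps / 4 * (1 - rho)).
    rewrite ler_wpM2l//; apply: le_trans dM.
    by rewrite ler_piMl ?(ltW rho1)// mulr_ge0// ltW.
  lra.
have dM0 n : 0 <= delta * (M n.+1 - M n) by rewrite mulr_ge0 ?subr_ge0// ltW.
have dMC' : cvgn (series (fun n => delta * (M n.+1 - M n))).
  exact: (is_cvg_seriesZ (k := delta) dMC).
have [N3 _ zN] := contracting_recursion_le kN kdiv zle dM0 dMC' (divr_gt0 eps0 (ltr0n _ 4)).
exists (maxn N N3) => // n /=; rewrite geq_max => /andP[Nn N3n].
apply: le_trans (xz _ Nn) _; have := zN _ N3n.
have : eps / 4 * (1 - rho) <= eps / 4 by rewrite ler_piMr ?(ltW (divr_gt0 _ _))// lerBlDr lerDl.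
lra.
Qed.

End perturbed_contraction.

(** * Countable networks and strong measurability *)

Section networks.
Context {d : measure_display} {T : measurableType d}.

(* Strong measurability of [f] in a form that makes sense for any topological
   target and is stable under pairing and continuous images. *)
Definition networked (Z : topologicalType) (f : T -> Z) : Prop :=
  exists N : nat -> set T, (forall i, measurable (N i)) /\
    forall w O, nbhs (f w) O -> exists i, N i w /\ N i `<=` f @^-1` O.

Lemma networked_open (Z : topologicalType) (f : T -> Z) O :
  networked f -> open O -> measurable (f @^-1` O).
Proof.
move=> [N [mN Nf]] oO.
have -> : f @^-1` O = \bigcup_i (if `[< N i `<=` f @^-1` O >] then N i else set0).
  apply/seteqP; split=> [w Ow|w [i _]].
    have [i [Niw NO]] := Nf w O (open_nbhs_nbhs (conj oO Ow)).
    by exists i => //; rewrite asboolT.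
  by case: asboolP => // + Niw; apply.
by apply: bigcupT_measurable => i; case: ifP.
Qed.

Lemma measurable_preimage_borel (Z : topologicalType) (f : T -> Z) A :
  (forall O, open O -> measurable (f @^-1` O)) -> borel_set A ->
  measurable (f @^-1` A).
Proof.
move=> mf; apply: (@smallest_sub _ _ _ [set A | measurable (f @^-1` A)]) => //.
split; first by rewrite /= preimage_set0.
  by move=> X /= mX; rewrite setTD preimage_setC; exact: measurableC.
by move=> X /= mX; rewrite preimage_bigcup; exact: bigcupT_measurable.
Qed.

Lemma networked_borel (Z : topologicalType) (f : T -> Z) A :
  networked f -> borel_set A -> measurable (f @^-1` A).
Proof. by move=> Nf; apply: measurable_preimage_borel => O; exact: networked_open. Qed.

Lemma networked_cst (Z : topologicalType) (z : Z) : networked (fun _ : T => z).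
Proof.
exists (fun=> setT); split=> [_|w O /nbhs_singleton Oz]; first exact: measurableT.
by exists 0%N; split.
Qed.

Lemma networked_comp (Y Z : topologicalType) (g : Y -> Z) (f : T -> Y) :
  continuous g -> networked f -> networked (g \o f).
Proof.
move=> cg [N [mN Nf]]; exists N; split=> // w O /cg gO.
exact: Nf gO.
Qed.

(** For nonseparable targets the Borel sets of a product need not be generated by rectangles, so
    measurability of the coordinates says little about the pair. Networks do pair, which is the
    reason for working with them. *)
Lemma networked_pair (Y Z : topologicalType) (f : T -> Y) (g : T -> Z) :
  networked f -> networked g -> networked (fun w => (f w, g w)).
Proof.
move=> [N [mN Nf]] [M [mM Mg]].
exists (fun k => if unpickle k is Some (i, j) then N i `&` M j else set0).
split=> [k|w O].
  by case: unpickle => [[i j]|//]; exact: measurableI.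
case=> -[U1 U2] /= [fO1 gO2] O12.
have [i [Ni NO1]] := Nf _ _ fO1; have [j [Mj MO2]] := Mg _ _ gO2.
exists (pickle (i, j)); rewrite pickleK; split=> // v [Niv Mjv].
by apply: O12; split; [exact: NO1|exact: MO2].
Qed.

(** Finite sequences of network indices are coded by integers. Boxes of neighborhoods generate a
    filter [F] that refines the neighborhoods in the product topology, so it suffices to find
    network sets inside a box. *)
Lemma networked_ptws (Z : topologicalType) n (f : 'I_n -> T -> Z) :
  (forall i, networked (f i)) ->
  networked (fun w => (fun i => f i w) : {ptws 'I_n -> Z}).
Proof.
move=> /choice[N Nf].
exists (fun k => if unpickle k is Some s then
  \bigcap_(i in [set: 'I_n]) N i (nth 0%N s i) else set0).
split=> [k|w O fO].
  case: unpickle => [s|//]; apply: fin_bigcap_measurable => //.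
  by move=> i _; have [] := Nf i.
pose F : set_system (prod_topology (fun _ : 'I_n => Z)) :=
  filter_from [set S : 'I_n -> set Z | forall i, nbhs (f i w) (S i)]
    (fun S => [set g | forall i, S i (g i)]).
have FF : Filter F.
  apply: filter_from_filter; first by exists (fun=> setT) => i; exact: filterT.
  move=> S1 S2 /= S1f S2f; exists (fun i => S1 i `&` S2 i).
    by move=> i /=; exact: filterI.
  by move=> g Sg; split=> i; have [] := Sg i.
have Ff : F --> ((fun i => f i w) : {ptws 'I_n -> Z}).
  apply/cvg_sup => t A [_ [[U Uop <-] Uf UA]].
  exists (fun i => if i == t then U else setT).
    by move=> i; case: eqP => [->|_]; [exact: open_nbhs_nbhs|exact: filterT].
  by move=> g /(_ t); rewrite eqxx => Ug; exact: UA.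
have [S Sf SO] := Ff _ fO.
have /choice[k kS] : forall i, exists k, N i k w /\ N i k `<=` f i @^-1` S i.
  by move=> i; have [_] := Nf i; apply; exact: Sf.
exists (pickle [seq k i | i <- enum 'I_n]); rewrite pickleK.
have nthk (i : 'I_n) : nth 0%N [seq k i | i <- enum 'I_n] i = k i.
  by rewrite (nth_map i) ?size_enum_ord// nth_ord_enum.
split=> [i _|v Nv]; first by rewrite nthk; have [] := kS i.
apply: SO => i; have [_] := kS i; apply.
by have := Nv i I; rewrite nthk.
Qed.

Lemma measurable_fun_open (R : realType) (f : T -> R) :
  (forall O, open O -> measurable (f @^-1` O)) -> measurable_fun setT f.
Proof.
move=> mf; apply: (measurability _ (measurable_realfun.RGenOInfty.measurableE R)).
move=> _ [_ [a ->] <-]; rewrite setTI; apply: mf.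
by rewrite set_itvE; exact: open_gt.
Qed.

Lemma networked_measurable_fun (R : realType) (f : T -> R) :
  networked f -> measurable_fun setT f.
Proof. by move=> Nf; apply: measurable_fun_open => O; exact: networked_open. Qed.

Lemma measurable_networked (R : realType) (f : T -> R) :
  measurable_fun setT f -> networked f.
Proof.
move=> mf.
exists (fun k => if unpickle k is Some (a, b) then
   f @^-1` `]ratr a, ratr b[ else set0).
split=> [k|w O /nbhs_ballP[e /= e0 eO]].
  case: unpickle => [[a b]|//].
  by rewrite -[X in measurable X]setTI; apply: mf.
have [a /itvP aw] : exists q : rat, ratr q \in `]f w - e, f w[.
  by apply: rat_in_itvoo; rewrite gtrBl.
have [b /itvP bw] : exists q : rat, ratr q \in `]f w, f w + e[.
  by apply: rat_in_itvoo; rewrite ltrDl.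
exists (pickle (a, b)); rewrite pickleK /=; split.
  by rewrite /= in_itv/= aw bw.
move=> v /=; rewrite in_itv/= => /andP[av vb]; apply: eO.
rewrite /ball/= ltr_distlC; apply/andP; split.
  by apply: lt_trans av; rewrite aw.
by apply: lt_trans vb _; rewrite bw.
Qed.

Lemma borel_fun_measurable (Z : topologicalType) (R : realType) (f : T -> Z)
  (g : Z -> R) : networked f -> borel_fun g -> measurable_fun setT (g \o f).
Proof.
move=> Nf mg; apply: measurable_fun_open => O oO.
rewrite comp_preimage; apply: networked_borel => //; apply: mg.
exact: sub_sigma_algebra.
Qed.

End networks.

Section strongly_measurable.
Context {d : measure_display} {T : measurableType d} {R : realType}.
Context {B : completeNormedModType R}.

Lemma simple_map_preimage (s : T -> B) A : simple_map s -> measurable (s @^-1` A).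
Proof.
move=> [fs ms].
rewrite (_ : _ @^-1` _ = \bigcup_(v in range s `&` A) s @^-1` [set v]).
  by apply: fin_bigcup_measurable => //; exact: finite_setIl.
by apply/seteqP; split=> [w Aw|w [v [_ Av] /= swv]]; [exists (s w)|rewrite /= swv].
Qed.

(** The point [f w] lies in [O] exactly when, for some [m], the [1 / (m + 1)]-ball around [s k w]
    lies in [O] from some [k] on. The margin is needed since limits of points of [O] may leave
    [O]. *)
Lemma strongly_measurable_open (f : T -> B) O :
  strongly_measurable f -> open O -> measurable (f @^-1` O).
Proof.
move=> [s [ss sf]] oO.
pose D k m := s k @^-1` [set v | ball v m.+1%:R^-1 `<=` O].
rewrite (_ : _ @^-1` _ = \bigcup_m \bigcup_N \bigcap_(k in [set k | (N <= k)%N]) D k m).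
  apply: bigcupT_measurable => m; apply: bigcupT_measurable => N.
  by apply: bigcap_measurable => [|k _]; [exists N => /=|exact: simple_map_preimage].
apply/seteqP; split=> w.
  move=> fO.
  have /nbhs_ballP[e /= e0 eO] : nbhs (f w) O by exact: open_nbhs_nbhs.
  have [m _ me] := near_infty_natSinv_lt (PosNum (divr_gt0 e0 (ltr0n R 2))).
  have /cvgrPdist_lt/(_ (e / 2))[|N _ Ns] := sf w; first by rewrite divr_gt0.
  exists m => //; exists N => // k /= Nk v bv; apply: eO.
  rewrite -!ball_normE /= in bv *; apply: le_lt_trans (ler_distD (s k w) _ _) _.
  rewrite (splitr e) ltrD ?(lt_trans bv)//; [exact: Ns Nk|exact: me (leqnn m)].
move=> [m _ [N _ Ns]] /=.
have m0 : 0 < m.+1%:R^-1 :> R by rewrite invr_gt0.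
have /cvgrPdist_lt/(_ _ m0)[N1 _ N1s] := sf w.
have := N1s (maxn N N1) (leq_maxr _ _).
move=> /= H; apply: (Ns (maxn N N1) (leq_maxl _ _)).
by rewrite -ball_normE /= distrC.
Qed.

Lemma strongly_measurable_countable_range (f : T -> B) :
  strongly_measurable f -> exists c : nat -> B,
    forall w e, 0 < e -> exists i, `|f w - c i| < e.
Proof.
move=> [s [ss sf]].
have /choice[l ls] : forall k, exists l : seq B, forall w, s k w \in l.
  move=> k; have [/finite_seqP[l El] _] := ss k; exists l => w.
  by have : [set` l] (s k w) by rewrite -El; exists w.
exists (fun k => if unpickle k is Some (i, j) then nth 0 (l i) j else 0).
move=> w e e0; have /cvgrPdist_lt/(_ _ e0)[N _ Ns] := sf w.
exists (pickle (N, index (s N w) (l N))); rewrite pickleK nth_index//.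
exact: Ns (leqnn N).
Qed.

(** Balls of radius [1 / (m + 1)] around the centers, pulled back, form the network. Only preimages
    of balls have to be measurable, which is convenient over the sub-sigma-algebras of the past. *)
Lemma networked_countable_range (f : T -> B) (c : nat -> B) :
  (forall w e, 0 < e -> exists i, `|f w - c i| < e) ->
  (forall v r, measurable (f @^-1` [set x | `|x - v| < r])) ->
  networked f.
Proof.
move=> fc mf.
exists (fun k => if unpickle k is Some (i, m) then
   f @^-1` [set x | `|x - c i| < m.+1%:R^-1] else set0).
split=> [k|w O /nbhs_ballP[e /= e0 eO]]; first by case: unpickle => [[i j]|].
have [m _ me] := near_infty_natSinv_lt (PosNum (divr_gt0 e0 (ltr0n R 2))).
have [i ci] := fc w m.+1%:R^-1 (ltac:(by rewrite invr_gt0)).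
exists (pickle (i, m)); rewrite pickleK; split=> // v /= vc; apply: eO.
rewrite -ball_normE /=; apply: le_lt_trans (ler_distD (c i) _ _) _.
rewrite (splitr e) (distrC (c i)) ltrD//.
  exact: lt_trans ci (me _ (leqnn m)).
exact: lt_trans vc (me _ (leqnn m)).
Qed.

End strongly_measurable.

(** * Borel images of strongly measurable maps *)

(* Names for the sets generated by a countable family: there are at most
   continuum many of them, whence [code_bits_inj]. *)
Inductive code := CEmpty | CBasic of nat | CCompl of code | CUnion of (nat -> code).

(** A code is a countably branching tree, recorded by the labels met along finite paths: the empty
    path reads the constructor, and any further step below [CBasic n] reads [n]. *)
Fixpoint code_labels (c : code) (p : seq nat) : nat :=
  match c, p with
  | CEmpty, _ => 0
  | CBasic _, [::] => 1
  | CBasic n, _ :: _ => n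
  | CCompl _, [::] => 2
  | CCompl c', _ :: q => code_labels c' q
  | CUnion _, [::] => 3
  | CUnion f, k :: q => code_labels (f k) q
  end.

Lemma code_labels_inj : injective code_labels.
Proof.
elim=> [|n|c IH|f IH] [|m|c'|f'] // H; try by have := congr1 (@^~ [::]) H.
- by have /= -> := congr1 (@^~ [:: 0%N]) H.
- by congr CCompl; apply: IH; apply/funext => q; have := congr1 (@^~ (0%N :: q)) H.
- congr CUnion; apply/funext => k; apply: IH; apply/funext => q.
  exact: (congr1 (@^~ (k :: q)) H).
Qed.

(** The graph of the label function as a bit sequence, which makes codes points of the Cantor
    space. *)
Definition code_bits (c : code) (m : nat) : bool :=
  if unpickle m is Some (p, k) then code_labels c p == k else false.

Lemma code_bits_inj : injective code_bits.
Proof.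
move=> c c' H; apply: code_labels_inj; apply/funext => p; apply/eqP.
have := congr1 (@^~ (pickle (p, code_labels c' p))) H.
by rewrite /code_bits pickleK eqxx.
Qed.

(** * Regularity of laws and null families with Borel unions *)

Section null_families.
Context {R : realType} {d : measure_display} {T : measurableType d}.
Context (P : probability T R) {B : completeNormedModType R}.
Context (xi : T -> B) (Nxi : networked xi).

Lemma borelC (A : set B) : borel_set A -> borel_set (~` A).
Proof. by move=> bA; rewrite -setTD; exact: sigma_algebraCD. Qed.

Lemma borel_open (A : set B) : open A -> borel_set A.
Proof. exact: sub_sigma_algebra. Qed.

Lemma borel_bigcup (A : nat -> set B) :
  (forall n, borel_set (A n)) -> borel_set (\bigcup_n A n).
Proof. exact: sigma_algebra_bigcup. Qed.

Lemma borelI (A A' : set B) : borel_set A -> borel_set A' -> borel_set (A `&` A').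
Proof.
move=> bA bA'.
exact: (@measurableI _ (g_sigma_algebraType (@open B)) A A').
Qed.

Lemma borelD (A A' : set B) : borel_set A -> borel_set A' -> borel_set (A `\` A').
Proof. by move=> bA bA'; rewrite setDE; apply: borelI => //; exact: borelC. Qed.

Lemma borel_closed (A : set B) : closed A -> borel_set A.
Proof. move=> cA; rewrite -(setCK A); apply: borelC; apply: borel_open.
exact: closed_openC.
Qed.

Let mxi A : borel_set A -> measurable (xi @^-1` A).
Proof. exact: networked_borel. Qed.

Lemma nonincreasing_lt_prob (F : nat -> set T) eps :
  (forall n, measurable (F n)) -> (forall n, F n.+1 `<=` F n) ->
  (P (\bigcap_n F n) < eps)%E -> exists n, (P (F n) < eps)%E.
Proof.
move=> mF Fd Peps.
apply/not_existsP => H; suff : (eps <= P (\bigcap_n F n))%E by rewrite leNgt Peps.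
apply: (@cvge_ge _ _ _ _ (P \o F)); last first.
  apply: nonincreasing_cvg_mu => //.
  - by apply: le_lt_trans (probability_le1 _ _) _ => //; rewrite ltry.
  - exact: bigcapT_measurable.
  - by apply/nonincreasing_seqP => n; apply/subsetPset; exact: Fd.
by apply: nearW => n; rewrite leNgt; apply/negP; exact: H.
exact: eventually_filter.
Qed.

(** Regularity of the law of [xi]. Asking for the inner and outer sets together makes the property
    symmetric under complements. *)
Definition closed_open_approx (A : set B) := forall eps, 0 < eps ->
  exists F O, [/\ closed F, open O, F `<=` A, A `<=` O &
     (P (xi @^-1` (O `\` F)) < eps%:E)%E].

Lemma open_closed_open_approx O : open O -> closed_open_approx O.
Proof.
move=> oO eps eps0.
pose F n := [set x | ball x n.+1%:R^-1 `<=` O].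
have oF n : open (~` F n).
  rewrite (_ : ~` F n = \bigcup_(y in ~` O) ball y n.+1%:R^-1).
    by apply: bigcup_open => y _; apply: ball_open; rewrite invr_gt0.
  apply/seteqP; split=> x /=.
    move=> /existsNP[y /not_implyP[xy yO]]; exists y => //.
    exact: ball_sym.
  by move=> [y yO yx] xO; apply: yO; apply: xO; exact: ball_sym.
have FO n : F n `<=` O.
  by move=> x; apply; apply: ballxx; rewrite invr_gt0.
have [n Pn] : exists n, (P (xi @^-1` (O `\` F n)) < eps%:E)%E.
  apply: nonincreasing_lt_prob.
  - move=> n; apply: mxi; apply: borelD; first exact: borel_open.
    by rewrite -[F n]setCK; apply: borelC; exact: borel_open.
  - move=> n w [Ow nF]; split=> // Fn; apply: nF => y yw; apply: Fn.
    by apply: le_ball yw; rewrite lef_pV2 ?posrE// ler_nat.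
  - rewrite (_ : \bigcap_n _ = set0) ?measure0 ?lte_fin//.
    rewrite -subset0 => w H; have [/= Ow _] := H 0%N I.
    have /nbhs_ballP[e /= e0 eO] : nbhs (xi w) O by exact: open_nbhs_nbhs.
    have [m _ me] := near_infty_natSinv_lt (PosNum e0).
    have [_] := H m I; apply => y yw; apply: eO; apply: le_ball yw.
    exact/ltW/(me _ (leqnn m)).
exists (F n), O; split=> //.
by rewrite -[F n]setCK; exact: open_closedC.
Qed.

(** For a countable union the outer errors are summed as [eps / 2 / 2 ^ n.+1]. The union of the
    inner closed sets need not be closed, so finitely many are kept, and continuity from above makes
    the discarded part small. *)
Lemma borel_closed_open_approx A : borel_set A -> closed_open_approx A.
Proof.
move=> bA; suff [] : [set A | borel_set A /\ closed_open_approx A] A by [].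
move: bA; apply: smallest_sub; last first.
  move=> O oO; split; first exact: borel_open.
  exact: open_closed_open_approx.
split.
- split; first exact: sigma_algebra0.
  move=> eps eps0; exists set0, set0; split=> //.
  + exact: closed0.
  + exact: open0.
  + by rewrite setD0 preimage_set0 measure0 lte_fin.
- move=> A' [bA' H]; split; first by rewrite setTD; exact: borelC.
  move=> eps /H[F [V [cF oV FA AV PFV]]]; exists (~` V), (~` F); split.
  + exact: open_closedC.
  + exact: closed_openC.
  + by rewrite setTD; exact: subsetC.
  + by rewrite setTD; exact: subsetC.
  + by rewrite setDE setCK setIC -setDE.
- move=> E H; split; first by apply: borel_bigcup => n; have [] := H n.
  move=> eps eps0.
  have e2 n : 0 < eps / 2 / (2 ^ n.+1)%:R :> R.
    by rewrite !divr_gt0// ltr0n expn_gt0.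
  have /choice[FO HFO] : forall n, exists FO : set B * set B,
     [/\ closed FO.1, open FO.2, FO.1 `<=` E n, E n `<=` FO.2 &
       (P (xi @^-1` (FO.2 `\` FO.1)) < (eps / 2 / (2 ^ n.+1)%:R)%:E)%E].
    by move=> n; have [_ /(_ _ (e2 n))[F [V ?]]] := H n; exists (F, V).
  pose F n := (FO n).1; pose O n := (FO n).2.
  have mO : borel_set (\bigcup_n O n).
    by apply: borel_bigcup => n; apply: borel_open; have [] := HFO n.
  have mF n : borel_set (F n) by apply: borel_closed; have [] := HFO n.
  have cFn n : closed (\big[setU/set0]_(i < n) F i).
    by apply: closed_bigsetU => i _; have [] := HFO i.
  have [n Pn] : exists n,
      (P (xi @^-1` ((\bigcup_n O n) `\` \big[setU/set0]_(i < n) F i)) < eps%:E)%E.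
    apply: nonincreasing_lt_prob.
    + by move=> n; apply: mxi; apply: borelD => //; apply: borel_closed.
    + move=> n w [Ow nF]; split=> // Fn; apply: nF.
      by rewrite big_ord_recr/=; left.
    + apply: (@le_lt_trans _ _ (eps / 2)%:E); last first.
        by rewrite lte_fin ltr_pdivrMr// ltr_pMr// ltr1n.
      apply: (@le_trans _ _ (\sum_(n <oo) P (xi @^-1` (O n `\` F n)))%E).
        apply: measure_sigma_subadditive.
        * move=> n; apply: mxi; apply: borelD => //.
          by apply: borel_open; have [] := HFO n.
        * apply: bigcapT_measurable => n; apply: mxi; apply: borelD => //.
          exact: borel_closed.
        * move=> w Hw; have [[n _ On] _] := Hw 0%N I.
          exists n => //; split=> // Fn; have [_] := Hw n.+1 I.
          by apply; rewrite big_ord_recr/=; right.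
      apply: (@le_trans _ _ (\sum_(n <oo) (eps / 2 / (2 ^ n.+1)%:R)%:E)%E).
        by apply: lee_nneseries => // n _; apply: ltW; have [] := HFO n.
      exact: epsilon_trick0 (ltW (divr_gt0 eps0 (ltr0n R 2))).
  exists (\big[setU/set0]_(i < n) F i), (\bigcup_n O n); split=> //.
  + by apply: bigcup_open => i _; have [] := HFO i.
  + by rewrite -bigcup_mkord => x [i _ Fi]; exists i => //; have [_ _ + _ _] := HFO i; apply.
  + by apply: subset_bigcup => i _; have [] := HFO i.
Qed.

Lemma networked_dense_seq : exists c : nat -> B,
  forall w e, 0 < e -> exists i, `|xi w - c i| < e.
Proof.
have [N [mN Nf]] := Nxi.
have /choice[t Nt] : forall i, exists w, N i !=set0 -> N i w.
  move=> i; have [[w Nw]|Ni] := pselect (N i !=set0); first by exists w.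
  by exists point.
exists (fun i => xi (t i)) => w e e0.
have [i [Niw Ni]] := Nf w _ (nbhsx_ballx (xi w) _ e0).
exists i; have /Ni : N i (t i) by apply: Nt; exists w.
by rewrite /= -ball_normE.
Qed.

(** Countably many balls of radius [eps / 2] cover the range of [xi], so one of them meets [A] in
    positive probability; a closed inner approximation with error below that very probability cannot
    be null. *)
Lemma positive_closed_subset A eps : borel_set A ->
  (0 < P (xi @^-1` A))%E -> 0 < eps ->
  exists F, [/\ closed F, F `<=` A, (0 < P (xi @^-1` F))%E &
     forall x y, F x -> F y -> `|x - y| <= eps].
Proof.
move=> bA PA eps0; have [c cd] := networked_dense_seq.
have e20 : 0 < eps / 2 by rewrite divr_gt0.
pose D i := A `&` ball (c i) (eps / 2).
have bD i : borel_set (D i).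
  by apply: borelI => //; apply: borel_open; exact: ball_open.
have [i PD] : exists i, (0 < P (xi @^-1` D i))%E.
  apply/not_existsP => H; move: PA; rewrite lt0e => /andP[/eqP PA _]; apply: PA.
  apply/negligibleP; first exact: mxi.
  apply: (@negligibleS _ _ _ _ (\bigcup_i xi @^-1` D i)).
    move=> w Aw; have [i ci] := cd w _ e20; exists i => //; split=> //.
    by rewrite -ball_normE /= distrC.
  apply: negligible_bigcup => i; apply/negligibleP; first exact: mxi.
  by apply/eqP; rewrite eq_le measure_ge0 andbT leNgt; apply/negP; exact: H.
have fD : P (xi @^-1` D i) \is a fin_num by apply: fin_num_measure; exact: mxi.
have PD2 : 0 < fine (P (xi @^-1` D i)) by rewrite fine_gt0// PD/= ltey_eq fD.
have [F [V [cF oV FD DV PFV]]] := borel_closed_open_approx (bD i) PD2.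
exists F; split=> //.
- by move=> x /FD[].
- rewrite lt0e measure_ge0 andbT; apply/eqP => PF0.
  have : (P (xi @^-1` D i) < (fine (P (xi @^-1` D i)))%:E)%E.
    apply: le_lt_trans PFV.
    have mVF : measurable (xi @^-1` (V `\` F)).
      by apply: mxi; apply: borelD; [exact: borel_open|exact: borel_closed].
    have mF : measurable (xi @^-1` F) by apply: mxi; exact: borel_closed.
    rewrite -[leRHS]adde0 -PF0; apply: le_trans (measureU2 _ mVF mF).
    apply: le_measure; rewrite ?inE.
    - exact: mxi.
    - exact: measurableU.
    - by move=> w /DV Vw; have [Fw|nFw] := pselect (F (xi w)); [right|left].
  by rewrite fineK// ltxx.
- move=> x y /FD[_ xc] /FD[_ yc]; move: xc yc.
  rewrite -!ball_normE /= => xc yc; apply: le_trans (ler_distD (c i) _ _) _.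
  by rewrite (splitr eps) lerD// ltW// distrC.
Qed.

Section family.
Context {I : Type} (Y : I -> set B).
Hypothesis tY : trivIset setT Y.
Local Notation U J := (\bigcup_(i in J) Y i).
Hypothesis bY : forall J : set I, borel_set (U J).
Hypothesis Y0 : forall i, P (xi @^-1` Y i) = 0%E.
Context (t : I -> T) (J0 : set I).
Hypothesis Yt : forall i, J0 i -> Y i (xi (t i)).

Lemma family_inj i j x : Y i x -> Y j x -> i = j.
Proof.
by move=> Yix Yjx; apply: tY => //; exists x.
Qed.

(** The network set [N k] splits the indices according to whether it contains [t i]. If every such
    split had a null side, discarding these countably many null sides would leave indices whose
    points [xi (t i)] the network cannot separate: at most one index, with a null member. *)
Lemma positive_family_split K J : borel_set K -> J `<=` J0 ->
  (0 < P (xi @^-1` (K `&` U J)))%E -> exists J1 J2 : set I,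
  [/\ J1 `<=` J, J2 `<=` J, forall i, J1 i -> J2 i -> False,
      (0 < P (xi @^-1` (K `&` U J1)))%E & (0 < P (xi @^-1` (K `&` U J2)))%E].
Proof.
move=> bK JJ0 PJ; have [N [mN Nf]] := Nxi.
have mKU J' : measurable (xi @^-1` (K `&` U J')) by apply: mxi; exact: borelI.
apply: contrapT => nex.
pose L k b := [set i | J i /\ (`[< N k (t i) >] = b)].
have /choice[b Hb] : forall k, exists b, P (xi @^-1` (K `&` U (L k b))) = 0%E.
  move=> k; apply: contrapT => /forallNP H; apply: nex.
  exists (L k true), (L k false); split.
  - by move=> i [].
  - by move=> i [].
  - by move=> i [_ H1] [_]; rewrite H1.
  - by rewrite lt0e measure_ge0 andbT; apply/eqP; exact: H.
  - by rewrite lt0e measure_ge0 andbT; apply/eqP; exact: H.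
(* The survivors: [b k] is the null answer to membership in [N k], so they all give the opposite
   one. *)
pose M := [set i | J i /\ forall k, `[< N k (t i) >] = ~~ b k].
have M1 i j : M i -> M j -> i = j.
  move=> [Ji Mi] [Jj Mj]; apply: contrapT => ij.
  have xij : xi (t i) <> xi (t j).
    move=> eij; apply: ij; apply: (@family_inj _ _ (xi (t i))).
      exact: Yt (JJ0 _ Ji).
    by rewrite eij; exact: Yt (JJ0 _ Jj).
  have oV : open (~` [set xi (t j)]).
    by apply: closed_openC; apply: accessible_closed_set1; exact: hausdorff_accessible.
  have [k [Nk NV]] := Nf (t i) _ (open_nbhs_nbhs (conj oV xij)).
  have := Mi k; rewrite asboolT// => bk.
  have := Mj k; rewrite -bk => /asboolP/NV; exact.
have PM : P (xi @^-1` (K `&` U M)) = 0%E.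
  have [[i Mi]|M0] := pselect (M !=set0).
    apply/eqP; rewrite eq_le measure_ge0 andbT -(Y0 i).
    apply: le_measure; rewrite ?inE//.
      apply: mxi; rewrite (_ : Y i = U [set i]); first exact: bY.
      by rewrite bigcup_set1.
    by move=> w [_ [j Mj]]; rewrite (M1 _ _ Mj Mi).
  rewrite (_ : U M = set0) ?setI0 ?preimage_set0 ?measure0//.
  by rewrite -subset0 => x [i Mi _]; apply: M0; exists i.
move: PJ; rewrite lt0e => /andP[/eqP PJ _]; apply: PJ.
apply/negligibleP => //.
apply: (@negligibleS _ _ _ _ (xi @^-1` (K `&` U M) `|`
   \bigcup_k xi @^-1` (K `&` U (L k (b k))))).
  move=> w [Kw [i Ji Yi]].
  have [Mi|/existsNP[k Hk]] := pselect (forall k, `[< N k (t i) >] = ~~ b k).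
    by left; split=> //; exists i.
  right; exists k => //; split=> //; exists i => //; split=> //.
  by move: Hk; case: asboolP; case: (b k).
apply: negligibleU; first by apply/negligibleP.
by apply: negligible_bigcup => k; apply/negligibleP; [exact: mKU|exact: Hb].
Qed.

(* A node of the Cantor scheme: a closed non-null set with the indices of the
   members of the family that are still allowed to meet it. *)
Record state := State { st_K : set B; st_J : set I;
  st_closed : closed st_K; st_sub : st_J `<=` J0;
  st_KU : st_K `<=` U st_J; st_pos : (0 < P (xi @^-1` st_K))%E }.

Lemma state_split (s : state) eps : 0 < eps -> exists f : bool -> state,
  (forall b, [/\ st_K (f b) `<=` st_K s, st_J (f b) `<=` st_J s &
     forall x y, st_K (f b) x -> st_K (f b) y -> `|x - y| <= eps]) /\
  forall i, st_J (f true) i -> st_J (f false) i -> False.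
Proof.
move=> eps0; case: s => K J cK JJ0 KU PK /=.
have bK := borel_closed cK.
have [|J1 [J2 [J1J J2J J12 P1 P2]]] := @positive_family_split K J bK JJ0.
  by rewrite setIidl.
have [F1 [cF1 F1K PF1 dF1]] := positive_closed_subset (borelI bK (bY J1)) P1 eps0.
have [F2 [cF2 F2K PF2 dF2]] := positive_closed_subset (borelI bK (bY J2)) P2 eps0.
pose s2 := @State F2 J2 cF2 (subset_trans J2J JJ0) (subset_trans F2K (@subIsetr _ _ _)) PF2.
exists (fun b => if b then
 @State F1 J1 cF1 (subset_trans J1J JJ0) (subset_trans F1K (@subIsetr _ _ _)) PF1
 else s2); split=> [[]|//]; split=> //=.
- exact: subset_trans F1K (@subIsetl _ _ _).
- exact: subset_trans F2K (@subIsetl _ _ _).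
Qed.

(** Along a branch the closed sets shrink to a point lying in a single member of the family.
    Disjointness of the members puts its index in every [st_J] of the branch, and disjointness of
    the two index sets at each node lets the branch be read off from the index. *)
Lemma cantor_injection (s0 : state) : exists f : (nat -> bool) -> I,
  injective f /\ forall sigma, J0 (f sigma).
Proof.
have /choice[step stepP] : forall sn : state * nat, exists f : bool -> state,
  (forall b, [/\ st_K (f b) `<=` st_K sn.1, st_J (f b) `<=` st_J sn.1 &
     forall x y, st_K (f b) x -> st_K (f b) y -> `|x - y| <= sn.2.+1%:R^-1]) /\
  forall i, st_J (f true) i -> st_J (f false) i -> False.
  by move=> [s n]; apply: state_split; rewrite invr_gt0.
pose s sigma := fix s n := if n is m.+1 then step (s m, m) (sigma m) else s0.
have sK sigma m n : (m <= n)%N -> st_K (s sigma n) `<=` st_K (s sigma m).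
  elim: n => [|n IH]; first by rewrite leqn0 => /eqP ->.
  rewrite leq_eqVlt => /predU1P[->//|]; rewrite ltnS => /IH; apply: subset_trans.
  by have [/(_ (sigma n))[]] := stepP (s sigma n, n).
suff H sigma : exists i, forall n, st_J (s sigma n) i.
  have [f fJ] := choice H; exists f; split; last first.
    by move=> sigma; apply: st_sub (fJ sigma 0%N).
  move=> sigma sigma' ff.
  have E n : s sigma n = s sigma' n -> sigma n = sigma' n.
    move=> sn; have /= := fJ sigma n.+1; have /= := fJ sigma' n.+1.
    rewrite sn ff; have [_ /(_ (f sigma'))] := stepP (s sigma' n, n).
    case: (sigma n); case: (sigma' n) => // H' H1 H2; exfalso; exact: H'.
  have E' n : s sigma n = s sigma' n.
    by elim: n => //= n IH; rewrite IH (E _ IH).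
  by apply/funext => n; exact: E.
have /choice[y yK] : forall n, exists x, st_K (s sigma n) x.
  move=> n; apply: contrapT => /forallNP H.
  have := st_pos (s sigma n); rewrite (_ : st_K _ = set0).
    by rewrite preimage_set0 measure0 ltxx.
  by rewrite -subset0 => x /H.
have yC : cvgn y.
  apply/cauchy_cvgP/cauchy_exP => e e0.
  have [n _ ne] := near_infty_natSinv_lt (PosNum e0).
  exists (y n.+1); exists n.+1 => // m /= nm.
  rewrite -ball_normE /=; apply: le_lt_trans (ne _ (leqnn n)).
  have [/(_ (sigma n))[_ _ H] _] := stepP (s sigma n, n).
  by apply: H; [exact: (yK n.+1)|exact: (sK sigma n.+1 m nm) (yK m)].
have ylim n : st_K (s sigma n) (limn y).
  have H : \forall m \near \oo, st_K (s sigma n) (y m).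
    by exists n => // m /= nm; exact: sK nm _ (yK m).
  exact: (closed_cvg _ (@st_closed (s sigma n)) H _ yC).
have [i _ Yi] := st_KU (ylim 0%N).
exists i => n; have [j Jj Yj] := st_KU (ylim n).
by rewrite (family_inj Yi Yj).
Qed.

End family.

(** Only members met by [xi] count, whence [J0]. Every preimage of a Borel set has a code over the
    network, and a code [c] singles out the index [f (code_bits c)]; as both maps are injective, a
    set of indices can be prescribed one code at a time. *)
Lemma null_borel_family {I : Type} (Y : I -> set B) : trivIset setT Y ->
  (forall J : set I, borel_set (\bigcup_(i in J) Y i)) ->
  (forall i, P (xi @^-1` Y i) = 0%E) -> P (xi @^-1` \bigcup_i Y i) = 0%E.
Proof.
move=> tY bY Y0.
pose J0 := [set i | exists w, Y i (xi w)].
have /choice[t tP] : forall i, exists w, J0 i -> Y i (xi w).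
  move=> i; have [[w Yw]|nJ] := pselect (J0 i); first by exists w.
  by exists point.
apply: contrapT => /eqP PY.
have PY0 : (0 < P (xi @^-1` \bigcup_(i in J0) Y i))%E.
  rewrite lt0e measure_ge0 andbT; move: PY; congr (_ != _); congr (P _).
  by apply/seteqP; split=> w [i iI Yi]; exists i => //; exists w.
have [K [cK KY PK _]] := positive_closed_subset (bY J0) PY0 (ltr01 : 0 < 1 :> R).
have [f [finj fJ]] := cantor_injection tY bY Y0 tP
  (@State _ Y J0 K J0 cK (@subset_refl _ _) KY PK).
have [N [mN Nf]] := Nxi.
pose ev := fix ev c := match c with CEmpty => set0 | CBasic n => N n
  | CCompl c' => ~` (ev c') | CUnion g => \bigcup_k ev (g k) end.
have coded A : borel_set A -> exists c, xi @^-1` A = ev c.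
  apply: (@smallest_sub _ _ _ [set A | exists c, xi @^-1` A = ev c]).
    split.
    - by exists CEmpty; rewrite preimage_set0.
    - by move=> X [c Xc]; exists (CCompl c); rewrite setTD /= -Xc.
    - move=> X /choice[c Xc]; exists (CUnion c); rewrite preimage_bigcup/=.
      by apply: eq_bigcupr => i _.
  move=> V oV /=.
  exists (CUnion (fun i => if `[< N i `<=` xi @^-1` V >] then CBasic i else CEmpty)).
  apply/seteqP; split=> [w Vw|w [i _] /=].
    have [i [Niw NV]] := Nf w V (open_nbhs_nbhs (conj oV Vw)).
    by exists i => //; rewrite asboolT.
  by case: asboolP => //= + Niw; apply.
(* Diagonal set: its union differs from the set coded by [c] at the point
   [t (f (code_bits c))]. *)
pose J := [set i | J0 i /\
  forall c, i = f (code_bits c) -> ~ ev c (t i)].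
have [c Jc] := coded _ (bY J).
pose i := f (code_bits c).
have J0i : J0 i by exact: fJ.
have Yi : Y i (xi (t i)) by exact: tP.
have [Ji|nJi] := pselect (J i).
  have [_ /(_ c erefl)] := Ji; rewrite -Jc; apply.
  by exists i.
apply: nJi; split=> // c' /finj/code_bits_inj <-; rewrite -Jc.
move=> [j Jj Yj]; move: (Jj); rewrite -(family_inj tY Yi Yj) => -[_ /(_ c erefl)].
by rewrite -Jc; apply; exists j.
Qed.

Lemma countable_positive_family (F : B -> set T) : trivIset setT F ->
  (forall b, measurable (F b)) -> countable [set b | (0 < P (F b))%E].
Proof.
move=> tF mF.
have fP b : P (F b) \is a fin_num by exact: fin_num_measure.
rewrite [X in countable X](_ : _ =
    \bigcup_n [set b | n.+1%:R^-1 < fine (P (F b))]); last first.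
  apply/seteqP; split=> [b/= Pb|b/= [k _ /= kb]].
    have /ltr_add_invr[k] : 0 < fine (P (F b)) by rewrite fine_gt0// Pb/= ltey_eq fP.
    by rewrite add0r; exists k.
  by rewrite -(fineK (fP b)) lte_fin; apply: lt_trans kb; rewrite invr_gt0.
apply: bigcup_countable => // n _; apply: finite_set_countable.
apply: contrapT => /infiniteP/pcard_leP/injfunPex[/= q q_fun q_inj].
have /(probability_le1 P) : measurable (\bigcup_k F (q k)).
  by apply: bigcup_measurable.
rewrite leNgt => /negP; apply.
rewrite [ltRHS](_ : _ = \sum_(0 <= k <oo) P (F (q k)))%E; last first.
  rewrite measure_bigcup//; first by apply: eq_eseriesl =>// i; rewrite in_setT.
  move=> i j _ _ [x Fx]; apply: q_inj; rewrite ?inE//.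
  by apply: tF => //; exists x.
apply: (lt_le_trans _ (nneseries_lim_ge n.+1 _)) => //.
rewrite -EFin_sum_fine//.
rewrite lte_fin (_ : 1%R = (\sum_(0 <= k < n.+1) n.+1%:R^-1:R)%R); last first.
  by rewrite sumr_const_nat subn0 -[RHS]mulr_natr mulVf.
by apply: ltr_sum => // k _; exact: q_fun.
Qed.

(* First step of Stone's theorem: attach to [x] the first center, in a well
   order of the space, of an [eps]-ball containing [x]. *)
Lemma first_center (eps : R) : 0 < eps -> exists m : B -> B,
  (forall x, ball (m x) eps x) /\
  forall x y, ball (m x) eps y -> ball (m y) eps x -> m x = m y.
Proof.
move=> eps0; have [Q Qwo] := wochoice.well_ordering_principle B.
have bxx x : ball x eps x by exact: ballxx.
pose S x : {pred B} := [pred z | `[< ball z eps x >]].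
have SP x z : ball z eps x -> z \in S x by move=> ?; apply/asboolP.
have /choice[m mP] : forall x, exists z, wochoice.minimum_of Q (S x) z.
  move=> x; have [|z [zP _]] := Qwo (S x); first by exists x; exact: SP.
  by exists z.
exists m; split=> [x|x y yx xy]; first by have [/asboolP] := mP x.
have [mx Qx] := mP x; have [my Qy] := mP y.
have [|z [_ zU]] := Qwo [pred z | (z == m x) || (z == m y)].
  by exists (m x); rewrite inE eqxx.
have zx : z = m x.
  apply: zU; split; first by rewrite inE eqxx.
  by move=> z'; rewrite inE => /orP[] /eqP ->; apply: Qx; rewrite // SP.
have zy : z = m y.
  apply: zU; split; first by rewrite inE eqxx orbT.
  by move=> z'; rewrite inE => /orP[] /eqP ->; apply: Qy; rewrite // SP.
by rewrite -zx -zy.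
Qed.

(** Over all scales [n] the space is covered by open pieces inside [eps]-balls, disjoint at each
    scale. Countably many carry positive probability; the others, pulled back by [g], are disjoint
    null sets all of whose unions are Borel, so [null_borel_family] discards them together. *)
Lemma borel_image_separable (g : B -> B) (eps : R) : borel_fun g -> 0 < eps ->
  exists2 H : set B, countable H &
  {ae P, forall w, exists2 c, H c & `|g (xi w) - c| < eps}.
Proof.
move=> bg eps0; have [m [mx mxy]] := first_center eps0.
pose r n : R := n.+1%:R^-1; have r0 n : 0 < r n by rewrite invr_gt0.
(* Stone's refinement: [D n p] keeps the points with first center [p] whose [r n]-ball stays in the
   ball of [p]. Thickened by [r n / 2], these sets stay disjoint: two witnesses at distance below
   [r n] each lie in the ball of the other's center, so the centers agree. *)
pose D n p := [set x | m x = p /\ ball x (r n) `<=` ball p eps].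
pose V n p := \bigcup_(x in D n p) ball x (r n / 2).
have VU n J : open (\bigcup_(p in J) V n p).
  by apply: bigcup_open => p _; apply: bigcup_open => x _; apply: ball_open; rewrite divr_gt0.
have tV n : trivIset setT (V n).
  move=> a b _ _ [z [[x [xa Dx] xz] [y [yb Dy] yz]]].
  have xy : ball x (r n) y.
    by rewrite [r n]splitr; apply: ball_triangle xz (ball_sym yz).
  by rewrite -xa -yb; apply: mxy; [rewrite xa; exact: Dx|rewrite yb; exact/Dy/ball_sym].
have VB n p : V n p `<=` ball p eps.
  move=> z [x [_ Dx] xz]; apply: Dx; apply: le_ball xz.
  by rewrite ler_pdivrMr// ler_peMr ?ler1n// ltW.
have Vcover x : exists n, V n (m x) x.
  have /nbhs_ballP[e /= e0 eO] : nbhs x (ball (m x) eps).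
    by apply: open_nbhs_nbhs; split=> //; exact: ball_open.
  have [n _ ne] := near_infty_natSinv_lt (PosNum e0).
  exists n; exists x; last by apply: ballxx; rewrite divr_gt0.
  by split=> // y xy; apply: eO; apply: le_ball xy; exact/ltW/(ne _ (leqnn n)).
have bgV n J : borel_set (g @^-1` \bigcup_(p in J) V n p).
  by apply: bg; exact: borel_open.
pose H n := [set p | (0 < P (xi @^-1` (g @^-1` V n p)))%E].
have cH n : countable (H n).
  apply: countable_positive_family.
    by move=> a b _ _ [w [wa wb]]; apply: (tV n) => //; exists (g (xi w)).
  by move=> b; apply: mxi; have := bgV n [set b]; rewrite bigcup_set1.
exists (\bigcup_n H n); first exact: bigcup_countable.
pose Y n p := [set x | ~ H n p /\ V n p (g x)].
have Ynull n : P (xi @^-1` \bigcup_p Y n p) = 0%E.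
  apply: null_borel_family.
  - by move=> a b _ _ [x [[_ xa] [_ xb]]]; apply: (tV n) => //; exists (g x).
  - move=> J; rewrite (_ : \bigcup_(i in J) _ = g @^-1` \bigcup_(p in J `\` H n) V n p).
      exact: bgV.
    apply/seteqP; split=> [x [p Jd [nH Vx]]|x [p [Jd nH] Vx]]; first by exists p.
    by exists p.
  - move=> p; have [Hd|nHd] := pselect (H n p).
      rewrite (_ : Y n p = set0) ?preimage_set0 ?measure0//.
      by rewrite -subset0 => x [].
    apply/eqP; rewrite eq_le measure_ge0 andbT leNgt; apply/negP => PY; apply: (nHd).
    suff YE : Y n p = g @^-1` V n p by rewrite /H /= -YE.
    by apply/seteqP; split=> x // [].
apply: (@negligibleS _ _ _ _ (\bigcup_n xi @^-1` \bigcup_p Y n p)); last first.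
  apply: negligible_bigcup => n; apply/negligibleP; last exact: Ynull.
  rewrite (_ : \bigcup_p Y n p = g @^-1` \bigcup_(p in ~` H n) V n p).
    by apply: mxi; exact: bgV.
  by apply/seteqP; split=> [x [p _ [nH Vx]]|x [p nH Vx]]; exists p.
move=> w; apply: contra_notP => nY; have [n Vn] := Vcover (g (xi w)).
exists (m (g (xi w))); last first.
  by have := mx (g (xi w)); rewrite -ball_normE /= distrC.
exists n => //; apply: contrapT => nH; apply: nY; exists n => //.
by exists (m (g (xi w))).
Qed.

Lemma borel_image_ae_dense_seq (g : B -> B) : borel_fun g -> exists c : nat -> B,
  {ae P, forall w e, 0 < e -> exists i, `|g (xi w) - c i| < e}.
Proof.
move=> bg.
have /choice[H HP] : forall k : nat, exists H : set B, countable H /\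
    {ae P, forall w, exists2 c, H c & `|g (xi w) - c| < k.+1%:R^-1}.
  move=> k; have k0 : 0 < k.+1%:R^-1 :> R by rewrite invr_gt0.
  have [H cH aeH] := borel_image_separable bg k0.
  by exists H.
have /countable_injP[f finj] : countable (\bigcup_k H k).
  by apply: bigcup_countable => // k _; have [] := HP k.
have /choice[c cP] : forall j, exists x, forall y, (\bigcup_k H k) y -> f y = j -> x = y.
  move=> j; have [[x [Hx fx]]|nx] := pselect (exists x, (\bigcup_k H k) x /\ f x = j).
    by exists x => y Hy fy; apply: finj; rewrite ?inE// fx fy.
  by exists point => y Hy fy; exfalso; apply: nx; exists y.
exists c.
have : {ae P, forall w k, exists2 c, H k c & `|g (xi w) - c| < k.+1%:R^-1}.
  by apply/ae_foralln => k; have [] := HP k.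
apply: filterS => w Hw e e0.
have [n _ ne] := near_infty_natSinv_lt (PosNum e0).
have [y Hy gy] := Hw n; exists (f y).
rewrite (cP (f y) y)//; first exact: lt_trans gy (ne _ (leqnn n)).
by exists n.
Qed.

End null_families.

(** * Scalar martingales with independent innovations *)

Section bounded_functions.
Context {d : measure_display} {T : measurableType d} {R : realType}.

Definition bmeasurable (f : T -> R) :=
  measurable_fun setT f /\ exists M : R, forall w, `|f w| <= M.

Lemma bmeasurable_cst (a : R) : bmeasurable (fun=> a).
Proof. by split; [exact: measurable_cst|exists `|a|]. Qed.

Lemma bmeasurableD (f g : T -> R) :
  bmeasurable f -> bmeasurable g -> bmeasurable (fun w => f w + g w).
Proof.
move=> [mf [M fM]] [mg [N gN]]; split; first exact: measurable_funD.
by exists (M + N) => w; apply: le_trans (ler_normD _ _) _; rewrite lerD.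
Qed.

Lemma bmeasurableM (f g : T -> R) :
  bmeasurable f -> bmeasurable g -> bmeasurable (fun w => f w * g w).
Proof.
move=> [mf [M fM]] [mg [N gN]]; split; first exact: measurable_funM.
by exists (M * N) => w; rewrite normrM ler_pM.
Qed.

Lemma bmeasurableB (f g : T -> R) :
  bmeasurable f -> bmeasurable g -> bmeasurable (fun w => f w - g w).
Proof.
move=> [mf [M fM]] [mg [N gN]]; split; first exact: measurable_funB.
by exists (M + N) => w; apply: le_trans (ler_normB _ _) _; rewrite lerD.
Qed.

Lemma bmeasurable_norm (f : T -> R) :
  bmeasurable f -> bmeasurable (fun w => `|f w|).
Proof.
move=> [mf [M fM]]; split; first exact: measurableT_comp.
by exists M => w; rewrite normr_id.
Qed.

Lemma bmeasurable_indic (A : set T) : measurable A -> bmeasurable (\1_A).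
Proof.
move=> mA; split; first exact: measurable_indic.
by exists 1 => w; rewrite indicE; case: (_ \in _); rewrite ?normr1 ?normr0.
Qed.

Lemma bmeasurable_lt (f g : T -> R) (eps : R) : bmeasurable f ->
  bmeasurable g -> bmeasurable (fun w => if f w < eps then g w else 0).
Proof.
move=> [mf _] [mg [M gM]]; split; last first.
  exists M => w; case: ifP => // _; rewrite normr0; exact: le_trans (gM w).
apply: measurable_fun_ifT => //.
by apply: measurable_fun_ltr => //; exact: measurable_cst.
Qed.

End bounded_functions.

Section expectation.
Context {d : measure_display} {T : measurableType d} {R : realType}.
Context (P : probability T R).
Local Notation Ex f := (\int[P]_w f w).

Lemma bmeasurable_integrable (f : T -> R) :
  bmeasurable f -> P.-integrable setT (EFin \o f).
Proof.
move=> [mf [M fM]]; apply: measurable_bounded_integrable => //.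
  by rewrite ltey_eq fin_num_measure.
by exists M; split=> [|x Mx w _ /=]; [exact: num_real|exact: le_trans (ltW Mx)].
Qed.

Lemma Rintegral_prob_cst (a : R) : Ex (fun=> a) = a.
Proof.
rewrite Rintegral_cst// (_ : fine _ = 1) ?mulr1//.
by rewrite -[RHS]/(fine 1%E); congr fine; exact: probability_setT.
Qed.

(** Independence makes the law of the pair the product of the two laws, and Tonelli separates the
    integral. *)
Lemma ge0_integral_indep (f g : T -> R) :
  measurable_fun setT f -> measurable_fun setT g ->
  (forall w, 0 <= f w) -> (forall w, 0 <= g w) ->
  (forall A A', measurable A -> measurable A' ->
    P (f @^-1` A `&` g @^-1` A') = P (f @^-1` A) * P (g @^-1` A'))%E ->
  (\int[P]_w (f w * g w)%:E = (\int[P]_w (f w)%:E) * (\int[P]_w (g w)%:E))%E.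
Proof.
move=> mf mg f0 g0 ind.
pose X : {mfun T >-> R} := mfun_Sub (mem_set mf).
pose Y : {mfun T >-> R} := mfun_Sub (mem_set mg).
have mZ : measurable_fun setT (fun w => (f w, g w)).
  exact/measurable_fun_pairP.
pose Z : {mfun T >-> (R * R)%type} := mfun_Sub (mem_set mZ).
have mn : measurable_fun setT (fun r : R => (`|r| : R)%:E).
  by apply/measurable_EFinP; exact: normr_measurable.
have mn2 : measurable_fun setT (fun z : R * R => (`|z.1| * `|z.2| : R)%:E).
  apply/measurable_EFinP; apply: measurable_funM.
    by apply: measurableT_comp => //; exact: measurable_fst.
  by apply: measurableT_comp => //; exact: measurable_snd.
(* Absolute values make the integrand nonnegative on the whole plane, not only on the range of
   [Z]. *)
transitivity (\int[distribution P Z]_z (`|z.1| * `|z.2| : R)%:E)%E.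
  rewrite ge0_integral_distribution; [|exact: mn2|by move=> z; rewrite lee_fin mulr_ge0].
  by apply: eq_integral => w _ /=; rewrite !ger0_norm.
transitivity (\int[(distribution P X \x distribution P Y)%E]_z (`|z.1| * `|z.2| : R)%:E)%E.
  apply: eq_measure_integral => A mA _.
  by apply/esym/product_measure_unique.
rewrite fubini_tonelli1; [|exact: mn2|by move=> z; rewrite lee_fin mulr_ge0].
rewrite /fubini_F /=.
transitivity (\int[distribution P X]_x ((`|x| : R)%:E * \int[P]_w (g w)%:E))%E.
  apply: eq_integral => x _.
  under eq_integral do rewrite EFinM.
  rewrite ge0_integralZl_EFin//.
  rewrite ge0_integral_distribution//; congr (_ * _)%E.
  by apply: eq_integral => w _ /=; rewrite ger0_norm.
rewrite ge0_integralZr//; last by apply: integral_ge0 => w _; rewrite lee_fin.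
rewrite ge0_integral_distribution//; congr (_ * _)%E.
by apply: eq_integral => w _ /=; rewrite ger0_norm.
Qed.

(** Adding the bounds [M] and [N] makes both factors nonnegative; the extra terms are linear and
    cancel. *)
Lemma Rintegral_indep (f g : T -> R) : bmeasurable f -> bmeasurable g ->
  (forall A A', measurable A -> measurable A' ->
    P (f @^-1` A `&` g @^-1` A') = P (f @^-1` A) * P (g @^-1` A'))%E ->
  Ex (fun w => f w * g w) = Ex f * Ex g.
Proof.
move=> bf bg ind; have [mf [M fM]] := bf; have [mg [N gN]] := bg.
have bf' : bmeasurable (fun w => f w + M) by apply: bmeasurableD => //; exact: bmeasurable_cst.
have bg' : bmeasurable (fun w => g w + N) by apply: bmeasurableD => //; exact: bmeasurable_cst.
have f0 w : 0 <= f w + M by have := fM w; rewrite ler_norml => /andP[]; lra.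
have g0 w : 0 <= g w + N by have := gN w; rewrite ler_norml => /andP[]; lra.
have sM (a : R) A : measurable A -> measurable ((fun x => x + a) @^-1` A).
  move=> mA; rewrite -[X in measurable X]setTI.
  by apply: (measurable_funD (@measurable_id _ _ _) (measurable_cst a)).
have E : Ex (fun w => (f w + M) * (g w + N)) =
    Ex (fun w => f w + M) * Ex (fun w => g w + N).
  rewrite /Rintegral ge0_integral_indep ?fineM//.
  - exact/integrable_fin_num/bmeasurable_integrable.
  - exact/integrable_fin_num/bmeasurable_integrable.
  - exact: bf'.1.
  - exact: bg'.1.
  - by move=> A A' mA mA'; apply: (ind _ _ (sM M A mA) (sM N A' mA')).
have Ef : Ex (fun w => f w + M) = Ex f + M.
  by rewrite RintegralD ?Rintegral_prob_cst//; apply: bmeasurable_integrable => //; exact: bmeasurable_cst.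
have Eg : Ex (fun w => g w + N) = Ex g + N.
  by rewrite RintegralD ?Rintegral_prob_cst//; apply: bmeasurable_integrable => //; exact: bmeasurable_cst.
have bfg : bmeasurable (fun w => f w * g w) by exact: bmeasurableM.
have Mg : bmeasurable (fun w => M * g w) by apply: bmeasurableM => //; exact: bmeasurable_cst.
have Nf : bmeasurable (fun w => N * f w) by apply: bmeasurableM => //; exact: bmeasurable_cst.
have MN : bmeasurable (fun _ : T => M * N) by exact: bmeasurable_cst.
have E2 : Ex (fun w => (f w + M) * (g w + N)) =
    Ex (fun w => f w * g w) + M * Ex g + N * Ex f + M * N.
  rewrite (_ : (fun w => _) = (fun w => f w * g w + M * g w + N * f w + M * N)); last first.
    by apply/funext => w; ring.
  have S1 := bmeasurableD bfg Mg; have S2 := bmeasurableD S1 Nf.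
  rewrite (RintegralD measurableT (bmeasurable_integrable S2) (bmeasurable_integrable MN)).
  rewrite (RintegralD measurableT (bmeasurable_integrable S1) (bmeasurable_integrable Nf)).
  rewrite (RintegralD measurableT (bmeasurable_integrable bfg) (bmeasurable_integrable Mg)).
  rewrite (RintegralZl _ measurableT (bmeasurable_integrable bf)).
  by rewrite (RintegralZl _ measurableT (bmeasurable_integrable bg)) Rintegral_prob_cst.
move: E; rewrite E2 Ef Eg => E.
by apply: (@addIr _ (M * Ex g + N * Ex f + M * N)); rewrite !addrA E; ring.
Qed.

Lemma le_Rintegral_bmeasurable (f g : T -> R) : bmeasurable f -> bmeasurable g ->
  (forall w, f w <= g w) -> Ex f <= Ex g.
Proof. by move=> bf bg fg; apply: le_Rintegral => //; exact: bmeasurable_integrable. Qed.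

Lemma chebyshev_sq (f : T -> R) (eps : R) : bmeasurable f -> 0 < eps ->
  (P [set w | (eps <= `|f w|)%R] <= (Ex (fun w => f w ^+ 2) / eps ^+ 2)%:E)%E.
Proof.
move=> bf eps0; have mE : measurable [set w | eps <= `|f w|].
  rewrite (_ : mkset _ = (fun w => `|f w|) @^-1` `[eps, +oo[); last first.
    by apply/seteqP; split=> w /=; rewrite in_itv/= andbT.
  rewrite -[X in measurable X]setTI.
  by apply: (measurableT_comp (@normr_measurable R setT) bf.1).
have bf2 : bmeasurable (fun w => f w ^+ 2 / eps ^+ 2).
  by apply: bmeasurableM; [exact: bmeasurableM|exact: bmeasurable_cst].
have <- : (\int[P]_w (\1_[set w | (eps <= `|f w|)%R] w)%:E = P [set w | (eps <= `|f w|)%R])%E.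
  by rewrite integral_indic// setIT.
have -> : Ex (fun w => f w ^+ 2) / eps ^+ 2 = Ex (fun w => f w ^+ 2 / eps ^+ 2).
  by rewrite RintegralZr//; apply: bmeasurable_integrable; exact: bmeasurableM.
rewrite /Rintegral fineK; last exact/integrable_fin_num/bmeasurable_integrable.
apply: ge0_le_integral => //.
- by apply/measurable_EFinP; exact: measurable_indic.
- by apply/measurable_EFinP; exact: bf2.1.
- move=> w _; rewrite lee_fin indicE.
  have [|_] := boolP (w \in _); last by rewrite divr_ge0// sqr_ge0.
  rewrite inE /= => fw; rewrite ler_pdivlMr ?exprn_gt0// mul1r -[leRHS]real_normK ?num_real//.
  by rewrite ler_sqr ?nnegrE ?(ltW eps0).
Qed.

End expectation.

Lemma measurable_borel (R : realType) (A : set R) : measurable A -> borel_set A.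
Proof.
move=> mA.
have : (@measurable_realfun.RGenOpens.G R).-sigma.-measurable A.
  by rewrite -measurable_realfun.RGenOpens.measurableE.
apply: smallest_sub; first exact: smallest_sigma_algebra.
by move=> _ [x [y ->]]; apply: sub_sigma_algebra; exact: interval_open.
Qed.

(** * Kolmogorov's inequality for bounded predictable transforms *)

Section filtration.
Context {d : measure_display} {T : measurableType d} {R : realType}.
Context (P : probability T R) {B : completeNormedModType R} (Y : nat -> T -> B).
Hypothesis mY : forall n A, borel_set A -> measurable (Y n @^-1` A).
Hypothesis indY : mutually_independent P Y.
Local Notation Ex f := (\int[P]_w f w).

Definition past_cylinder n : set (set T) :=
  [set E | exists A : nat -> set B, (forall i, borel_set (A i)) /\
     E = \bigcap_(i in `I_n) Y i @^-1` A i].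

(* The index [n] counts observed variables: [past n] is generated by [Y 0, ..., Y n.-1]. *)
Definition past n := g_sigma_algebraType (past_cylinder n).

Lemma borel_setT : borel_set [set: B].
Proof. by apply: borel_open; exact: openT. Qed.

Lemma past_cylinder_measurable n E : past_cylinder n E -> measurable E.
Proof.
move=> [A [bA ->]]; apply: fin_bigcap_measurable => [|i _]; last exact: mY.
exact: finite_II.
Qed.

Lemma past_measurable n (E : set T) : @measurable _ (past n) E -> @measurable _ T E.
Proof.
apply: (@smallest_sub _ _ _ (@measurable _ T)); last exact: past_cylinder_measurable.
exact: sigma_algebra_measurable.
Qed.

Lemma past_cylinderI n : setI_closed (past_cylinder n).
Proof.
move=> _ _ [A [bA ->]] [A' [bA' ->]]; exists (fun i => A i `&` A' i); split.
  by move=> i; exact: borelI.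
by rewrite -bigcapI.
Qed.

Lemma past_le n (E : set T) : @measurable _ (past n) E -> @measurable _ (past n.+1) E.
Proof.
apply: (@smallest_sub _ _ _ (@measurable _ (past n.+1))).
  exact: (@sigma_algebra_measurable _ (past n.+1)).
move=> _ [A [bA ->]]; apply: sub_sigma_algebra.
exists (fun i => if (i < n)%N then A i else setT); split.
  by move=> i; case: ifP => // _; exact: borel_setT.
apply/seteqP; split=> w H i /= ni.
  by case: ifP => // ni'; exact: H.
by have /= := H i (ltnW ni); rewrite ni.
Qed.

Lemma past_present n A : borel_set A -> @measurable _ (past n.+1) (Y n @^-1` A).
Proof.
move=> bA; apply: sub_sigma_algebra.
exists (fun i => if i == n then A else setT); split.
  by move=> i; case: ifP => // _; exact: borel_setT.
apply/seteqP; split=> w H.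
  by move=> i /= _; case: eqP => [->|].
by have /= := H n (ltnSn n); rewrite eqxx.
Qed.

(** Dynkin's argument: on cylinders this is mutual independence with one more variable, and the
    events satisfying the identity are stable under complements and countable disjoint unions. *)
Lemma past_independent n E A : @measurable _ (past n) E -> borel_set A ->
  (P (E `&` Y n @^-1` A) = P E * P (Y n @^-1` A))%E.
Proof.
move=> + bA; apply: (@dynkin_induction _ (past n) (past_cylinder n)
  [set E | (P (E `&` Y n @^-1` A) = P E * P (Y n @^-1` A))%E]) => //.
- exact: past_cylinderI.
- by rewrite /mkset setTI (_ : P [set: past n] = 1%E) ?mul1e//; exact: probability_setT.
- move=> _ [S [bS ->]] /=.
  have iotaE k : [set` iota 0 k] = `I_k.
    by apply/seteqP; split=> i /=; rewrite mem_iota.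
  have SE := indY (iota_uniq 0 n) bS; rewrite iotaE in SE; rewrite [in RHS]SE.
  pose S' i := if i == n then A else S i.
  have bS' i : borel_set (S' i) by rewrite /S'; case: ifP.
  have S'E i : (i < n)%N -> S' i = S i by move=> ni; rewrite /S' ltn_eqF.
  have := indY (iota_uniq 0 n.+1) bS'; rewrite iotaE -addn1 iotaD add0n big_cat/= big_seq1.
  have S'n : S' n = A by rewrite /S' eqxx.
  rewrite S'n.
  rewrite (eq_big_seq (fun i => P (Y i @^-1` S i))); last first.
    by move=> i; rewrite mem_iota /= add0n => /S'E ->.
  move=> <-; congr (P _); apply/seteqP; split=> w /=.
    move=> [H HA] i /=; rewrite addn1 ltnS leq_eqVlt => /predU1P[->|ni].
      by rewrite /S' eqxx.
    by rewrite S'E//; exact: H.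
  move=> H; split=> [i /= ni|].
    by rewrite -S'E//; apply: H; rewrite /= addn1 ltnW// ltnS.
  by have /= := H n; rewrite addn1 ltnSn /S' eqxx; exact.
- move=> S mS /= PS.
  have mS' := past_measurable mS.
  have mYA := mY n bA.
  have mI : @measurable _ T (S `&` Y n @^-1` A) by exact: (@measurableI _ T).
  rewrite setIC -setDE measureD//; last by rewrite ltey_eq fin_num_measure.
  rewrite [X in (_ - P X)%E]setIC PS.
  have -> : P (~` S) = (1 - P S)%E by exact: probability_setC.
  by rewrite muleBl ?mul1e ?fin_num_measure// fin_num_adde_defr// fin_num_measure.
- move=> F mF tF /= PF.
  have mF' k := past_measurable (mF k).
  rewrite setI_bigcupl measure_bigcup//=; last 2 first.
  + by move=> k _; apply: measurableI => //; exact: mY.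
  + move=> i j _ _ [w [[Fi _] [Fj _]]]; apply: tF => //; by exists w.
  rewrite measure_bigcup//.
  have pE : P (Y n @^-1` A) = (fine (P (Y n @^-1` A)))%:E.
    by rewrite fineK// fin_num_measure//; exact: mY.
  rewrite pE muleC -nneseriesZl//.
  by apply: eq_eseriesr => k _; rewrite muleC -pE; exact: PF.
Qed.

Lemma past_bmeasurable n (f : T -> R) :
  @bmeasurable _ (past n) R f -> bmeasurable f.
Proof.
move=> [mf bf]; split=> // _ A mA.
by apply: (@past_measurable n); exact: mf.
Qed.

Lemma past_bmeasurableS n (f : T -> R) :
  @bmeasurable _ (past n) R f -> @bmeasurable _ (past n.+1) R f.
Proof. by move=> [mf bf]; split=> // _ A mA; apply: past_le; exact: mf. Qed.

Lemma past_bmeasurable_present n (h : B -> R) : borel_fun h ->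
  (exists M : R, forall x, `|h x| <= M) ->
  @bmeasurable _ (past n.+1) R (h \o Y n).
Proof.
move=> bh [M hM]; split; last by exists M => w; exact: hM.
apply: (@measurable_fun_open _ (past n.+1)) => O oO.
by rewrite comp_preimage; apply: past_present; apply: bh; exact: sub_sigma_algebra.
Qed.

Lemma Rintegral_past_present n (f : T -> R) (h : B -> R) :
  @bmeasurable _ (past n) R f -> borel_fun h -> (exists M : R, forall x, `|h x| <= M) ->
  Ex (fun w => f w * h (Y n w)) = Ex f * Ex (h \o Y n).
Proof.
move=> bf bh hM.
apply: (@Rintegral_indep _ _ _ P f (h \o Y n)).
- exact: past_bmeasurable bf.
- exact: past_bmeasurable (past_bmeasurable_present _ bh hM).
- move=> A A' mA mA'; apply: (past_independent (A := h @^-1` A')).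
    by rewrite -[X in measurable X]setTI; exact: bf.1.
  by apply: bh; exact: measurable_borel.
Qed.

Section martingale.
Context (b : nat -> T -> R) (K : R) (h : nat -> B -> R).
Hypothesis mb : forall n, @measurable_fun _ _ (past n) R setT (b n).
Hypothesis bK : forall n w, `|b n w| <= K.
Hypothesis bh : forall n, borel_fun (h n).
Hypothesis hM : forall n, exists M : R, forall x, `|h n x| <= M.
Hypothesis h0 : forall n, Ex (h n \o Y n) = 0.

(** The partial sum from [m] on, frozen once it has reached [eps] in absolute value. Freezing is a
    predictable change of the coefficient, so the maximal inequality reduces to Chebyshev at the
    last time. *)
Fixpoint stopped_sum (eps : R) m j (w : T) : R := if j is i.+1 then
    let t := stopped_sum eps m i w in
    t + (if `|t| < eps then b (m + i)%N w else 0) * h (m + i)%N (Y (m + i)%N w)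
  else 0.

Lemma stopped_sum_past eps m j : @bmeasurable _ (past (m + j)) R (stopped_sum eps m j).
Proof.
elim: j => [|j IH]; first exact: bmeasurable_cst.
rewrite addnS /=; apply: bmeasurableD; first exact: past_bmeasurableS.
apply: bmeasurableM; last exact: past_bmeasurable_present.
apply: past_bmeasurableS; apply: bmeasurable_lt; first exact: bmeasurable_norm.
by split=> //; exists K.
Qed.

(** The sum so far times the stopped coefficient depends on the past only, and [h k \o Y k] has mean
    zero: cross terms vanish and second moments add up. *)
Lemma stopped_sum_sq_le eps m j : Ex (fun w => stopped_sum eps m j w ^+ 2) <=
  K ^+ 2 * \sum_(m <= k < m + j) Ex (fun w => h k (Y k w) ^+ 2).
Proof.
elim: j => [|j IH] /=.
  by rewrite addn0 big_geq// mulr0 expr0n /= Rintegral_prob_cst.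
rewrite addnS big_nat_recr ?leq_addr//= mulrDr.
set t := stopped_sum eps m j.
pose c w := if `|t w| < eps then b (m + j)%N w else 0.
have bt := stopped_sum_past eps m j.
have bc : @bmeasurable _ (past (m + j)) R c.
  by apply: bmeasurable_lt; [exact: bmeasurable_norm|split=> //; exists K].
have bt2 : @bmeasurable _ (past (m + j)) R (fun w => 2 * (t w * c w)).
  by apply: bmeasurableM; [exact: bmeasurable_cst|exact: bmeasurableM].
have bt' := past_bmeasurable bt; have bc' := past_bmeasurable bc.
have bt2' := past_bmeasurable bt2.
have bhY := past_bmeasurable (past_bmeasurable_present (m + j) (bh (m + j)) (hM (m + j))).
have E : (fun w => (t w + c w * h (m + j) (Y (m + j) w)) ^+ 2) =
  (fun w => t w ^+ 2 + 2 * (t w * c w) * h (m + j) (Y (m + j) w) +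
    (c w * h (m + j) (Y (m + j) w)) ^+ 2).
  by apply/funext => w; ring.
rewrite -/(c _) E.
have b1 : bmeasurable (fun w => t w ^+ 2) by exact: bmeasurableM.
have b2 : bmeasurable (fun w => 2 * (t w * c w) * h (m + j) (Y (m + j) w)).
  exact: bmeasurableM.
have b3 : bmeasurable (fun w => (c w * h (m + j) (Y (m + j) w)) ^+ 2).
  by apply: bmeasurableM; exact: bmeasurableM.
have b4 : bmeasurable (fun w => h (m + j) (Y (m + j) w) ^+ 2) by exact: bmeasurableM.
have b5 : bmeasurable (fun w => K ^+ 2 * h (m + j) (Y (m + j) w) ^+ 2).
  by apply: bmeasurableM => //; exact: bmeasurable_cst.
have b12 := bmeasurableD b1 b2.
rewrite (RintegralD measurableT (bmeasurable_integrable P b12) (bmeasurable_integrable P b3)).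
rewrite (RintegralD measurableT (bmeasurable_integrable P b1) (bmeasurable_integrable P b2)).
rewrite (Rintegral_past_present bt2 (bh _) (hM _)) h0 mulr0 addr0.
apply: lerD => //.
rewrite -(RintegralZl _ measurableT (bmeasurable_integrable P b4)).
apply: le_Rintegral_bmeasurable => // w.
rewrite exprMn ler_wpM2r ?sqr_ge0// -real_normK ?num_real// ler_sqr ?nnegrE//.
  by rewrite /c; case: ifP => // _; rewrite normr0; exact: le_trans (bK 0%N w).
exact: le_trans (bK 0%N w).
Qed.

(** Before the first crossing the stopped sum is the true one; at the crossing it freezes and so
    remembers it. *)
Lemma stopped_sum_maximal eps m j w :
  (exists i, (i <= j)%N /\ eps <= `|\sum_(m <= k < m + i) b k w * h k (Y k w)|) ->
  eps <= `|stopped_sum eps m j w|.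
Proof.
have H i : stopped_sum eps m i w = \sum_(m <= k < m + i) b k w * h k (Y k w) \/
    eps <= `|stopped_sum eps m i w|.
  elim: i => [|i [IH|IH]]; first by left; rewrite addn0 big_geq.
    have [lt|le] := ltP `|stopped_sum eps m i w| eps; last first.
      by right; rewrite /= ltNge le /= mul0r addr0.
    by left; rewrite addnS big_nat_recr ?leq_addr//= lt IH.
  by right; rewrite /= ltNge IH /= mul0r addr0.
have S i : eps <= `|stopped_sum eps m i w| -> forall l,
    eps <= `|stopped_sum eps m (i + l) w|.
  move=> Hi; elim=> [|l IH]; first by rewrite addn0.
  by rewrite addnS /= ltNge IH /= mul0r addr0.
move=> [i [ij epsS]]; rewrite -(subnKC ij); apply: S.
by have [->|] := H i.
Qed.

(** The probability of an excursion of size [eps] after time [m] is at most [K ^+ 2 / eps ^+ 2]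
    times a tail of the second moments. So outside a null set each [1 / (k + 1)] has an [m] after
    which the partial sums stay that close, which is the Cauchy property. *)
Lemma martingale_cvg :
  cvgn (series (fun n => Ex (fun w => h n (Y n w) ^+ 2))) ->
  {ae P, forall w, cvgn (series (fun n => b n w * h n (Y n w)))}.
Proof.
move=> vC.
set v := (fun n => Ex (fun w => h n (Y n w) ^+ 2)) in vC.
have v0 n : 0 <= v n by apply: Rintegral_ge0 => w _; exact: sqr_ge0.
have K0 : 0 <= K ^+ 2 by exact: sqr_ge0.
pose E eps m j := [set w | (eps <= `|stopped_sum eps m j w|)%R].
have mE (eps : R) m j : measurable (E eps m j).
  rewrite (_ : E eps m j = (fun w => `|stopped_sum eps m j w|) @^-1` `[eps, +oo[); last first.
    by apply/seteqP; split=> w /=; rewrite in_itv/= andbT.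
  rewrite -[X in measurable X]setTI.
  by apply: (measurableT_comp (@normr_measurable R setT) (past_bmeasurable (stopped_sum_past eps m j)).1).
have Etail eps : 0 < eps -> forall delta, 0 < delta ->
    exists m, (P (\bigcup_j E eps m j) <= delta%:E)%E.
  move=> eps0 delta delta0.
  have d'0 : 0 < delta * eps ^+ 2 / (K ^+ 2 + 1).
    by rewrite divr_gt0 ?mulr_gt0 ?exprn_gt0// ltr_wpDl.
  have /cauchy_cvgP/cauchy_seriesP/(_ _ d'0)[[A A']/= [[N1 _ N1A] [N2 _ N2A]] AA] := vC.
  pose m := maxn N1 N2; exists m.
  have vm n : (m <= n)%N -> K ^+ 2 * \sum_(m <= k < n) v k <= delta * eps ^+ 2.
    move=> mn.
    have : `|\sum_(m <= k < n) v k| < delta * eps ^+ 2 / (K ^+ 2 + 1).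
      apply: (AA (m, n)); split => /=; first by apply: N1A => /=; rewrite /m leq_maxl.
      by apply: N2A => /=; apply: leq_trans mn; rewrite /m leq_maxr.
    rewrite ger0_norm ?sumr_ge0// ltr_pdivlMr ?ltr_wpDl// => /ltW; apply: le_trans.
    by rewrite mulrC ler_wpM2l ?sumr_ge0// lerDl.
  apply: (@cvge_le _ _ _ _ (fun j => P (E eps m j))); last first.
  - apply: nondecreasing_cvg_mu => //; first exact: bigcupT_measurable.
    apply/nondecreasing_seqP => j; apply/subsetPset => w.
    by rewrite /E /= => Ej; rewrite ltNge Ej /= mul0r addr0.
  - apply: nearW => j.
    have := chebyshev_sq P (past_bmeasurable (stopped_sum_past eps m j)) eps0.
    move=> /le_trans; apply; rewrite lee_fin ler_pdivrMr ?exprn_gt0//.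
    apply: le_trans (stopped_sum_sq_le eps m j) _.
    by apply: vm; rewrite leq_addr.
  exact: eventually_filter.
pose Z k := \bigcap_m \bigcup_j E k.+1%:R^-1 m j.
have Z0 k : P (Z k) = 0%E.
  have k0 : 0 < k.+1%:R^-1 :> R by rewrite invr_gt0.
  have mU m : measurable (\bigcup_j E k.+1%:R^-1 m j) by exact: bigcupT_measurable.
  have mZ : measurable (Z k) by exact: bigcapT_measurable.
  apply/eqP; rewrite eq_le measure_ge0 andbT; apply/lee_addgt0Pr => e e0.
  rewrite add0e; have [m Pm] := Etail _ k0 e e0.
  apply: le_trans Pm; apply: le_measure; rewrite ?inE//.
  by move=> w; apply.
apply: (@negligibleS _ _ _ _ (\bigcup_k Z k)); last first.
  apply: negligible_bigcup => k; apply/negligibleP; last exact: Z0.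
  by apply: bigcapT_measurable => m; exact: bigcupT_measurable.
move=> w; apply: contra_notP => nZ.
apply/cauchy_cvgP/cauchy_exP => e e0.
have [k _ ke] := near_infty_natSinv_lt (PosNum e0).
have : ~ Z k w by move=> Zk; apply: nZ; exists k.
move=> /existsNP[m /not_implyP[_ nE]].
exists (series (fun n => b n w * h n (Y n w)) m).
exists m => // n /= mn; rewrite -ball_normE /= distrC sub_series_geq//.
apply: lt_trans (ke _ (leqnn k)); rewrite /= ltNge; apply/negP => H.
apply: nE; exists (n - m)%N => //; apply: stopped_sum_maximal.
by exists (n - m)%N; split=> //; rewrite subnKC.
Qed.

End martingale.

End filtration.

(** * Averaging of discretized noise *)

Section summability.
Context {R : realType}.
Implicit Type x : nat -> R.

Lemma cvgn_series_ereal x : (forall n, 0 <= x n) -> cvgn (series x) ->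
  (\sum_(0 <= n <oo) (x n)%:E < +oo)%E.
Proof.
move=> x0 xC; rewrite (_ : (\sum_(_ <= _ <oo) _)%E = (limn (series x))%:E) ?ltry//.
rewrite -EFin_lim//; congr (limn _); apply/funext => n /=.
by rewrite /series /= sumEFin.
Qed.

Lemma ereal_cvgn_series x : (forall n, 0 <= x n) ->
  (\sum_(0 <= n <oo) (x n)%:E < +oo)%E -> cvgn (series x).
Proof.
move=> x0 xoo; apply: nondecreasing_is_cvgn.
  by apply/nondecreasing_seqP => n; rewrite /series /= big_nat_recr//= lerDl.
have s0 : (0 <= \sum_(0 <= n <oo) (x n)%:E)%E.
  by apply: nneseries_ge0 => n _; rewrite lee_fin.
exists (fine (\sum_(0 <= n <oo) (x n)%:E)%E) => _ [n _ <-].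
rewrite -lee_fin fineK ?ge0_fin_numE// /series /= -sumEFin.
by apply: nneseries_lim_ge => // i _; rewrite lee_fin.
Qed.

End summability.

Section cells.
Context {R : realType} {B : completeNormedModType R}.
Implicit Types (v : seq B) (eps : R) (x : B).

(* [cell v eps i] is the part of the [eps]-ball around the [i]-th point of [v]
   not covered by earlier balls; [cell v eps (size v)] is what no ball covers. *)
Definition cell v eps i : set B := [set x | find (fun c => `|x - c| < eps) v = i].

Lemma cell_borel v eps i : borel_set (cell v eps i).
Proof.
elim: v i => [|c v IH] i.
  case: i => [|i]; first by rewrite (_ : cell _ _ _ = setT) ?predeqE//; exact: borel_setT.
  rewrite (_ : cell _ _ _ = set0); first exact: sigma_algebra0.
  by rewrite -subset0 => x.
have bc : borel_set [set x | `|x - c| < eps].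
  have [eps0|eps0] := ltP 0 eps; last first.
    rewrite (_ : mkset _ = set0); first exact: sigma_algebra0.
    by rewrite -subset0 => x /= /lt_le_trans/(_ eps0); rewrite ltNge normr_ge0.
  apply: borel_open; rewrite (_ : mkset _ = ball c eps); first exact: ball_open.
  by rewrite -ball_normE; apply/seteqP; split=> x /=; rewrite distrC.
case: i => [|i].
  rewrite (_ : cell _ _ _ = [set x | `|x - c| < eps]) //.
  by apply/seteqP; split=> x; rewrite /cell /=; case: ifP.
rewrite (_ : cell _ _ _ = ~` [set x | `|x - c| < eps] `&` cell v eps i).
  by apply: borelI => //; exact: borelC.
apply/seteqP; split=> x; rewrite /cell /=.
  by case: ifP => // /negbT; rewrite -leNgt => H [<-]; split=> //; apply/negP; rewrite -leNgt.
by move=> [/negP/negbTE -> ->].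
Qed.

(** Projection to the first center within [eps]. A point that no ball covers goes to [0], the
    default of [nth], so its error is its own norm. *)
Lemma cell_sum v eps x : \sum_(i < size v) \1_(cell v eps i) x *: nth 0 v i =
  nth 0 v (find (fun c => `|x - c| < eps) v).
Proof.
set k := find _ _.
have E i : \1_(cell v eps i) x = (i == k)%:R :> R.
  rewrite indicE; congr (_%:R : R); congr nat_of_bool.
  by apply/idP/eqP; rewrite inE /cell /= -/k => ->.
under eq_bigr do rewrite E.
have [kv|vk] := ltnP k (size v).
  rewrite (bigD1 (Ordinal kv))//= eqxx scale1r big1 ?addr0// => i ik.
  by rewrite (_ : (i == k :> nat) = false) ?scale0r//; apply/negbTE.
rewrite nth_default// big1// => i _.
by rewrite ltn_eqF ?scale0r// (leq_trans (ltn_ord i)).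
Qed.

Lemma cell_dist v eps x : 0 < eps ->
  `|x - nth 0 v (find (fun c => `|x - c| < eps) v)| <=
  eps + `|x| * \1_(cell v eps (size v)) x.
Proof.
move=> eps0; have [kv|vk] := boolP (has (fun c => `|x - c| < eps) v).
  apply: le_trans (ltW (nth_find 0 kv)) _; rewrite lerDl.
  by rewrite mulr_ge0// indicE.
have E : cell v eps (size v) x by rewrite /cell /= hasNfind.
rewrite hasNfind// nth_default// subr0 indicE mem_set// mulr1 lerDr.
exact: ltW.
Qed.

Lemma cell_indic01 v eps i x : 0 <= (\1_(cell v eps i) x : R) <= 1.
Proof. by rewrite indicE; case: (_ \in _); rewrite ?ler01 ?lexx. Qed.

End cells.

Section noise.
Context {d : measure_display} {T : measurableType d} {R : realType}.
Context (P : probability T R) {B : completeNormedModType R} (Y : nat -> T -> B).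
Hypothesis sY : forall n, strongly_measurable (Y n).
Hypothesis indY : mutually_independent P Y.
Context (beta : nat -> R).
Hypothesis beta_gt0 : forall n, 0 < beta n.
Hypothesis beta_sq : cvgn (series (fun n => beta n ^+ 2)).
Hypothesis trunc_moment : cvgn (series (fun n =>
  \int[P]_w Num.min 1 ((beta n * `|Y n w|) ^+ 2))).
Local Notation Ex f := (\int[P]_w f w).

Let mY n A : borel_set A -> measurable (Y n @^-1` A).
Proof. by apply: measurable_preimage_borel => V; exact: strongly_measurable_open. Qed.

Lemma norm_measurable n : measurable_fun setT (fun w => `|Y n w|).
Proof.
apply: measurable_fun_open => V oV.
rewrite (_ : _ @^-1` _ = Y n @^-1` ((fun x : B => `|x|) @^-1` V)) //.
apply: mY; apply: borel_open; apply: open_comp => // x _; exact: norm_continuous.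
Qed.

Lemma beta_norm_measurable n : measurable_fun setT (fun w => beta n * `|Y n w|).
Proof. by apply: measurable_funM; [exact: measurable_cst|exact: norm_measurable]. Qed.

Lemma trunc_bmeasurable n :
  bmeasurable (fun w => Num.min 1 ((beta n * `|Y n w|) ^+ 2)).
Proof.
split.
  apply: measurable_minr; first exact: measurable_cst.
  by apply: measurable_funX; exact: beta_norm_measurable.
exists 1 => w; rewrite ger0_norm ?ge_min ?lexx//.
by rewrite le_min ler01 sqr_ge0.
Qed.

(** [min 1 (t ^+ 2)] dominates the indicator of [t > 1], so Borel-Cantelli applies; truncating at
    [beta n * |Y n| <= 1] is then eventually harmless. *)
Lemma ae_small_increments :
  {ae P, forall w, \forall n \near \oo, beta n * `|Y n w| <= 1}.
Proof.
pose F n := [set w | 1 < beta n * `|Y n w|].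
have mF n : measurable (F n).
  rewrite (_ : F n = (fun w => beta n * `|Y n w|) @^-1` `]1, +oo[); last first.
    by apply/seteqP; split=> w /=; rewrite in_itv/= andbT.
  by rewrite -[X in measurable X]setTI; exact: beta_norm_measurable.
have F0 : P (lim_sup_set F) = 0%E.
  apply: lim_sup_set_cvg0 => //.
  apply: le_lt_trans (cvgn_series_ereal _ trunc_moment); last first.
    by move=> n; apply: Rintegral_ge0 => w _; rewrite le_min ler01 sqr_ge0.
  apply: lee_nneseries => // n _.
  apply: (@le_trans _ _ (\int[P]_w (\1_(F n) w)%:E)%E).
    by rewrite integral_indic// setIT.
  rewrite /Rintegral fineK; last exact/integrable_fin_num/bmeasurable_integrable/trunc_bmeasurable.
  apply: ge0_le_integral => //.
  - by apply/measurable_EFinP; exact: measurable_indic.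
  - by apply/measurable_EFinP; exact: (trunc_bmeasurable n).1.
  - move=> w _; rewrite lee_fin indicE.
    have [|_] := boolP (w \in _); last by rewrite le_min ler01 sqr_ge0.
    by rewrite inE /F /= => Fw; rewrite le_min lexx/= expr_ge1 ?ltW// (lt_trans _ Fw).
apply: (@negligibleS _ _ _ _ (lim_sup_set F)); last first.
  apply/negligibleP => //.
  by apply: bigcapT_measurable => n; apply: bigcup_measurable.
move=> w; apply: contra_notP => nF; move: nF => /existsNP[N /not_implyP[_ nF]].
exists N => // n /= Nn; rewrite leNgt; apply/negP => H; apply: nF.
by exists n.
Qed.

(** The increments are centered and bounded by [beta n] up to the factor [a], so [beta_sq] sums
    their variances even if [Y] has none. *)
Lemma cell_noise_cvg (a : nat -> T -> R) K v eps i :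
  (forall n, @measurable_fun _ _ (past Y n) R setT (a n)) ->
  (forall n w, `|a n w| <= K) ->
  {ae P, forall w, cvgn (series (fun n => a n w * (beta n *
     (\1_(cell v eps i) (Y n w) - fine (P (Y n @^-1` cell v eps i))))))}.
Proof.
move=> ma aK.
set A := cell v eps i.
pose p n := fine (P (Y n @^-1` A)).
have bA : borel_set A by exact: cell_borel.
have p01 n : 0 <= p n <= 1.
  rewrite /p fine_ge0//=; rewrite -lee_fin fineK ?fin_num_measure//; last exact: mY.
  by apply: probability_le1; exact: mY.
have i01 x : 0 <= (\1_A x : R) <= 1 by exact: cell_indic01.
pose h n x := beta n * (\1_A x - p n).
have bh n : borel_fun (h n).
  move=> S bS; pose BB := g_sigma_algebraType (@open B).
  have mI : @measurable_fun _ _ BB R setT (h n).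
    apply: measurable_funM; first exact: measurable_cst.
    by apply: measurable_funB; [exact: measurable_indic|exact: measurable_cst].
  have mS : measurable S.
    move: bS; apply: smallest_sub; first exact: sigma_algebra_measurable.
    by move=> V oV; exact: open_measurable.
  by have := mI measurableT S mS; rewrite setTI.
have hle n x : `|h n x| <= beta n.
  rewrite /h normrM (gtr0_norm (beta_gt0 n)) ler_piMr ?(ltW (beta_gt0 n))//.
  have /andP[? ?] := i01 x; have /andP[? ?] := p01 n.
  by rewrite ler_norml; apply/andP; split; lra.
have bhY n : bmeasurable (h n \o Y n).
  apply: (@past_bmeasurable _ _ _ _ _ mY n.+1).
  by apply: past_bmeasurable_present => //; exists (beta n).
have Iint n : P.-integrable setT (EFin \o (\1_(Y n @^-1` A) : T -> R)).
  by apply/bmeasurable_integrable/bmeasurable_indic; exact: mY.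
apply: (@martingale_cvg _ _ _ P _ Y mY indY a K h) => //.
- by move=> n; exists (beta n).
- move=> n.
  rewrite (_ : (fun w => (h n \o Y n) w) =
    (fun w => beta n * (\1_(Y n @^-1` A) w - p n))) //.
  rewrite RintegralZl//; last first.
    apply/bmeasurable_integrable/bmeasurableB; last exact: bmeasurable_cst.
    by apply: bmeasurable_indic; exact: mY.
  rewrite RintegralB//; last exact/bmeasurable_integrable/bmeasurable_cst.
  rewrite Rintegral_prob_cst (_ : Ex _ = p n) ?subrr ?mulr0//.
  by rewrite /Rintegral integral_indic ?setIT//; exact: mY.
- apply: series_le_cvg beta_sq.
  + by move=> n; apply: Rintegral_ge0 => w _; exact: sqr_ge0.
  + by move=> n; exact: sqr_ge0.
  + move=> n; rewrite -[leRHS](Rintegral_prob_cst P).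
    apply: le_Rintegral_bmeasurable.
    * exact: (bmeasurableM (bhY n) (bhY n)).
    * exact: bmeasurable_cst.
    * by move=> w; rewrite -real_normK ?num_real// ler_sqr ?nnegrE// ltW.
Qed.

(** The norm of an uncovered point may have infinite variance. Truncated at [beta n * |x| <= 1] and
    weighted by [beta n], its second moment is at most the summand of [trunc_moment]; [g] is this
    truncation minus its mean, and the mean is at most [eps]. *)
Lemma residual_noise_cvg v eps : 0 < eps ->
  (forall n, (\int[P]_w (`|Y n w| * \1_(cell v eps (size v)) (Y n w))%:E <= eps%:E)%E) ->
  exists g : nat -> B -> R, {ae P, forall w, cvgn (series (fun n => beta n * g n (Y n w)))} /\
    forall n x, beta n * `|x| <= 1 -> `|x| * \1_(cell v eps (size v)) x <= eps + g n x.
Proof.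
move=> eps0 resid.
set A := cell v eps (size v) in resid *.
have bA : borel_set A by exact: cell_borel.
pose BB := g_sigma_algebraType (@open B).
pose f n x : R := `|x| * \1_A x * \1_[set x : B | beta n * `|x| <= 1] x.
have mn : @measurable_fun _ _ BB R setT (fun x : B => `|x|).
  apply: (@measurable_fun_open _ BB) => V oV; apply: borel_open.
  by apply: open_comp => // x _; exact: norm_continuous.
have mbn n : @measurable_fun _ _ BB R setT (fun x : B => beta n * `|x|).
  by apply: measurable_funM; [exact: measurable_cst|exact: mn].
have mf n : @measurable_fun _ _ BB R setT (f n).
  apply: measurable_funM; first by apply: measurable_funM; [exact: mn|exact: measurable_indic].
  apply: measurable_indic.
  rewrite (_ : mkset _ = (fun x : BB => beta n * `|x : B|) @^-1` `]-oo, 1]); last first.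
    by apply/seteqP; split=> x /=; rewrite in_itv/=.
  by rewrite -[X in measurable X]setTI; exact: mbn.
have f0 n x : 0 <= f n x by rewrite /f !mulr_ge0// indicE.
have fle n x : (beta n * f n x) ^+ 2 <= Num.min 1 ((beta n * `|x|) ^+ 2).
  have bx0 : 0 <= beta n * `|x| by rewrite mulr_ge0// ltW.
  rewrite /f [\1_[set x : B | _] x]indicE.
  have [|_] := boolP (x \in _); last first.
    by rewrite !mulr0 expr0n /= le_min ler01 sqr_ge0.
  rewrite inE /= mulr1 => bx1; rewrite mulrA.
  have i01 := cell_indic01 v eps (size v) x.
  have : 0 <= beta n * `|x| * \1_A x <= beta n * `|x|.
    by have /andP[i0 i1] := i01; rewrite mulr_ge0//= ler_piMr.
  move=> /andP[H0 H1]; rewrite le_min -{1}(expr1n _ 2) !ler_sqr ?nnegrE// H1 andbT.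
  exact: le_trans H1 bx1.
have fbd n x : f n x <= (beta n)^-1.
  have := fle n x; rewrite le_min => /andP[+ _].
  rewrite -{1}(expr1n _ 2) ler_sqr ?nnegrE ?mulr_ge0//; last exact: ltW.
  by rewrite -[(beta n)^-1]mul1r ler_pdivlMr// mulrC.
have bfY n : bmeasurable (f n \o Y n).
  split; last by exists (beta n)^-1 => w /=; rewrite ger0_norm.
  move=> _ S mS; rewrite setTI comp_preimage; apply: mY.
  by have := mf n measurableT S mS; rewrite setTI.
pose m n := Ex (f n \o Y n).
have m0 n : 0 <= m n by apply: Rintegral_ge0 => w _; exact: f0.
have meps n : m n <= eps.
  rewrite -lee_fin /m /Rintegral fineK; last exact/integrable_fin_num/bmeasurable_integrable.
  apply: le_trans (resid n); apply: ge0_le_integral => //.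
  - by move=> w _; rewrite lee_fin; exact: f0.
  - by apply/measurable_EFinP; exact: (bfY n).1.
  - apply/measurable_EFinP; apply: measurable_funM; first exact: norm_measurable.
    rewrite (_ : (fun x => \1_A (Y n x)) = \1_(Y n @^-1` A))//.
    by apply: measurable_indic; exact: mY.
  - move=> w _; rewrite lee_fin /f /= ler_piMr//.
exists (fun n x => f n x - m n); split; last first.
  move=> n x bx; have -> : `|x| * \1_A x = f n x by rewrite /f [X in _ = _ * X]indicE mem_set// mulr1.
  by have := meps n; lra.
have bh n : borel_fun (fun x => beta n * (f n x - m n)).
  move=> S bS.
  have mI : @measurable_fun _ _ BB R setT (fun x => beta n * (f n x - m n)).
    apply: measurable_funM; first exact: measurable_cst.
    by apply: measurable_funB; [exact: mf|exact: measurable_cst].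
  have mS : measurable S.
    move: bS; apply: smallest_sub; first exact: sigma_algebra_measurable.
    by move=> V oV; exact: open_measurable.
  by have := mI measurableT S mS; rewrite setTI.
have bfm n : bmeasurable (fun w => f n (Y n w) - m n).
  exact: (bmeasurableB (bfY n) (bmeasurable_cst (m n))).
have Efm n : Ex (fun w => f n (Y n w) - m n) = 0.
  have bfY' : bmeasurable (fun w => f n (Y n w)) by exact: bfY.
  have bm : bmeasurable (fun _ : T => m n) by exact: bmeasurable_cst.
  rewrite (RintegralB measurableT (bmeasurable_integrable P bfY') (bmeasurable_integrable P bm)).
  by rewrite Rintegral_prob_cst subrr.
have H : {ae P, forall w, cvgn (series (fun n => 1 * (beta n * (f n (Y n w) - m n))))}.
  apply: (@martingale_cvg _ _ _ P _ Y mY indY (fun _ _ => 1) 1 (fun n x => beta n * (f n x - m n))) => //.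
  - by move=> n w; rewrite normr1.
  - move=> n; exists (beta n * ((beta n)^-1 + eps)) => x.
    rewrite normrM (gtr0_norm (beta_gt0 n)) ler_wpM2l ?(ltW (beta_gt0 n))//.
    apply: le_trans (ler_normB _ _) _; rewrite !ger0_norm// lerD//.
  - move=> n; rewrite (_ : (fun w => _) = (fun w => beta n * (f n (Y n w) - m n)))//.
    by rewrite RintegralZl ?Efm ?mulr0//; exact: bmeasurable_integrable.
  - apply: series_le_cvg trunc_moment.
    + by move=> n; apply: Rintegral_ge0 => w _; exact: sqr_ge0.
    + by move=> n; apply: Rintegral_ge0 => w _; rewrite le_min ler01 sqr_ge0.
    + move=> n.
      have bff : bmeasurable (fun w => (beta n * f n (Y n w)) ^+ 2).
        have bbf := bmeasurableM (bmeasurable_cst (beta n)) (bfY n).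
        exact: (bmeasurableM bbf bbf).
      apply: (@le_trans _ _ (Ex (fun w => (beta n * f n (Y n w)) ^+ 2))); last first.
        by apply: le_Rintegral_bmeasurable => //; exact: trunc_bmeasurable.
      have -> : (fun w => (beta n * (f n (Y n w) - m n)) ^+ 2) =
         (fun w => (beta n * f n (Y n w)) ^+ 2 -
            ((2 * beta n ^+ 2 * m n) * (f n (Y n w) - m n) + (beta n * m n) ^+ 2)).
        by apply/funext => w; ring.
      have b1 : bmeasurable (fun w => (2 * beta n ^+ 2 * m n) * (f n (Y n w) - m n)).
        by apply: bmeasurableM => //; exact: bmeasurable_cst.
      have b2 : bmeasurable (fun w : T => (beta n * m n) ^+ 2) by exact: bmeasurable_cst.
      have b12 := bmeasurableD b1 b2.
      rewrite (RintegralB measurableT (bmeasurable_integrable P bff) (bmeasurable_integrable P b12)).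
      rewrite (RintegralD measurableT (bmeasurable_integrable P b1) (bmeasurable_integrable P b2)).
      rewrite (RintegralZl _ measurableT (bmeasurable_integrable P (bfm n))) Efm mulr0 add0r.
      by rewrite Rintegral_prob_cst lerBlDr lerDl sqr_ge0.
apply: filterS H => w.
rewrite (_ : (fun n => 1 * _) = (fun n => beta n * (f n (Y n w) - m n)))//.
by apply/funext => n; rewrite mul1r.
Qed.

Lemma is_cvgn_sum (V : normedModType R) m (F : nat -> nat -> V) :
  (forall i, cvgn (F i)) -> cvgn (fun N => \sum_(i < m) F i N).
Proof.
move=> FC; elim: m => [|m IH].
  by rewrite (_ : (fun N => _) = cst 0); [exact: is_cvg_cst|apply/funext => N; rewrite big_ord0].
rewrite (_ : (fun N => _) = (fun N => \sum_(i < m) F i N + F m N)).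
  exact: is_cvgD.
by apply/funext => N; rewrite big_ord_recr.
Qed.

(** For each of the countably many meshes [1 / (j + 1)] the scalar series converge almost surely; on
    the common event [averaging_approx_cvg0] applies with [c] the centered projection times [a].
    Since [u] is quantified inside, the null set does not depend on it. *)
Lemma noise_cvg0 (a : nat -> T -> R) K gam k :
  (forall n, @measurable_fun _ _ (past Y n) R setT (a n)) ->
  (forall n w, `|a n w| <= K) ->
  0 < k -> (forall n, gam n = k * beta n) ->
  (\forall n \near \oo, 0 <= gam n <= 1) ->
  series gam n @[n --> \oo] --> +oo ->
  (forall eps, 0 < eps -> exists v : seq B, forall n,
    (\int[P]_w (`|Y n w| * \1_(cell v eps (size v)) (Y n w))%:E <= eps%:E)%E /\
    `|\sum_(i < size v) fine (P (Y n @^-1` cell v eps i)) *: nth 0 v i| <= 2 * eps) ->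
  {ae P, forall w (u : nat -> B),
    (forall n, u n.+1 = (1 - gam n) *: u n + gam n *: (a n w *: Y n w)) ->
    u n @[n --> \oo] --> (0 : B)}.
Proof.
move=> ma aK k0 gamE g01 gdiv HCD.
have K0 : 0 <= K by exact: le_trans (aK 0%N point).
pose eps (j : nat) : R := j.+1%:R^-1.
have eps0 j : 0 < eps j by rewrite invr_gt0.
have /choice[v vP] := fun j => HCD (eps j) (eps0 j).
have /choice[g gP] := fun j => residual_noise_cvg (eps0 j) (fun n => (vP j n).1).
have Hcell : {ae P, forall w (j i : nat), cvgn (series (fun n => a n w * (beta n *
     (\1_(cell (v j) (eps j) i) (Y n w) - fine (P (Y n @^-1` cell (v j) (eps j) i))))))}.
  by apply/ae_foralln => j; apply/ae_foralln => i; exact: cell_noise_cvg.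
have Hres : {ae P, forall w (j : nat), cvgn (series (fun n => beta n * g j n (Y n w)))}.
  by apply/ae_foralln => j; exact: (gP j).1.
apply: filterS3 Hcell Hres ae_small_increments => w Hcell Hres Hsmall u urec.
apply: (averaging_approx_cvg0 g01 gdiv urec) => e e0.
(* The mesh contributes [4 * eps j]: one for the distance to the center, one for the mean of the
   residual, two for the mean of the projection. The added [1] keeps the denominator positive when
   [K = 0]. *)
have [j _ je] := near_infty_natSinv_lt (PosNum (divr_gt0 e0 (ltr_wpDl (mulr_ge0 (ler0n R 4) K0) ltr01))).
have {je} jE : K * (4 * eps j) <= e.
  have /ltW := je _ (leqnn j); rewrite /= ler_pdivlMr ?ltr_wpDl ?mulr_ge0// => H.
  apply: le_trans H; rewrite mulrDr mulr1 -/(eps j).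
  by have := ltW (eps0 j); lra.
pose p i n := fine (P (Y n @^-1` cell (v j) (eps j) i)).
pose I i n := \1_(cell (v j) (eps j) i) (Y n w) : R.
exists (fun n => \sum_(i < size (v j)) (a n w * (I i n - p i n)) *: nth 0 (v j) i).
exists (fun n => K * g j n (Y n w)); split.
- rewrite (_ : series _ = (fun N => \sum_(i < size (v j))
     (k * series (fun n => a n w * (beta n * (I i n - p i n))) N) *: nth 0 (v j) i)).
    apply: (@is_cvgn_sum B (size (v j)) (fun i N =>
      (k * series (fun n => a n w * (beta n * (I i n - p i n))) N) *: nth 0 (v j) i)) => i.
    apply: is_cvgZ; last exact: is_cvg_cst.
    exact: (is_cvgM (is_cvg_cst k) (Hcell j i)).
  apply/funext => N; rewrite /series /=.
  under eq_bigr do rewrite scaler_sumr.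
  rewrite exchange_big /=; apply: eq_bigr => i _.
  rewrite mulr_sumr scaler_suml; apply: eq_bigr => n _.
  by rewrite scalerA gamE; congr (_ *: _); ring.
- rewrite (_ : (fun n => gam n * _) = (fun n => (k * K) * (beta n * g j n (Y n w)))).
    exact: (is_cvg_seriesZ (k := k * K) (Hres j)).
  by apply/funext => n; rewrite gamE; ring.
- apply: filterS Hsmall => n bn.
  have -> : \sum_(i < size (v j)) (a n w * (I i n - p i n)) *: nth 0 (v j) i =
    a n w *: (\sum_(i < size (v j)) I i n *: nth 0 (v j) i -
              \sum_(i < size (v j)) p i n *: nth 0 (v j) i).
    rewrite -sumrB scaler_sumr; apply: eq_bigr => i _.
    by rewrite -scalerBl scalerA.
  rewrite cell_sum -scalerBr normrZ opprB addrA.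
  set s := nth 0 _ _; set m := \sum_(i < _) _.
  have H1 : `|Y n w + m - s| <= 4 * eps j + g j n (Y n w).
    rewrite addrAC; apply: le_trans (ler_normD _ _) _.
    have := cell_dist (v j) (Y n w) (eps0 j).
    have := (gP j).2 n (Y n w) bn; have := (vP j n).2.
    by rewrite -/s -/m; lra.
  apply: le_trans (ler_wpM2l (normr_ge0 _) H1) _.
  have H2 : 0 <= 4 * eps j + g j n (Y n w) by exact: le_trans H1.
  apply: le_trans (ler_wpM2r H2 (aK n w)) _.
  by rewrite mulrDr lerD2r.
Qed.

End noise.

(** * Convergence of the stochastic approximation *)

Section networked_algebra.
Context {d : measure_display} {T : measurableType d} {R : realType}.
Context {B : completeNormedModType R}.

Lemma networkedD (f g : T -> B) :
  networked f -> networked g -> networked (fun w => f w + g w).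
Proof.
move=> Nf Ng.
have H : continuous (fun z : B * B => z.1 + z.2) by exact: add_continuous.
have := networked_comp H (networked_pair Nf Ng).
exact.
Qed.

Lemma networkedZ (s : T -> R) (f : T -> B) :
  networked s -> networked f -> networked (fun w => s w *: f w).
Proof.
move=> Ns Nf.
exact: (networked_comp (@scale_continuous R B) (networked_pair Ns Nf)).
Qed.

Lemma measurable_fun_bigmax (I : Type) (r : seq I) (f : I -> T -> R) :
  (forall i, measurable_fun setT (f i)) ->
  measurable_fun setT (fun w => \big[Num.max/0]_(i <- r) f i w).
Proof.
move=> mf; elim: r => [|i r IH].
  by under eq_fun do rewrite big_nil; exact: measurable_cst.
by under eq_fun do rewrite big_cons; exact: measurable_maxr.
Qed.

Lemma measurable_fun_invr (f : T -> R) : (forall w, 0 < f w) ->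
  measurable_fun setT f -> measurable_fun setT (fun w => (f w)^-1).
Proof.
move=> f0 mf; apply: (measurability _ (measurable_realfun.RGenOInfty.measurableE R)).
move=> _ [_ [a ->] <-]; rewrite (_ : _ @^-1` _ = (fun w => a * f w) @^-1` `]-oo, 1[).
  by apply: measurable_funM => //; exact: measurable_cst.
by apply/seteqP; split=> w /=; rewrite !in_itv/= andbT -[_^-1]mul1r ltr_pdivlMr.
Qed.

End networked_algebra.

Section borel_image.
Context {d : measure_display} {T : measurableType d} {R : realType}.
Context (P : probability T R) {B : completeNormedModType R}.

(** The version is [g \o f] on the event [O] that the sequence [c] approaches [g (f w)], and [0]
    elsewhere. [O] is built from preimages under [f], so it lies in the sigma-algebra generated by
    [H] and the version stays adapted. *)
Lemma borel_image_version (H : set (set T)) (f : T -> B) (g : B -> B) :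
  (forall E : set T, H.-sigma.-measurable E -> measurable E) ->
  @networked _ (g_sigma_algebraType H) B f -> borel_fun g ->
  exists f' : T -> B, @networked _ (g_sigma_algebraType H) B f' /\
    {ae P, forall w, f' w = g (f w)}.
Proof.
move=> HT Nf bg.
have NfT : networked f.
  by have [N [mN NN]] := Nf; exists N; split=> [i|]; [apply: HT; exact: mN|exact: NN].
have [c cP] := borel_image_ae_dense_seq P NfT bg.
pose TH := g_sigma_algebraType H.
have bball (x : B) (r : R) : borel_set [set y | `|y - x| < r].
  have := cell_borel [:: x] r 0; rewrite /cell /= (_ : mkset _ = [set y | `|y - x| < r])//.
  by apply/seteqP; split=> y /=; case: ifP.
have mball x r : H.-sigma.-measurable (f @^-1` (g @^-1` [set y | `|y - x| < r])).
  by apply: (@networked_borel _ TH _ f _ Nf); exact: bg.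
pose O := \bigcap_k \bigcup_i (f @^-1` (g @^-1` [set y | `|y - c i| < k.+1%:R^-1])).
have mO : H.-sigma.-measurable O.
  by apply: bigcapT_measurable => k; exact: bigcupT_measurable.
exists (fun w => if `[< O w >] then g (f w) else 0); split; last first.
  apply: filterS cP => w Hw; rewrite asboolT// => k _.
  by have [|i ci] := Hw k.+1%:R^-1; [rewrite invr_gt0|exists i].
(* The center [0] is put in front for the value taken off [O]. *)
apply: (@networked_countable_range _ TH R B _ (fun i => if i is j.+1 then c j else 0)).
  move=> w e e0; case: asboolP => [Ow|nO]; last by exists 0%N; rewrite subrr normr0.
  have [n _ ne] := near_infty_natSinv_lt (PosNum e0).
  have [i _ ci] := Ow n I; exists i.+1.
  exact: lt_trans ci (ne _ (leqnn n)).
move=> x r.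
rewrite (_ : _ @^-1` _ = (O `&` (f @^-1` (g @^-1` [set y | `|y - x| < r]))) `|`
   (~` O `&` [set w | `|0 - x| < r])).
  apply: (@measurableU _ TH); first exact: (@measurableI _ TH).
  apply: (@measurableI _ TH); first exact: (@measurableC _ TH).
  have [xr|xr] := boolP (`|0 - x| < r).
    by rewrite (_ : mkset _ = setT) ?predeqE//; exact: (@measurableT _ TH).
  rewrite (_ : mkset _ = set0); first exact: (@measurable0 _ TH).
  by rewrite -subset0 => w /=.
apply/seteqP; split=> w /=; first by case: asboolP => Ow; [left|right].
by case: asboolP => Ow [] [].
Qed.

End borel_image.

(** * Adapted versions of the iterates *)

Section adapted.
Context {d : measure_display} {T : measurableType d} {R : realType}.
Context (P : probability T R) {B : completeNormedModType R} (Y X : nat -> T -> B).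
Context (G : B -> B) (beta : nat -> R) (x0 : B).
Context (lambda : forall n : nat, {ptws 'I_n.+1 -> B} -> R).
Hypothesis sY : forall n, strongly_measurable (Y n).
Hypothesis G_borel : borel_fun G.
Hypothesis lambda_borel : forall n, borel_fun (@lambda n).
Hypothesis X_init : forall w, X 0%N w = x0.
Hypothesis X_rec : forall n w, X n.+1 w = X n w - beta n *: (G (X n w) +
  lambda (fun k : 'I_n.+1 => X k w) *: Y n w).

Let mY n A : borel_set A -> measurable (Y n @^-1` A).
Proof. by apply: measurable_preimage_borel => V; exact: strongly_measurable_open. Qed.

Lemma past_le_trans m n (E : set T) : (m <= n)%N ->
  @measurable _ (past Y m) E -> @measurable _ (past Y n) E.
Proof.
move=> mn; rewrite -(subnKC mn); elim: (n - m)%N => [|k IH]; first by rewrite addn0.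
by rewrite addnS => /IH; exact: past_le.
Qed.

Lemma networked_past m n (Z : topologicalType) (f : T -> Z) : (m <= n)%N ->
  @networked _ (past Y m) Z f -> @networked _ (past Y n) Z f.
Proof.
move=> mn [N [mN Nf]]; exists N; split=> [i|]; last exact: Nf.
exact: past_le_trans mn (mN i).
Qed.

Lemma networked_present n : @networked _ (past Y n.+1) B (Y n).
Proof.
have [c cP] := strongly_measurable_countable_range (sY n).
apply: (@networked_countable_range _ (past Y n.+1) R B _ c) => // v r.
apply: past_present.
have := cell_borel [:: v] r 0; rewrite /cell /= (_ : mkset _ = [set y | `|y - v| < r])//.
by apply/seteqP; split=> y /=; case: ifP.
Qed.

(** Strong induction, since [lambda] sees the whole trajectory. Because of [G], strong measurability
    is obtained for a version of [X n] only, over the sigma-algebra of [Y 0, ..., Y n.-1]. *)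
Lemma adapted_version n : exists f : T -> B,
  @networked _ (past Y n) B f /\ {ae P, forall w, f w = X n w}.
Proof.
elim/ltn_ind: n => -[_|n IH].
  exists (fun=> x0); split; first exact: networked_cst.
  by apply/aeW => w; rewrite X_init.
have /choice[f fP] : forall k : nat, exists f : T -> B, (k <= n)%N ->
    @networked _ (past Y k) B f /\ {ae P, forall w, f w = X k w}.
  move=> k; have [kn|nk] := leqP k n; last by exists (X k).
  by have [f fP] := IH k kn; exists f.
have fX : {ae P, forall w k, (k <= n)%N -> f k w = X k w}.
  apply/ae_foralln => k; have [kn|nk] := leqP k n; last by apply/aeW.
  by apply: filterS (fP k kn).2.
have Nf (k : 'I_n.+1) : @networked _ (past Y n) B (f k).
  have kn : (k <= n)%N by rewrite -ltnS.
  exact: networked_past (fP k kn).1.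
have [Gf [NGf GfE]] := @borel_image_version _ _ _ P B _ _ G
   (@past_measurable _ _ _ _ _ mY n) (Nf ord_max) G_borel.
have ml : @measurable_fun _ _ (past Y n) R setT
    (fun w => lambda (fun k : 'I_n.+1 => f k w)).
  exact: (borel_fun_measurable (networked_ptws Nf) (@lambda_borel n)).
have Nn (Z : topologicalType) (h : T -> Z) :
    @networked _ (past Y n) Z h -> @networked _ (past Y n.+1) Z h.
  exact: networked_past.
exists (fun w => f n w + (- beta n) *:
  (Gf w + lambda (fun k : 'I_n.+1 => f k w) *: Y n w)).
split.
  apply: (@networkedD _ (past Y n.+1)); first exact: Nn (Nf ord_max).
  apply: (@networkedZ _ (past Y n.+1)); first exact: networked_cst.
  apply: (@networkedD _ (past Y n.+1)); first exact: Nn.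
  apply: (@networkedZ _ (past Y n.+1)); last exact: networked_present.
  by apply: Nn; exact: measurable_networked.
apply: filterS2 GfE fX => w -> fX; rewrite X_rec scaleNr fX//.
rewrite (_ : (fun k : 'I_n.+1 => f k w) = (fun k : 'I_n.+1 => X k w))//.
by apply/funext => k; apply: fX; rewrite -ltnS.
Qed.

(* The ratio of [lambda] to the running maximum is bounded and predictable
   although [lambda] itself is unbounded. *)
Lemma adapted_ratio (C tau : R) :
  (forall (n : nat) (u : {ptws 'I_n.+1 -> B}),
    `|lambda u| <= C * (1 + \big[Num.max/0]_(k < n.+1) `|u k|)) ->
  exists a : nat -> T -> R,
  [/\ forall n, @measurable_fun _ _ (past Y n) R setT (a n),
      forall n w, `|a n w| <= `|tau| * C &
      {ae P, forall w n, a n w = - tau * lambda (fun k : 'I_n.+1 => X k w) /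
         (1 + \big[Num.max/0]_(k < n.+1) `|X k w|)}].
Proof.
move=> lambda_bound.
have /choice[f fP] := adapted_version.
pose M n w := 1 + \big[Num.max/0]_(k < n.+1) `|f k w|.
have M1 n w : 0 < M n w.
  rewrite ltr_wpDr//; elim/big_ind : _ => // x y xp yp.
  by rewrite le_max xp.
have Nf n (k : 'I_n.+1) : @networked _ (past Y n) B (f k).
  by apply: networked_past (fP k).1; rewrite -ltnS.
exists (fun n w => - tau * lambda (fun k : 'I_n.+1 => f k w) / M n w); split.
- move=> n.
  have ml : @measurable_fun _ _ (past Y n) R setT
      (fun w => lambda (fun k : 'I_n.+1 => f k w)).
    exact: (borel_fun_measurable (networked_ptws (Nf n)) (@lambda_borel n)).
  have mM : @measurable_fun _ _ (past Y n) R setT (M n).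
    apply: measurable_funD; first exact: measurable_cst.
    apply: (@measurable_fun_bigmax _ (past Y n)) => k.
    apply: networked_measurable_fun.
    by apply: (networked_comp (@norm_continuous _ B)); exact: Nf.
  apply: measurable_funM; first by apply: measurable_funM; [exact: measurable_cst|exact: ml].
  exact: (@measurable_fun_invr _ (past Y n)).
- move=> n w; rewrite normrM normfV (gtr0_norm (M1 n w)) ler_pdivrMr// normrM normrN.
  by rewrite -mulrA ler_wpM2l.
- have H : {ae P, forall w k, f k w = X k w} by apply/ae_foralln => k; exact: (fP k).2.
  apply: filterS H => w fX n; rewrite /M.
  rewrite (_ : (fun k : 'I_n.+1 => f k w) = (fun k : 'I_n.+1 => X k w))//; last first.
    by apply/funext => k.
  by under eq_bigr do rewrite fX.
Qed.

End adapted.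

Section approximation.
Context {d : measure_display} {T : measurableType d} {R : realType}.
Context (P : probability T R) {B : completeNormedModType R} (Y X : nat -> T -> B).
Context (G : B -> B) (beta : nat -> R) (x0 : B) (tau rho C : R) (xstar : B).
Context (lambda : forall n : nat, {ptws 'I_n.+1 -> B} -> R).
Hypothesis sY : forall n, strongly_measurable (Y n).
Hypothesis indY : mutually_independent P Y.
Hypothesis G_borel : borel_fun G.
Hypothesis tau_gt0 : 0 < tau.
Hypothesis rho_lt1 : rho < 1.
Hypothesis G_contr : forall x : B, `|x - xstar - tau *: G x| <= rho * `|x - xstar|.
Hypothesis beta_gt0 : forall n, 0 < beta n.
Hypothesis beta_cvg0 : beta n @[n --> \oo] --> 0.
Hypothesis beta_sum : (\sum_(0 <= n <oo) (beta n)%:E)%E = +oo%E.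
Hypothesis lambda_borel : forall n, borel_fun (@lambda n).
Hypothesis lambda_bound : forall (n : nat) (u : {ptws 'I_n.+1 -> B}),
    `|lambda u| <= C * (1 + \big[Num.max/0]_(k < n.+1) `|u k|).
Hypothesis X_init : forall w, X 0%N w = x0.
Hypothesis X_rec : forall n w, X n.+1 w = X n w - beta n *: (G (X n w) +
  lambda (fun k : 'I_n.+1 => X k w) *: Y n w).
Hypothesis beta_sq : cvgn (series (fun n => beta n ^+ 2)).
Hypothesis trunc_moment : cvgn (series (fun n =>
  \int[P]_w Num.min 1 ((beta n * `|Y n w|) ^+ 2))).
Hypothesis discretized : forall eps, 0 < eps -> exists v : seq B, forall n,
    (\int[P]_w (`|Y n w| * \1_(cell v eps (size v)) (Y n w))%:E <= eps%:E)%E /\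
    `|\sum_(i < size v) fine (P (Y n @^-1` cell v eps i)) *: nth 0 v i| <= 2 * eps.

(** On the almost sure event where [a] is the true ratio and the averaged noise vanishes, what
    remains is the deterministic perturbed contraction, path by path. *)
Theorem stochastic_approximation_cvg :
  {ae P, forall w, X n w @[n --> \oo] --> xstar}.
Proof.
pose gam n := tau^-1 * beta n.
have ti0 : 0 < tau^-1 by rewrite invr_gt0.
have gam0 n : 0 <= gam n by rewrite mulr_ge0// ltW.
(* For [tau < 1] the first steps may have [gam n > 1]; [beta n <= tau] holds eventually. *)
have g01 : \forall n \near \oo, 0 <= gam n <= 1.
  move/cvgr0Pnorm_le : beta_cvg0 => /(_ _ tau_gt0); apply: filterS => n.
  rewrite (gtr0_norm (beta_gt0 n)) => bt; rewrite gam0 /=.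
  by rewrite /gam mulrC ler_pdivrMr// mul1r.
have gdiv : series gam n @[n --> \oo] --> +oo.
  apply: nondecreasing_dvgn_lt.
    by apply/nondecreasing_seqP => n; rewrite /series /= big_nat_recr//= lerDl.
  move=> gC; have : (\sum_(0 <= n <oo) (beta n)%:E < +oo)%E.
    apply: cvgn_series_ereal; first by move=> n; exact: ltW.
    rewrite (_ : beta = (fun n => tau * gam n)).
      exact: (is_cvg_seriesZ (k := tau) gC).
    by apply/funext => n; rewrite /gam mulVKf// gt_eqF.
  by rewrite beta_sum.
have [a [ma aC aE]] := adapted_ratio P sY G_borel lambda_borel X_init X_rec tau lambda_bound.
have Hu := noise_cvg0 sY indY beta_gt0 beta_sq trunc_moment ma aC ti0
  (fun n => erefl) g01 gdiv discretized.
apply: filterS2 aE Hu => w aE Hu.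
apply/subr_cvg0.
pose u := fix u n : B := if n is m.+1 then
  (1 - gam m) *: u m + gam m *: (a m w *: Y m w) else 0.
pose M n := 1 + \big[Num.max/0]_(k < n.+1) `|X k w|.
have M1 n : 0 < M n.
  rewrite ltr_wpDr//; elim/big_ind : _ => // x y xp yp.
  by rewrite le_max xp.
(* [rho] may be negative while the contraction lemma wants a factor in [[0, 1[]. The constant
   [1 + |xstar|] comes from [M n = 1 + max |X k|] and [|X k| <= |xstar| + |X k - xstar|]. *)
apply: (@perturbed_contraction_cvg0 _ _ gam (Num.max rho 0) (1 + `|xstar|)
  (fun n => X n w - xstar) (fun n => X n w - xstar - tau *: G (X n w))
  (fun n => a n w *: Y n w) u M) => //.
- by rewrite le_max lexx orbT gt_max rho_lt1 ltr01.
- move=> n; rewrite X_rec aE -/(M n).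
  rewrite !scalerA [gam n * M n * _](_ : _ = - (beta n * lambda (fun k : 'I_n.+1 => X k w))).
    set g := G _; set l := lambda _; set x := X n w - xstar.
    have -> : beta n *: (g + l *: Y n w) = beta n *: g + (beta n * l) *: Y n w.
      by rewrite scalerDr scalerA.
    have -> : gam n *: (x - tau *: g) = gam n *: x - beta n *: g.
      by rewrite scalerBr scalerA /gam mulrAC mulVf ?mul1r// gt_eqF.
    rewrite scaleNr scalerBl scale1r addrA subrK opprD !addrA /x.
    by rewrite [LHS]addrAC; congr (_ - _); rewrite addrAC.
  rewrite /gam; field.
  by rewrite !gt_eqF.
- move=> n; apply: le_trans (G_contr _) _.
  by rewrite ler_wpM2r// le_max lexx.
- exact: ltW.
- move=> n; rewrite /M lerD2l; apply: bigmax_le => [|k _].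
    by elim/big_ind : _ => // y z y0 z0; rewrite le_max y0.
  exact: (le_bigmax 0 (fun k : 'I_n.+2 => `|X k w|) (widen_ord (leqnSn _) k)).
- move=> n L xL; rewrite /M -addrA lerD2l; apply: bigmax_le.
    by rewrite addr_ge0//; apply: le_trans (xL 0%N _).
  move=> k _; rewrite -[X k w](subrK xstar) addrC; apply: le_trans (ler_normD _ _) _.
  by rewrite lerD2r; apply: xL; rewrite -ltnS.
- exact: Hu.
Qed.

End approximation.

(** * Verification of the three noise conditions *)

Section power_sums.
Context {R : realType}.
Implicit Types (x y p q : R).

(** Write [x ^ (- q)] as [(x + 1) ^ (- q)] times [exp (q ln ((x + 1) / x))], then use
    [exp t >= 1 + t] and [ln ((x + 1) / x) >= 1 / (x + 1)]. *)
Lemma powR_telescope x q : 0 < x -> 0 < q ->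
  q * (x + 1) `^ (- (q + 1)) <= x `^ (- q) - (x + 1) `^ (- q).
Proof.
move=> x0 q0; have x10 : 0 < x + 1 by rewrite ltr_wpDr// ltW.
have E : x `^ (- q) = (x + 1) `^ (- q) * expR (q * ln ((x + 1) / x)).
  rewrite /powR !gt_eqF// -expRD ln_div ?posrE//; congr expR; ring.
have -> : (x + 1) `^ (- (q + 1)) = (x + 1) `^ (- q) * (x + 1)^-1.
  have iE : (x + 1)^-1 = expR (- ln (x + 1)) by rewrite expRN lnK.
  by rewrite iE /powR !gt_eqF// -expRD; congr expR; ring.
rewrite E.
rewrite -[X in _ - X]mulr1 -mulrBr mulrCA ler_wpM2l ?powR_ge0// lerBrDl.
apply: le_trans (expR_ge1Dx _); rewrite lerD2l ler_wpM2l ?(ltW q0)//.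
have := expR_ge1Dx (- ln ((x + 1) / x)).
rewrite expRN lnK ?posrE ?divr_gt0// invf_div.
have -> : x / (x + 1) = 1 - (x + 1)^-1 by field; rewrite gt_eqF.
by lra.
Qed.

(* Compare [n^-p] with the increments of [n |-> (n + y)^(1 - p)]. *)
Lemma sum_min_powR p y N : 1 < p -> 0 <= y ->
  \sum_(1 <= n < N) Num.min 1 ((y / n%:R) `^ p) <= 2 `^ p / (p - 1) * y.
Proof.
move=> p1; rewrite le_eqVlt => /predU1P[<-|y0].
  rewrite mulr0 big1// => n _; rewrite mul0r powR0 ?gt_eqF//; last by lra.
  by rewrite min_r.
set q := p - 1; have q0 : 0 < q by rewrite subr_gt0.
have step (n : nat) : (0 < n)%N -> Num.min 1 ((y / n%:R) `^ p) <=
    (2 * y) `^ p / q * ((n.-1%:R + y) `^ (- q) - (n%:R + y) `^ (- q)).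
  case: n => // n _ /=.
  have n0 : 0 < n.+1%:R :> R by rewrite ltr0n.
  have ny : 0 < n.+1%:R + y by rewrite addr_gt0.
  (* With [m = n.+1], the ratio [2 y / (m + y)] is at least [y / m] if [y <= m] and at least [1]
     otherwise, and its power can be telescoped. *)
  apply: (@le_trans _ _ ((2 * y / (n.+1%:R + y)) `^ p)).
    have p0 : 0 <= p by lra.
    have c0 : 0 <= 2 * y / (n.+1%:R + y) by rewrite divr_ge0 ?mulr_ge0 ?ltW.
    rewrite ge_min; have [yn|ny'] := leP y n.+1%:R.
      apply/orP; right; apply: ge0_ler_powR => //; first by rewrite nnegrE divr_ge0 ?ltW.
      rewrite ler_pdivlMr// mulrAC ler_pdivrMr//.
      by have := ltW y0; nra.
    apply/orP; left; have one : 1 `^ p = 1 :> R by rewrite powR1.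
    rewrite -[X in X <= _]one.
    apply: ge0_ler_powR => //; first by rewrite nnegrE.
    by rewrite ler_pdivlMr//; lra.
  have ny' := ltW ny; have y2 : 0 <= 2 * y by rewrite mulr_ge0// ltW.
  rewrite powRM ?invr_ge0// -powR_inv1// -powRrM mulN1r.
  rewrite -mulrA ler_wpM2l ?powR_ge0// ler_pdivlMl//.
  have := @powR_telescope (n%:R + y) q _ q0.
  rewrite (_ : n%:R + y + 1 = n.+1%:R + y); last by rewrite -natr1; ring.
  by rewrite (_ : q + 1 = p) ?subrK//; apply; rewrite ltr_wpDl.
pose F n := - ((2 * y) `^ p / q * (n%:R + y) `^ (- q)).
apply: (@le_trans _ _ (\sum_(1 <= n < N) (F n - F n.-1))).
  rewrite !big_nat; apply: ler_sum => n /andP[n1 _].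
  by apply: le_trans (step n n1) _; rewrite /F mulrBr; lra.
have F0 n : F n <= 0.
  by rewrite /F oppr_le0 mulr_ge0 ?divr_ge0 ?powR_ge0// ltW.
have -> : \sum_(1 <= n < N) (F n - F n.-1) = F N.-1 - F 0%N.
  case: N => [|N]; first by rewrite big_geq// subrr.
  by rewrite big_add1 /= telescope_sumr.
apply: (@le_trans _ _ (- F 0%N)); first by have := F0 N.-1; lra.
have y0' := ltW y0.
have yE : y `^ p * y `^ (- q) = y.
  rewrite -powRD ?(gt_eqF y0) ?implybT// (_ : p - q = 1) ?powRr1//.
  by rewrite /q; ring.
rewrite /F opprK add0r powRM// -[X in _ <= _ * X]yE.
by rewrite le_eqVlt; apply/orP; left; apply/eqP; rewrite -/q; ring.
Qed.

Lemma min_sq_powR t p : 0 <= t -> 0 < p <= 2 -> Num.min 1 (t ^+ 2) <= t `^ p.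
Proof.
move=> t0 /andP[p0 p2]; rewrite ge_min; have [t1|t1] := leP t 1.
  apply/orP; right; rewrite -powR_mulrn//; move: t0; rewrite le_eqVlt => /predU1P[<-|t0].
    by rewrite !powR0 ?gt_eqF// ltr0n.
  by apply: ger_powR => //; rewrite t0.
by apply/orP; left; rewrite -[leLHS](powRr0 t); apply: ler_powR; rewrite ?ltW.
Qed.

End power_sums.

Section identical_distribution.
Context {d : measure_display} {T : measurableType d} {R : realType}.
Context (P : probability T R) {B : completeNormedModType R} (Y : nat -> T -> B).
Hypothesis sY : forall n, strongly_measurable (Y n).
Hypothesis idY : identically_distributed P Y.

Lemma identically_distributed_integral (phi : B -> R) n :
  borel_fun phi -> (forall x, 0 <= phi x) ->
  (\int[P]_w (phi (Y n w))%:E = \int[P]_w (phi (Y 0%N w))%:E)%E.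
Proof.
move=> bphi phi0.
have mphi k : measurable_fun setT (phi \o Y k).
  apply: measurable_fun_open => V oV; rewrite comp_preimage.
  apply: measurable_preimage_borel => [S oS|]; first exact: strongly_measurable_open.
  by apply: bphi; exact: sub_sigma_algebra.
pose X k : {mfun T >-> R} := mfun_Sub (mem_set (mphi k)).
have mn : measurable_fun setT (fun r : R => (`|r| : R)%:E).
  by apply/measurable_EFinP; exact: normr_measurable.
have E k : (\int[P]_w (phi (Y k w))%:E = \int[distribution P (X k)]_r (`|r| : R)%:E)%E.
  rewrite ge0_integral_distribution//.
  by apply: eq_integral => w _ /=; rewrite ger0_norm.
rewrite !E; apply: eq_measure_integral => A mA _.
have := idY n 0%N (bphi _ (measurable_borel mA)); exact.
Qed.

End identical_distribution.

From mathcomp Require Import finmap.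

(** * Bochner integrals and finite projections *)

Section simple_integrals.
Context {d : measure_display} {T : measurableType d} {R : realType}.
Context (P : probability T R) {B : completeNormedModType R}.

Lemma preimage_seq_prob (K : eqType) (h : T -> K) (r : seq K) :
  uniq r -> (forall k, measurable (h @^-1` [set k])) ->
  fine (P (h @^-1` [set` r])) = \sum_(k <- r) fine (P (h @^-1` [set k])).
Proof.
move=> + mh.
have consE k (l : seq K) : [set` k :: l] = [set k] `|` [set` l].
  by apply/seteqP; split=> x /=; rewrite inE => /predU1P.
elim: r => [_|k r IH /= /andP[kr ur]].
  by rewrite big_nil set_nil preimage_set0 measure0.
have mr : measurable (h @^-1` [set` r]).
  elim: (r) => [|j l IHl]; first by rewrite set_nil preimage_set0.
  by rewrite consE preimage_setU; exact: measurableU.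
rewrite big_cons -IH// consE preimage_setU measureU//.
  by rewrite fineD// fin_num_measure.
by rewrite -subset0 => w [/= -> hr]; rewrite hr in kr.
Qed.

(** A center may occur twice in a list, and two simple maps have different level sets; summing over
    the values of a finer [h] handles both. *)
Lemma simple_integral_comp (K : choiceType) (h : T -> K) (r : seq K) (phi : K -> B) :
  uniq r -> (forall w, h w \in r) -> (forall k, measurable (h @^-1` [set k])) ->
  simple_integral P (phi \o h) = \sum_(k <- r) fine (P (h @^-1` [set k])) *: phi k.
Proof.
move=> ur hr mh.
have fr : finite_set (range (phi \o h)).
  apply: (sub_finite_set _ (finite_seq [seq phi k | k <- r])).
  by move=> _ [w _ <-] /=; apply: map_f.
rewrite /simple_integral fsbig_finite//=.
have PE v : fine (P ((phi \o h) @^-1` [set v])) =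
    \sum_(k <- r | phi k == v) fine (P (h @^-1` [set k])).
  rewrite -big_filter -preimage_seq_prob ?filter_uniq//; congr (fine (P _)).
  by apply/seteqP; split=> w /=; rewrite mem_filter hr andbT => /eqP.
under eq_bigr do rewrite PE scaler_suml.
rewrite (exchange_big_dep xpredT)//=; apply: eq_big_seq => k kr.
have [[w hw]|nk] := pselect (exists w, h w = k).
  have kV : phi k \in fset_set (range (phi \o h)).
    by rewrite in_fset_set//; apply/mem_set; exists w; rewrite //= hw.
  rewrite big_mkcond (bigD1_seq (phi k) kV (finmap.fset_uniq _))/= eqxx.
  by rewrite big1_seq ?addr0// => v /andP[/negbTE]; rewrite eq_sym => ->.
rewrite (_ : h @^-1` [set k] = set0) ?measure0 ?scale0r ?big1//.
  by move=> v _; rewrite scale0r.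
by rewrite -subset0 => w /= hw; apply: nk; exists w.
Qed.

Lemma simple_map_networked (s : T -> B) : simple_map s -> networked s.
Proof.
move=> ss; have [fs ms] := ss; have /finite_seqP[r rE] := fs.
apply: (@networked_countable_range _ _ _ _ s (nth 0 r)).
  move=> w e e0; exists (index (s w) r); rewrite nth_index ?subrr ?normr0//.
  by have : [set` r] (s w) by rewrite -rE; exists w.
by move=> v e; exact: simple_map_preimage.
Qed.

Lemma strongly_measurable_networked (f : T -> B) : strongly_measurable f -> networked f.
Proof.
move=> sf.
have [c cP] := strongly_measurable_countable_range sf.
apply: (networked_countable_range cP) => x r.
rewrite (_ : _ @^-1` _ = f @^-1` cell [:: x] r 0).
  apply: measurable_preimage_borel => [S oS|]; first exact: strongly_measurable_open.
  exact: cell_borel.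
by apply/seteqP; split=> w; rewrite /cell /=; case: ifP.
Qed.

Lemma networked_norm_dist (f g : T -> B) : networked f -> networked g ->
  measurable_fun setT (fun w => `|f w - g w|).
Proof.
move=> Nf Ng; apply: networked_measurable_fun.
apply: (networked_comp (@norm_continuous _ B)); apply: networkedD => //.
have H : continuous (fun x : B => - x) by exact: opp_continuous.
have := networked_comp H Ng; exact.
Qed.

(** The pair [(s, t)] refines both maps, so both integrals become sums over the same pieces. *)
Lemma simple_integral_dist (s t : T -> B) : simple_map s -> simple_map t ->
  (`|simple_integral P s - simple_integral P t|%:E <= \int[P]_w `|s w - t w|%:E)%E.
Proof.
move=> ss st; pose h w := (s w, t w).
have [/finite_seqP[rs rsE] ms] := ss; have [/finite_seqP[rt rtE] mt] := st.
pose r := undup [seq (x, y) | x <- rs, y <- rt].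
have hr w : h w \in r.
  rewrite mem_undup; apply: allpairs_f.
    by have : [set` rs] (s w) by rewrite -rsE; exists w.
  by have : [set` rt] (t w) by rewrite -rtE; exists w.
have mh k : measurable (h @^-1` [set k]).
  rewrite (_ : _ @^-1` _ = s @^-1` [set k.1] `&` t @^-1` [set k.2]).
    exact: measurableI.
  by apply/seteqP; split=> w; rewrite /h /=; case: k => a b /= [-> ->].
have ur : uniq r by exact: undup_uniq.
have -> := simple_integral_comp (fst : B * B -> B) ur hr mh.
have -> := simple_integral_comp (snd : B * B -> B) ur hr mh.
rewrite -sumrB; under eq_bigr do rewrite -scalerBr.
apply: (@le_trans _ _ (\sum_(k <- r) (fine (P (h @^-1` [set k])) * `|k.1 - k.2|))%:E).
  rewrite lee_fin; apply: le_trans (ler_norm_sum _ _ _) _; apply: ler_sum => k _.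
  by rewrite normrZ ger0_norm// fine_ge0.
have -> : (\int[P]_w `|s w - t w|%:E =
   \int[P]_w \sum_(k <- r) (`|k.1 - k.2| * \1_(h @^-1` [set k]) w)%:E)%E.
  apply: eq_integral => w _; rewrite sumEFin; congr EFin.
  rewrite (bigD1_seq (h w))//= big1_seq ?addr0.
    by rewrite indicE mem_set// mulr1.
  move=> k /andP[kh _]; rewrite indicE memNset ?mulr0//.
  by move=> /= hk; rewrite hk eqxx in kh.
rewrite ge0_integral_sum//; last first.
  move=> k; apply/measurable_EFinP; apply: measurable_funM; first exact: measurable_cst.
  exact: measurable_indic.
rewrite -sumEFin; apply: lee_sum => k _.
under eq_integral do rewrite EFinM.
rewrite ge0_integralZl_EFin//; last by apply/measurable_EFinP; exact: measurable_indic.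
by rewrite integral_indic// setIT EFinM fineK ?fin_num_measure// muleC.
Qed.

(** The centers are the values of an approximant [s k2], so [|f - s k2| >= eps] on the uncovered
    cell. With [M] bounding another approximant [s k1], there [|f| <= |f - s k1| + M] and
    [M <= (M / eps) |f - s k2|]. The accuracy of [s k2] depends on [M], hence two approximants. *)
Lemma bochner_residual (f : T -> B) b (eps : R) : has_bochner_integral P f b -> 0 < eps ->
  exists v : seq B,
    (\int[P]_w (`|f w| * \1_(cell v eps (size v)) (f w))%:E <= eps%:E)%E.
Proof.
move=> [sf [s [ss sL1 _]]] eps0.
have Nf := strongly_measurable_networked sf.
have small (e : R) : 0 < e -> exists k, (\int[P]_w `|f w - s k w|%:E <= e%:E)%E.
  move=> e0; have /fine_cvgP[fin /cvgr0Pnorm_lt/(_ _ e0) lim] := sL1.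
  have [k [fk lk]] := filter_ex (filterI fin lim); exists k.
  rewrite -(fineK fk) lee_fin; apply: le_trans (ltW lk); exact: ler_norm.
have mfs k : measurable_fun setT (fun w => `|f w - s k w|).
  by apply: networked_norm_dist => //; exact: simple_map_networked.
have e20 : 0 < eps / 2 by rewrite divr_gt0.
have [k1 k1P] := small _ e20.
have [M M0 sM] : exists2 M : R, 0 < M & forall w, `|s k1 w| <= M.
  have [/finite_seqP[r rE] _] := ss k1.
  have r0 (l : seq B) : 0 <= \sum_(x <- l) `|x| by rewrite sumr_ge0.
  exists (1 + \sum_(x <- r) `|x|) => [|w]; first by rewrite ltr_wpDr.
  have wr : s k1 w \in r by have : [set` r] (s k1 w) by rewrite -rE; exists w.
  by rewrite (big_rem _ wr)/= addrCA lerDl addr_ge0.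
have d0 : 0 < eps / 2 / (M / eps) by rewrite !divr_gt0.
have [k2 k2P] := small _ d0.
have [/finite_seqP[v vE] _] := ss k2.
exists v.
have Me0 : 0 < M / eps by rewrite divr_gt0.
apply: (@le_trans _ _ (\int[P]_w (`|f w - s k1 w|%:E + (M / eps)%:E * `|f w - s k2 w|%:E))%E).
  apply: ge0_le_integral => //.
  - apply/measurable_EFinP; apply: measurable_funM.
      by apply: networked_measurable_fun; apply: (networked_comp (@norm_continuous _ B)).
    rewrite (_ : (fun w => \1__ (f w)) = \1_(f @^-1` cell v eps (size v)))//.
    apply: measurable_indic; apply: measurable_preimage_borel (cell_borel _ _ _) => S oS.
    exact: strongly_measurable_open.
  - apply: emeasurable_funD; first by apply/measurable_EFinP.
    by apply: measurable_funeM; apply/measurable_EFinP.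
  - move=> w _; rewrite -EFinM -EFinD lee_fin indicE.
    have [|_] := boolP (f w \in _); last by rewrite mulr0 addr_ge0// mulr_ge0// ltW.
    move=> /set_mem; rewrite /cell /= => fw; rewrite mulr1.
    have wv : s k2 w \in v by have : [set` v] (s k2 w) by rewrite -vE; exists w.
    have epsle : eps <= `|f w - s k2 w|.
      rewrite leNgt; apply/negP => lt.
      have : has (fun c => `|f w - c| < eps) v by apply/hasP; exists (s k2 w).
      by rewrite has_find fw ltnn.
    rewrite -[in leLHS](subrK (s k1 w) (f w)); apply: le_trans (ler_normD _ _) _.
    rewrite lerD2l; apply: le_trans (sM w) _.
    by rewrite mulrAC ler_pdivlMr// ler_pM2l.
rewrite ge0_integralD//; last 3 first.
- by apply/measurable_EFinP.
- by move=> w _; rewrite mule_ge0// lee_fin// ltW.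
- by apply: measurable_funeM; apply/measurable_EFinP.
rewrite ge0_integralZl_EFin//; last 2 first.
- by apply/measurable_EFinP.
- exact: ltW.
rewrite [eps in leRHS]splitr EFinD; apply: leeD => //.
have Me0E : (0 <= (M / eps)%:E)%E by rewrite lee_fin ltW.
apply: (le_trans (lee_wpmul2l Me0E k2P)).
by rewrite -EFinM lee_fin le_eqVlt; apply/orP; left; apply/eqP; field; rewrite !gt_eqF.
Qed.

(** The projection [t] is within [2 * eps] of [f] in [L^1], and simple integration is an [L^1]
    contraction; so the integral of [t] is within [2 * eps] of the limit [0] of the integrals of
    [s k]. *)
Lemma bochner_mean_le (f : T -> B) v (eps : R) : has_bochner_integral P f 0 -> 0 < eps ->
  (\int[P]_w (`|f w| * \1_(cell v eps (size v)) (f w))%:E <= eps%:E)%E ->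
  `|\sum_(i < size v) fine (P (f @^-1` cell v eps i)) *: nth 0 v i| <= 2 * eps.
Proof.
move=> [sf [s [ss sL1 s0]]] eps0 resid.
have mf A : borel_set A -> measurable (f @^-1` A).
  by apply: measurable_preimage_borel => S oS; exact: strongly_measurable_open.
have Nf := strongly_measurable_networked sf.
pose h w := find (fun c => `|f w - c| < eps) v.
have mh k : measurable (h @^-1` [set k]) by exact: mf (cell_borel v eps k).
pose t := nth 0 v \o h.
(* The index [size v] stands for the uncovered cell; its value is the default [0], so it drops out
   of the sum. *)
have hr w : h w \in iota 0 (size v).+1 by rewrite mem_iota /= add0n ltnS find_size.
have st : simple_map t.
  split.
    apply: (sub_finite_set _ (finite_seq [seq nth 0 v k | k <- iota 0 (size v).+1])).
    by move=> _ [w _ <-]; rewrite /mkset; apply/mapP; exists (h w).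
  move=> x; rewrite (_ : t @^-1` _ = \bigcup_(k in [set k | nth 0 v k = x]) h @^-1` [set k]).
    by apply: bigcup_measurable.
  by apply/seteqP; split=> [w <-|w [k kx /= hk]]; [exists (h w)|rewrite /t /= hk].
have -> : \sum_(i < size v) fine (P (f @^-1` cell v eps i)) *: nth 0 v i =
    simple_integral P t.
  rewrite /t (simple_integral_comp (r := iota 0 (size v).+1))// ?iota_uniq//.
  rewrite -addn1 iotaD big_cat /= big_seq1 add0n nth_default// scaler0 addr0.
  have -> : iota 0 (size v) = index_iota 0 (size v) by rewrite /index_iota subn0.
  by rewrite big_mkord.
have mfs k : measurable_fun setT (fun w => `|f w - s k w|).
  by apply: networked_norm_dist => //; exact: simple_map_networked.
have mft : measurable_fun setT (fun w => `|f w - t w|).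
  by apply: networked_norm_dist => //; exact: simple_map_networked.
have ft : (\int[P]_w `|f w - t w|%:E <= (2 * eps)%:E)%E.
  have mfi : measurable_fun setT (fun w => `|f w| * \1_(cell v eps (size v)) (f w)).
    apply: measurable_funM.
      by apply: networked_measurable_fun; apply: (networked_comp (@norm_continuous _ B)).
    rewrite (_ : (fun w => \1__ (f w)) = \1_(f @^-1` cell v eps (size v)))//.
    by apply: measurable_indic; apply: mf; exact: cell_borel.
  apply: (@le_trans _ _ (\int[P]_w (eps%:E + (`|f w| * \1_(cell v eps (size v)) (f w))%:E))%E).
    apply: ge0_le_integral => //.
    - by apply/measurable_EFinP.
    - by apply: emeasurable_funD => //; apply/measurable_EFinP.
    - by move=> w _; rewrite -EFinD lee_fin; exact: cell_dist.
  rewrite ge0_integralD//; last 2 first.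
  - by move=> w _; rewrite lee_fin ltW.
  - by apply/measurable_EFinP.
  rewrite (integral_cst P measurableT eps%:E) [X in (_ * X)%E](_ : _ = 1%E) ?mule1; last exact: probability_setT.
  by rewrite mulr_natl mulr2n EFinD leeD.
apply/ler_addgt0Pr => e e0.
have e20 : 0 < e / 2 by rewrite divr_gt0.
have [k [sk Ik]] : exists k, (\int[P]_w `|f w - s k w|%:E <= (e / 2)%:E)%E /\
    `|simple_integral P (s k)| <= e / 2.
  have /fine_cvgP[fin /cvgr0Pnorm_lt/(_ _ e20) lim] := sL1.
  move/cvgr0Pnorm_le : s0 => /(_ _ e20) s0.
  have [k [[fk lk] sk]] := filter_ex (filterI (filterI fin lim) s0); exists k; split=> //.
  rewrite -(fineK fk) lee_fin; apply: le_trans (ltW lk); exact: ler_norm.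
have tsk : `|simple_integral P t - simple_integral P (s k)| <= 2 * eps + e / 2.
  rewrite -lee_fin; apply: le_trans (simple_integral_dist st (ss k)) _.
  apply: (@le_trans _ _ (\int[P]_w (`|f w - t w|%:E + `|f w - s k w|%:E))%E).
    apply: ge0_le_integral => //.
    - apply/measurable_EFinP; apply: networked_norm_dist; exact: simple_map_networked.
    - by apply: emeasurable_funD; apply/measurable_EFinP.
    - move=> w _; rewrite -EFinD lee_fin (distrC (f w) (t w)).
      exact: ler_distD.
  rewrite ge0_integralD//; last 2 first.
  - by apply/measurable_EFinP.
  - by apply/measurable_EFinP.
  by rewrite EFinD leeD.
rewrite -(subrK (simple_integral P (s k)) (simple_integral P t)).
by apply: le_trans (ler_normD _ _) _; lra.
Qed.

End simple_integrals.

(** Brings a step of order [n ^ (- 1 / alpha)] into the form of [sum_min_powR], with [y = a ^ alpha]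
    and the exponent [2 / alpha], which exceeds 1 when [alpha < 2]. *)
Lemma powR_div_sq (R : realType) (a n alpha : R) : 0 <= a -> 0 < n -> 0 < alpha ->
  (a `^ alpha / n) `^ (2 / alpha) = (a * n `^ (- alpha^-1)) ^+ 2.
Proof.
move=> a0 n0 al0; have v0 : 0 <= n `^ (- alpha^-1) by exact: powR_ge0.
have -> : a `^ alpha / n = (a * n `^ (- alpha^-1)) `^ alpha.
  rewrite (powRM alpha a0 v0) -powRrM mulNr mulVf ?gt_eqF//.
  by rewrite powR_inv1// ltW.
rewrite -powRrM mulrCA divff ?gt_eqF// mulr1 powR_mulrn//.
exact: mulr_ge0.
Qed.

Section borel_functionals.
Context {R : realType} {B : completeNormedModType R}.
Local Notation BB := (g_sigma_algebraType (@open B)).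

Lemma measurable_borel_fun (phi : B -> R) :
  @measurable_fun _ _ BB R setT phi -> borel_fun phi.
Proof.
move=> mphi A bA; apply: (@measurable_preimage_borel _ BB R phi) => // V oV.
by rewrite -[X in measurable X]setTI; apply: mphi => //; exact: open_measurable.
Qed.

Lemma measurable_norm : @measurable_fun _ _ BB R setT (fun x : B => `|x|).
Proof.
apply: (@measurable_fun_open _ BB) => V oV; apply: borel_open.
by apply: open_comp => // x _; exact: norm_continuous.
Qed.

Lemma borel_fun_norm_cell v (eps : R) i : borel_fun (fun x : B => `|x| * \1_(cell v eps i) x).
Proof.
apply: measurable_borel_fun; apply: measurable_funM; first exact: measurable_norm.
by apply: measurable_indic; exact: cell_borel.
Qed.

Lemma borel_fun_norm_powR (p : R) : borel_fun (fun x : B => `|x| `^ p).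
Proof.
apply: measurable_borel_fun.
exact: (measurableT_comp (measurable_powR p) measurable_norm).
Qed.

Lemma borel_fun_trunc_sq (b : R) : borel_fun (fun x : B => Num.min 1 ((b * `|x|) ^+ 2)).
Proof.
apply: measurable_borel_fun; apply: measurable_minr; first exact: measurable_cst.
apply: measurable_funX; apply: measurable_funM; first exact: measurable_cst.
exact: measurable_norm.
Qed.

End borel_functionals.

(** * From the noise conditions to discretization and truncated moments *)

Section noise_conditions.
Context {d : measure_display} {T : measurableType d} {R : realType}.
Context (P : probability T R) {B : completeNormedModType R} (Y : nat -> T -> B).
Hypothesis sY : forall n, strongly_measurable (Y n).

Let discretized := forall eps : R, 0 < eps -> exists v : seq B, forall n,
    (\int[P]_w (`|Y n w| * \1_(cell v eps (size v)) (Y n w))%:E <= eps%:E)%E /\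
    `|\sum_(i < size v) fine (P (Y n @^-1` cell v eps i)) *: nth 0 v i| <= 2 * eps.

Let mY n A : borel_set A -> measurable (Y n @^-1` A).
Proof. by apply: measurable_preimage_borel => S oS; exact: strongly_measurable_open. Qed.

Let mphi n (phi : B -> R) : borel_fun phi -> measurable_fun setT (fun w => phi (Y n w)).
Proof.
move=> bphi; apply: (borel_fun_measurable (f := Y n)) => //.
exact: strongly_measurable_networked.
Qed.

Lemma identically_distributed_discretized :
  identically_distributed P Y -> has_bochner_integral P (Y 0%N) 0 -> discretized.
Proof.
move=> idY bY eps eps0; have [v rv] := bochner_residual bY eps0.
exists v => n; split.
  rewrite (identically_distributed_integral sY idY n (borel_fun_norm_cell v eps (size v)))//.
apply: le_trans (bochner_mean_le bY eps0 rv).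
rewrite le_eqVlt; apply/orP; left; apply/eqP; congr (`| _ |).
by apply: eq_bigr => i _; rewrite (idY n 0%N _ (cell_borel _ _ _)).
Qed.

(** A finite subcover of the compact set by [eps]-balls supplies the centers; whatever no ball
    covers is outside the compact set. *)
Lemma tight_cells : tight P Y -> forall eps delta : R, 0 < eps -> 0 < delta ->
  exists v : seq B, forall n, (P (Y n @^-1` cell v eps (size v)) <= delta%:E)%E.
Proof.
move=> tY eps delta eps0 delta0; have [K [cK PK]] := tY _ delta0.
have bK : borel_set K.
  rewrite -[K]setCK; apply: borelC; apply: borel_open; apply: closed_openC.
  by apply: compact_closed => //; exact: norm_hausdorff.
have := cK; rewrite compact_cover => /(_ B setT (fun c => ball c eps)).
case=> [c _|x Kx|v _ Kv]; first exact: ball_open.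
  by exists x => //; exact: ballxx.
exists v => n; set E := _ @^-1` _.
have mE : measurable E by apply: mY; exact: cell_borel.
have mK : measurable (Y n @^-1` K) by exact: mY.
rewrite -[E]setCK probability_setC; last exact: measurableC.
have KE : Y n @^-1` K `<=` ~` E.
  move=> w /Kv[c /= cv]; rewrite -ball_normE /= distrC => wc.
  rewrite /E /cell /= => fw.
  have : has (fun c => `|Y n w - c| < eps) v by apply/hasP; exists c.
  by rewrite has_find fw ltnn.
have H : ((1 - delta)%:E <= P (~` E))%E.
  by apply: le_trans (PK n) _; apply: le_measure KE; apply/mem_set => //; exact: measurableC.
rewrite leeBlDl ?fin_num_measure//; last exact: measurableC.
move: H; rewrite EFinB leeBlDr//; exact.
Qed.

(** Uniform integrability: [|Y|] on the uncovered cell is at most [L] there plus [eps / (2 M)] times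
    [|Y| ^ alpha], because [|Y| > L] forces [|Y| ^ (alpha - 1) >= 2 M / eps]. Each part contributes
    [eps / 2]. *)
Lemma tight_discretized (alpha M : R) : tight P Y -> 1 < alpha -> 0 < M ->
  (forall n, (\int[P]_w (`|Y n w| `^ alpha)%:E <= M%:E)%E) ->
  (forall n, has_bochner_integral P (Y n) 0) -> discretized.
Proof.
move=> tY alpha1 M0 YM bY eps eps0.
have k0 : 0 < 2 * M / eps by rewrite divr_gt0// mulr_gt0.
(* Beyond level [L] the moment bound controls the residual, below it tightness. *)
pose L := (2 * M / eps) `^ (alpha - 1)^-1.
have a10 : 0 < alpha - 1 by rewrite subr_gt0.
have L0 : 0 < L by exact: powR_gt0.
have LE : L `^ (alpha - 1) = 2 * M / eps.
  by rewrite /L -powRrM mulVf ?gt_eqF// powRr1// ltW.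
have del0 : 0 < eps / (2 * L) by rewrite divr_gt0// mulr_gt0.
have [v Pv] := tight_cells tY eps0 del0.
suff res n : (\int[P]_w (`|Y n w| * \1_(cell v eps (size v)) (Y n w))%:E <= eps%:E)%E.
  by exists v => n; split; [exact: res|exact: bochner_mean_le].
pose bad := Y n @^-1` cell v eps (size v).
have mbad : measurable bad by apply: mY; exact: cell_borel.
have mpow : measurable_fun setT (fun w => (`|Y n w| `^ alpha)%:E).
  by apply/measurable_EFinP; exact: (mphi _ (borel_fun_norm_powR _)).
have k0' : 0 <= eps / (2 * M) by rewrite divr_ge0 ?mulr_ge0 ?ltW.
apply: (@le_trans _ _ (\int[P]_w (L%:E * (\1_bad w)%:E
    + (eps / (2 * M))%:E * (`|Y n w| `^ alpha)%:E))%E).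
  apply: ge0_le_integral => //.
  - by apply/measurable_EFinP; exact: (mphi _ (borel_fun_norm_cell _ _ _)).
  - apply: emeasurable_funD; last exact: measurable_funeM.
    by apply: measurable_funeM; apply/measurable_EFinP; exact: measurable_indic.
  - move=> w _; rewrite -!EFinM -EFinD lee_fin.
    rewrite [X in _ * X](_ : _ = \1_bad w) //.
    have [yL|Ly] := leP `|Y n w| L.
      rewrite ler_wpDr//; first by rewrite mulr_ge0// powR_ge0.
      by rewrite ler_wpM2r// indicE.
    have y0 : 0 < `|Y n w| := lt_trans L0 Ly.
    rewrite ler_wpDl//; first by rewrite mulr_ge0// ?ltW// indicE.
    apply: (@le_trans _ _ `|Y n w|).
      by rewrite ler_piMr// indicE; case: (_ \in _); rewrite ?ler01 ?lexx.
    have kE : eps / (2 * M) = (L `^ (alpha - 1))^-1 by rewrite LE invf_div.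
    rewrite kE ler_pdivlMl ?powR_gt0//.
    have -> : `|Y n w| `^ alpha = `|Y n w| `^ (alpha - 1) * `|Y n w|.
      by rewrite -[X in _ * X]powRr1// -powRD ?subrK// (gt_eqF y0) implybT.
    rewrite ler_wpM2r//; apply: ge0_ler_powR; rewrite ?nnegrE ?(ltW a10)//; exact: ltW.
rewrite ge0_integralD//; last 4 first.
- by move=> w _; rewrite mule_ge0// lee_fin ?ltW// indicE.
- by apply: measurable_funeM; apply/measurable_EFinP; exact: measurable_indic.
- by move=> w _; rewrite mule_ge0// lee_fin// powR_ge0.
- exact: measurable_funeM.
rewrite ge0_integralZl_EFin//; last 2 first.
- by apply/measurable_EFinP; exact: measurable_indic.
- exact: ltW.
rewrite ge0_integralZl_EFin// integral_indic// setIT.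
rewrite [eps in leRHS]splitr EFinD; apply: leeD.
  have L0E : (0 <= L%:E)%E by rewrite lee_fin ltW.
  apply: le_trans (lee_wpmul2l L0E (Pv n)) _.
  rewrite -EFinM lee_fin le_eqVlt; apply/orP; left; apply/eqP; field.
  by rewrite gt_eqF.
have k0E : (0 <= (eps / (2 * M))%:E)%E by rewrite lee_fin.
apply: le_trans (lee_wpmul2l k0E (YM n)) _.
rewrite -EFinM lee_fin le_eqVlt; apply/orP; left; apply/eqP; field.
by rewrite gt_eqF.
Qed.

Context (beta : nat -> R).
Hypothesis beta_gt0 : forall n, 0 < beta n.
Let trunc n w := Num.min 1 ((beta n * `|Y n w|) ^+ 2).

Let trunc_ge0 n w : 0 <= trunc n w.
Proof. by rewrite le_min ler01 sqr_ge0. Qed.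

Let trunc_le1 n : (\int[P]_w (trunc n w)%:E <= 1)%E.
Proof.
apply: (@le_trans _ _ (\int[P]_w (cst 1%E w))%E).
  apply: ge0_le_integral => //.
  - by move=> w _; rewrite lee_fin.
  - by apply/measurable_EFinP; exact: (mphi _ (borel_fun_trunc_sq _)).
  - by move=> w _; rewrite lee_fin ge_min lexx.
by rewrite (integral_cst P measurableT 1%E) mul1e le_eqVlt; apply/orP; left; apply/eqP; exact: probability_setT.
Qed.

Let trunc_fin n : (\int[P]_w (trunc n w)%:E)%E \is a fin_num.
Proof.
rewrite ge0_fin_numE; first exact: le_lt_trans (trunc_le1 n) (ltry _).
by apply: integral_ge0 => w _; rewrite lee_fin.
Qed.

Let Etrunc n : (\int[P]_w trunc n w)%:E = (\int[P]_w (trunc n w)%:E)%E.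
Proof. by rewrite /Rintegral fineK. Qed.

Let Rtrunc_ge0 n : 0 <= \int[P]_w trunc n w.
Proof. by rewrite -lee_fin Etrunc; apply: integral_ge0 => w _; rewrite lee_fin. Qed.

(** [min 1 (t ^+ 2) <= t ^ alpha] for [alpha <= 2], so the series is dominated by
    [M * beta n ^ alpha]. *)
Lemma moment_trunc_cvg (alpha M : R) : 0 < alpha <= 2 ->
  (forall n, (\int[P]_w (`|Y n w| `^ alpha)%:E <= M%:E)%E) ->
  cvgn (series (fun n => beta n `^ alpha)) ->
  cvgn (series (fun n => \int[P]_w Num.min 1 ((beta n * `|Y n w|) ^+ 2))).
Proof.
move=> a02 YM bC.
have M0 : 0 <= M.
  by rewrite -lee_fin; apply: le_trans (YM 0%N); apply: integral_ge0 => w _; rewrite lee_fin powR_ge0.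
apply: (@series_le_cvg _ _ (fun n => M * beta n `^ alpha)) => //.
- by move=> n; rewrite mulr_ge0 ?powR_ge0.
- move=> n; rewrite -lee_fin Etrunc.
  apply: (@le_trans _ _ (\int[P]_w ((beta n `^ alpha)%:E * (`|Y n w| `^ alpha)%:E))%E).
    apply: ge0_le_integral => //.
    + by move=> w _; rewrite lee_fin.
    + by apply/measurable_EFinP; exact: (mphi _ (borel_fun_trunc_sq _)).
    + apply: measurable_funeM; apply/measurable_EFinP; exact: (mphi _ (borel_fun_norm_powR _)).
    + move=> w _; rewrite -EFinM lee_fin -powRM// ?(ltW (beta_gt0 n))//.
      by apply: min_sq_powR => //; rewrite mulr_ge0// ltW.
  rewrite ge0_integralZl_EFin ?powR_ge0//; last first.
    by apply/measurable_EFinP; exact: (mphi _ (borel_fun_norm_powR _)).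
  rewrite mulrC EFinM; apply: lee_wpmul2l (YM n).
  by rewrite lee_fin powR_ge0.
- exact: is_cvg_seriesZ.
Qed.

(** [beta n ^ alpha] may be of order [1 / n], so bounding each term by its moment of order [alpha]
    would not do. The sum is taken inside the expectation, where [sum_min_powR] bounds it pathwise
    by a constant times [|Y 0| ^ alpha]. *)
Lemma iid_trunc_cvg (alpha D M : R) : 0 < alpha < 2 -> 0 < D ->
  identically_distributed P Y ->
  (\int[P]_w (`|Y 0%N w| `^ alpha)%:E <= M%:E)%E ->
  (forall n, (1 <= n)%N -> beta n <= D * n%:R `^ (- alpha^-1)) ->
  cvgn (series (fun n => \int[P]_w Num.min 1 ((beta n * `|Y n w|) ^+ 2))).
Proof.
move=> /andP[a0 a2] D0 idY YM bD.
pose p := 2 / alpha; have p1 : 1 < p by rewrite ltr_pdivlMr// mul1r.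
pose K := 2 `^ p / (p - 1); have K0 : 0 <= K.
  by rewrite divr_ge0 ?powR_ge0// subr_ge0 ltW.
pose y w := (D * `|Y 0%N w|) `^ alpha.
have mmin n : measurable_fun setT (fun w => (Num.min 1 ((y w / n%:R) `^ p))%:E).
  apply/measurable_EFinP; apply: measurable_minr; first exact: measurable_cst.
  apply: (measurableT_comp (measurable_powR p)).
  apply: measurable_funM; last exact: measurable_cst.
  apply: (measurableT_comp (measurable_powR alpha)).
  apply: measurable_funM; first exact: measurable_cst.
  exact: (mphi _ (measurable_borel_fun measurable_norm)).
have min0 n w : 0 <= Num.min 1 ((y w / n%:R) `^ p).
  by rewrite le_min ler01 powR_ge0.
have step n : (0 < n)%N -> (\int[P]_w (trunc n w)%:E <=
    \int[P]_w (Num.min 1 ((y w / n%:R) `^ p))%:E)%E.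
  move=> n0; rewrite (identically_distributed_integral sY idY n (borel_fun_trunc_sq (beta n))).
    apply: ge0_le_integral => //.
    - by move=> w _; rewrite lee_fin le_min ler01 sqr_ge0.
    - by apply/measurable_EFinP; exact: (mphi _ (borel_fun_trunc_sq _)).
    - move=> w _; rewrite lee_fin le_min ge_min lexx /= ge_min; apply/orP; right.
      have n0' : 0 < n%:R :> R by rewrite ltr0n.
      have -> : (y w / n%:R) `^ p = (D * n%:R `^ (- alpha^-1) * `|Y 0%N w|) ^+ 2.
        by rewrite mulrAC; apply: powR_div_sq => //; rewrite mulr_ge0// ltW.
      have bn0 := ltW (beta_gt0 n).
      rewrite ler_sqr ?nnegrE ?mulr_ge0 ?powR_ge0 ?(ltW D0)//.
      by rewrite ler_wpM2r// bD.
  by move=> x; rewrite le_min ler01 sqr_ge0.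
apply: nondecreasing_is_cvgn.
  apply/nondecreasing_seqP => n; rewrite /series /= big_nat_recr//= lerDl.
  exact: Rtrunc_ge0.
exists (1 + K * (D `^ alpha * M)) => _ [N _ <-].
(* Passing to [N.+1] lets the term [n = 0], on which the decay bound is silent, be split off; it is
   at most [1]. *)
apply: (@le_trans _ _ (series (fun n => \int[P]_w trunc n w) N.+1)).
  by rewrite [leRHS]/series /= big_nat_recr//= lerDl.
rewrite /series /= big_nat_recl//= lerD//.
  by rewrite -lee_fin Etrunc.
rewrite -lee_fin -sumEFin.
apply: (@le_trans _ _ (\sum_(0 <= n < N) \int[P]_w (Num.min 1 ((y w / n.+1%:R) `^ p))%:E)%E).
  by apply: lee_sum => n _; rewrite Etrunc; exact: step.
rewrite -ge0_integral_sum//; last by move=> n w _; rewrite lee_fin.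
apply: (@le_trans _ _ (\int[P]_w ((K * D `^ alpha)%:E * (`|Y 0%N w| `^ alpha)%:E))%E).
  apply: ge0_le_integral => //.
  - by move=> w _; apply: sume_ge0 => n _; rewrite lee_fin.
  - exact: emeasurable_sum.
  - apply: measurable_funeM; apply/measurable_EFinP; exact: (mphi _ (borel_fun_norm_powR _)).
  - move=> w _; rewrite sumEFin -EFinM lee_fin.
    rewrite -mulrA -powRM ?(ltW D0)// -/(y w).
    have := @sum_min_powR _ p (y w) N.+1 p1 (powR_ge0 _ _).
    by rewrite big_add1.
rewrite ge0_integralZl_EFin//; last 2 first.
- by apply/measurable_EFinP; exact: (mphi _ (borel_fun_norm_powR _)).
- by rewrite mulr_ge0// powR_ge0.
rewrite mulrA EFinM; apply: lee_wpmul2l YM.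
by rewrite lee_fin mulr_ge0// powR_ge0.
Qed.

End noise_conditions.

Section step_sizes.
Context {R : realType} (beta : nat -> R).
Hypothesis beta01 : forall n, 0 < beta n < 1.

Lemma powR_step_sq_cvg (alpha : R) : alpha <= 2 ->
  cvgn (series (fun n => beta n `^ alpha)) -> cvgn (series (fun n => beta n ^+ 2)).
Proof.
move=> a2; apply: series_le_cvg => [n|n|n]; [exact: sqr_ge0|exact: powR_ge0|].
have /andP[b0 b1] := beta01 n.
by rewrite -powR_mulrn ?(ltW b0)//; apply: ger_powR; rewrite ?b0 ?(ltW b1).
Qed.

(** [beta n ^+ 2] is at most [min 1 ((D ^ alpha / n) ^ (2 / alpha))] for [n >= 1]: the deterministic
    case of the same power sum. *)
Lemma decay_step_sq_cvg (alpha D : R) : 0 < alpha < 2 -> 0 < D ->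
  (forall n, (1 <= n)%N -> beta n <= D * n%:R `^ (- alpha^-1)) ->
  cvgn (series (fun n => beta n ^+ 2)).
Proof.
move=> /andP[a0 a2] D0 bD.
pose p := 2 / alpha; have p1 : 1 < p by rewrite ltr_pdivlMr// mul1r.
apply: nondecreasing_is_cvgn.
  by apply/nondecreasing_seqP => n; rewrite /series /= big_nat_recr//= lerDl sqr_ge0.
exists (1 + 2 `^ p / (p - 1) * D `^ alpha) => _ [N _ <-].
apply: (@le_trans _ _ (series (fun n => beta n ^+ 2) N.+1)).
  by rewrite [leRHS]/series /= big_nat_recr//= lerDl sqr_ge0.
have b1 n : beta n ^+ 2 <= 1.
  by have /andP[b0 b1] := beta01 n; rewrite expr_le1// ltW.
rewrite /series /= big_nat_recl//= lerD//.
apply: le_trans (sum_min_powR N.+1 p1 (powR_ge0 D alpha)).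
rewrite big_add1 /=; apply: ler_sum => n _.
have n0 : 0 < n.+1%:R :> R by rewrite ltr0n.
have /andP[b0 _] := beta01 n.+1.
rewrite le_min b1 (powR_div_sq (ltW D0) n0 a0) /=.
by rewrite ler_sqr ?nnegrE ?mulr_ge0 ?powR_ge0 ?(ltW b0) ?(ltW D0)// bD.
Qed.

End step_sizes.

(* The sequence (W_n)_{n >= 1} is [fun n => W n.+1]; the value [W 0] is unused. *)
Theorem theorem1 (R : realType) (B : completeNormedModType R)
  (d : measure_display) (T : measurableType d) (P : probability T R)
  (G : B -> B) (tau rho : R) (xstar : B)
  (beta : nat -> R)
  (lambda : forall n : nat, {ptws 'I_n.+1 -> B} -> R) (C : R)
  (W : nat -> T -> B) (x0 : B) (X : nat -> T -> B)
  (G_borel : borel_fun G)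
  (tau_gt0 : 0 < tau) (rho_lt1 : rho < 1)
  (G_contr : forall x : B,
    `|x - xstar - tau *: G x| <= rho * `|x - xstar|)
  (beta01 : forall n, 0 < beta n < 1)
  (beta_cvg0 : beta n @[n --> \oo] --> 0)
  (beta_sum : (\sum_(0 <= n <oo) (beta n)%:E)%E = +oo%E)
  (lambda_borel : forall n, borel_fun (lambda n))
  (lambda_bound : forall (n : nat) (u : {ptws 'I_n.+1 -> B}),
    `|lambda n u| <= C * (1 + \big[Num.max/0]_(k < n.+1) `|u k|))
  (W_meas : forall n, strongly_measurable (W n.+1))
  (W_indep : mutually_independent P (fun n => W n.+1))
  (X_init : forall w, X 0%N w = x0)
  (X_rec : forall n w,
    X n.+1 w = X n w
      - beta n *: (G (X n w)
                   + lambda n (fun k : 'I_n.+1 => X k w) *: W n.+1 w))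
  (J : (* (J1) *)
    [/\ iid P (fun n => W n.+1),
        ('E_P[(fun w => `|W 1%N w| ^+ 2)%R] < +oo)%E,
        has_bochner_integral P (W 1%N) 0
      & (\sum_(0 <= n <oo) (beta n ^+ 2)%:E < +oo)%E]
    \/ (* (J2) *)
    (iid P (fun n => W n.+1) /\
     exists alpha D : R,
      [/\ 1 <= alpha < 2, 0 < D,
          ('E_P[(fun w => `|W 1%N w| `^ alpha)%R] < +oo)%E,
          has_bochner_integral P (W 1%N) 0
        & forall n, (1 <= n)%N -> beta n <= D * n%:R `^ (- alpha^-1)])
    \/ (* (J3) *)
    [/\ forall n, has_bochner_integral P (W n.+1) 0,
        tight P (fun n => W n.+1)
      & exists alpha : R,
        [/\ 1 < alpha <= 2,
            (ereal_sup (range (fun n => 'E_P[(fun w => `|W n.+1 w| `^ alpha)%R]))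
               < +oo)%E
          & (\sum_(0 <= n <oo) (beta n `^ alpha)%:E < +oo)%E]]) :
  {ae P, forall w, X n w @[n --> \oo] --> xstar}.
Proof.
have b0 n : 0 < beta n by have /andP[] := beta01 n.
pose Y n := W n.+1.
have moment alpha : ('E_P[(fun w => `|W 1%N w| `^ alpha)%R] < +oo)%E ->
    exists2 M : R, 0 < M & (\int[P]_w (`|Y 0%N w| `^ alpha)%:E <= M%:E)%E.
  rewrite unlock => Eoo; set E := (\int[P]_w _)%E in Eoo.
  have E0 : (0 <= E)%E by apply: integral_ge0 => w _; rewrite lee_fin powR_ge0.
  exists (fine E + 1); first by rewrite ltr_wpDl ?fine_ge0.
  rewrite EFinD fineK ?ge0_fin_numE// leeDl//.
(* The common content of the three conditions: square summable steps, summable truncated moments,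
   and centers that work for every [n]. *)
suff [bsq tr dis] : [/\ cvgn (series (fun n => beta n ^+ 2)),
    cvgn (series (fun n => \int[P]_w Num.min 1 ((beta n * `|Y n w|) ^+ 2))) &
    forall eps : R, 0 < eps -> exists v : seq B, forall n,
      (\int[P]_w (`|Y n w| * \1_(cell v eps (size v)) (Y n w))%:E <= eps%:E)%E /\
      `|\sum_(i < size v) fine (P (Y n @^-1` cell v eps i)) *: nth 0 v i| <= 2 * eps].
  exact: (stochastic_approximation_cvg (Y := Y) W_meas W_indep G_borel tau_gt0
    rho_lt1 G_contr b0 beta_cvg0 beta_sum lambda_borel lambda_bound X_init X_rec).
have idM alpha M n : identically_distributed P Y ->
    (\int[P]_w (`|Y 0%N w| `^ alpha)%:E <= M%:E)%E ->
    (\int[P]_w (`|Y n w| `^ alpha)%:E <= M%:E)%E.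
  move=> idY YM; apply: le_trans YM.
  rewrite le_eqVlt; apply/orP; left; apply/eqP.
  by apply: (identically_distributed_integral W_meas idY n (borel_fun_norm_powR alpha)) => x; exact: powR_ge0.
case: J => [[[_ idY] W2 bW b2]|[[[_ idY] [alpha [D [/andP[a1 a2] D0 Wa bW bD]]]]|
    [bW tW [alpha [/andP[a1 a2] Wa ba]]]]].
- have bsq : cvgn (series (fun n => beta n ^+ 2)).
    by apply: ereal_cvgn_series => // n; exact: sqr_ge0.
  have [M M0 YM] : exists2 M : R, 0 < M & (\int[P]_w (`|Y 0%N w| `^ 2)%:E <= M%:E)%E.
    apply: moment; move: W2; congr (_ < _)%E; congr (expectation _ _).
    by apply/funext => w; rewrite powR_mulrn.
  split=> //.
  + apply: (moment_trunc_cvg W_meas b0 (alpha := 2) (M := M)).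
    * by rewrite ltr0n lexx.
    * by move=> n; exact: idM.
    * rewrite (_ : (fun n => _) = (fun n => beta n ^+ 2))//.
      by apply/funext => n; rewrite powR_mulrn// ltW.
  + exact: identically_distributed_discretized.
- have a0 : 0 < alpha := lt_le_trans ltr01 a1.
  have a02 : 0 < alpha < 2 by rewrite a0.
  have [M _ YM] := moment _ Wa.
  split.
  + exact: decay_step_sq_cvg bD.
  + exact: iid_trunc_cvg YM bD.
  + exact: identically_distributed_discretized.
- have [M M0 YM] : exists2 M : R, 0 < M &
      forall n, (\int[P]_w (`|Y n w| `^ alpha)%:E <= M%:E)%E.
    move: Wa; set S := ereal_sup _ => Soo.
    have SY n : (\int[P]_w (`|Y n w| `^ alpha)%:E <= S)%E.
      by apply: ereal_sup_ubound; exists n => //; rewrite unlock.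
    have S0 : (0 <= S)%E.
      by apply: le_trans (SY 0%N); apply: integral_ge0 => w _; rewrite lee_fin powR_ge0.
    exists (fine S + 1); first by rewrite ltr_wpDl ?fine_ge0.
    move=> n; apply: le_trans (SY n) _.
    by rewrite EFinD fineK ?ge0_fin_numE// leeDl.
  have bC : cvgn (series (fun n => beta n `^ alpha)).
    by apply: ereal_cvgn_series => // n; exact: powR_ge0.
  split.
  + exact: powR_step_sq_cvg a2 bC.
  + apply: (moment_trunc_cvg W_meas b0 _ YM) => //.
    by rewrite a2 andbT (lt_trans ltr01).
  + exact: tight_discretized YM bW.
Qed.
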